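(* For a positive integer $N$ and a real number $k>0$ define the pseudomoment \[\mathcal{M}_k(N)=\lim_{T\to\infty}\frac{1}{T}\int_0^T\Big|\sum_{n=1}^N n^{-1/2-it}\Big|^{2k}\,dt .\] There exist constants $c>0$, $C_1>0$ such that the following hold as $N\to\infty$, where the implied constants in the $O(k^2)$ terms are absolute. (i) Uniformly for real $2\le k\le c\sqrt{\log\log N}$, \[\frac{\mathcal{M}_k(N)}{(\log N)^{k^2}}\ \ge\ \exp\big(-k^2\log k-k^2\log\log k+O(k^2)\big).\] (ii) Uniformly for real $2\le k\le C_1\log N/\log\log N$, \[\frac{\mathcal{M}_k(N)}{(\log N)^{k^2}}\ \le\ \exp\big(-k^2\log k-k^2\log\log k+O(k^2)\big).\] (iii) The upper bound in (ii) does not hold for $k=C_2\log N/\log\log N$, when $C_2$ is a sufficiently large constant (depending on the implied constant in the $O(k^2)$ term).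
   Context: Here $\log$ is the natural logarithm; $N$ and $k$ are assumed large enough that all iterated logarithms appearing are positive. *)

(* Defs.v *)
From Stdlib Require Import Reals.
From Coquelicot Require Import Coquelicot.
Open Scope R_scope.

Fixpoint dsum (f : nat -> R) (N : nat) : R :=
  match N with
  | O => 0
  | S m => dsum f m + f (S m)
  end.

(* x ^ y for x >= 0 and real y > 0, with the convention 0 ^ y = 0
   (Stdlib's Rpower 0 y would give 1). *)
Definition rpow (x y : R) : R :=
  if Rle_dec x 0 then 0 else Rpower x y.

(* n^{-1/2-it} = n^{-1/2} (cos (t log n) - i sin (t log n)) *)
Definition DirRe (N : nat) (t : R) : R :=
  dsum (fun n => / sqrt (INR n) * cos (t * ln (INR n))) N.
Definition DirIm (N : nat) (t : R) : R :=
  dsum (fun n => - (/ sqrt (INR n) * sin (t * ln (INR n)))) N.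

(* |sum_{n<=N} n^{-1/2-it}|^{2k} = (|.|^2)^k *)
Definition DirPow (k : R) (N : nat) (t : R) : R :=
  rpow (DirRe N t ^ 2 + DirIm N t ^ 2) k.

Definition pseudomoment (k : R) (N : nat) : R :=
  real (Lim (fun T => / T * RInt (DirPow k N) 0 T) p_infty).

Definition normmoment (k : R) (N : nat) : R :=
  pseudomoment k N / Rpower (ln (INR N)) (k ^ 2).

(* Main.v *)
Require Import Defs.
From Stdlib Require Import Reals Lra Lia List Permutation.
From Coquelicot Require Import Coquelicot.
From mathcomp Require prime.
Import ListNotations.
Open Scope R_scope.

(* Write [F] for the Dirichlet polynomial and [E] for the mean value over [t].

   Upper bound: with [s = k / log N] and [Z] the Euler product over [p <= N] at [1/2 + s + it],
   Rankin's trick becomes an inequality for all real [k >= 2] through M. Riesz's theorem. Cutting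
   [Z] at [n <= N] costs a factor [k^O(k)], because [2 k^2 u^2 (1 + v^2)^(k-1) - (1 + v^2)^k] is
   subharmonic and so has nonnegative mean, up to a constant, along [u + iv] analytic; moving the
   boundary by [s] into the half-plane undoes the weight [n^(-s)] at the cost [N^(2ks) = e^(2k^2)].
   Finally [E |Z|^(2k)] factors over primes: those up to [16 k^2] contribute [e^(O(k^2))], the others
   [exp (k^2 sum p^(-1-2s)) = exp (k^2 (log log N - log k - log log k + O(1)))].

   Lower bound: test [F] against [G = prod (1 + k z_p + (k-1) conj z_p)], [z_p = p^(-1/2-it)], over
   [256 k^4 < p <= N^(1/(4k))]. To second order [G] is [Z |Z|^(2k-2)], the extremal function of
   Hölder's inequality, whence [E |F|^(2k) >= exp (k^2 sum 1/p - O(k^2))].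

   For [k = C log N / log log N] with [C] large, the bound of (ii) would force the pseudomoment below
   [e^(-k^2)], whereas the choice [G = 1] shows that it is at least [e^(-O(k))]. *)

(** * Sums and time averages *)

(** For integral [k], Rankin's trick compares the nonnegative coefficients of [F^k] with those of
    [Z^k]; a fractional power of [F] offers no such comparison. Norms take its place: up to weights,
    [F] is the part of a rotated [Z] whose frequencies have one sign, so a conjugate-function
    estimate applies. Its constant may be as poor as [k^O(k)], because [k log k <= k^2].

    The order [k / log N] of [s] is the largest that leaves [N^(2ks)] at [e^O(k^2)]; the prime sum
    then stops near [log (1/s)]. Thresholds for primes come from third-order errors:
    [k^3 sum p^(-3/2)] over [p > X] is [O(k^2)] once [X] has order [k^2]. In the lower bound the
    dual exponent raises the norm of [G] to the power [2k - 1], the error becomes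
    [k^4 sum p^(-3/2)], and [X] has order [k^4], which moves [log log X] by [O(1)] only. The upper
    end [N^(1/(4k))] ensures that the cutoff at [N] loses at most half of the main term.

    Products over primes are averaged exactly: each factor is first majorised pointwise by a
    trigonometric polynomial whose third-order error sits in the constant coefficient. *)

Definition lsum {A} (f : A -> R) (l : list A) : R := fold_right (fun x s => f x + s) 0 l.
Definition lprod {A} (f : A -> R) (l : list A) : R := fold_right (fun x s => f x * s) 1 l.

Lemma lsum_app {A} (f : A -> R) l l' : lsum f (l ++ l') = lsum f l + lsum f l'.
Proof. induction l as [|x l IH]; simpl; [lra|rewrite IH; lra]. Qed.

Lemma lsum_map {A B} (f : B -> R) (g : A -> B) l : lsum f (map g l) = lsum (fun x => f (g x)) l.
Proof. induction l as [|x l IH]; simpl; [easy|now rewrite IH]. Qed.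

Lemma lsum_le {A} (f g : A -> R) l : (forall x, In x l -> f x <= g x) -> lsum f l <= lsum g l.
Proof.
  induction l as [|x l IH]; simpl; intros H; [lra|].
  apply Rplus_le_compat; auto.
Qed.

Lemma lsum_ext {A} (f g : A -> R) l : (forall x, In x l -> f x = g x) -> lsum f l = lsum g l.
Proof. intros H; apply Rle_antisym; apply lsum_le; intros x Hx; rewrite (H x Hx); lra. Qed.

Lemma lsum_nonneg {A} (f : A -> R) l : (forall x, In x l -> 0 <= f x) -> 0 <= lsum f l.
Proof.
  intros H; induction l as [|x l IH]; simpl; [lra|].
  apply Rplus_le_le_0_compat; [apply H; now left|apply IH; intros y Hy; apply H; now right].
Qed.

Lemma lsum_scal {A} c (f : A -> R) l : lsum (fun x => c * f x) l = c * lsum f l.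
Proof. induction l as [|x l IH]; simpl; [ring|rewrite IH; ring]. Qed.

Lemma lsum_plus {A} (f g : A -> R) l : lsum (fun x => f x + g x) l = lsum f l + lsum g l.
Proof. induction l as [|x l IH]; simpl; [ring|rewrite IH; ring]. Qed.

Lemma lsum_swap {A B} (f : A -> B -> R) l l' :
  lsum (fun x => lsum (f x) l') l = lsum (fun y => lsum (fun x => f x y) l) l'.
Proof.
  induction l as [|x l IH]; simpl.
  - induction l' as [|y l' IH']; simpl; [easy|rewrite <- IH'; ring].
  - rewrite IH; symmetry; exact (lsum_plus (f x) _ l').
Qed.

Lemma lsum_perm {A} (f : A -> R) l l' : Permutation l l' -> lsum f l = lsum f l'.
Proof. induction 1; simpl; lra. Qed.

Lemma lprod_pos {A} (f : A -> R) l : (forall x, In x l -> 0 < f x) -> 0 < lprod f l.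
Proof.
  intros H; induction l as [|x l IH]; simpl; [lra|].
  apply Rmult_lt_0_compat; [apply H; now left|apply IH; intros y Hy; apply H; now right].
Qed.

Lemma lprod_le {A} (f g : A -> R) l :
  (forall x, In x l -> 0 <= f x <= g x) -> 0 <= lprod f l <= lprod g l.
Proof.
  induction l as [|x l IH]; simpl; intros H; [lra|].
  destruct IH as [I1 I2]; [auto|].
  destruct (H x (or_introl eq_refl)) as [H1 H2].
  split; [now apply Rmult_le_pos|now apply Rmult_le_compat].
Qed.

Lemma lprod_mult {A} (f g : A -> R) l : lprod (fun x => f x * g x) l = lprod f l * lprod g l.
Proof. induction l as [|x l IH]; simpl; [ring|rewrite IH; ring]. Qed.

Lemma lprod_exp {A} (f : A -> R) l : lprod (fun x => exp (f x)) l = exp (lsum f l).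
Proof. induction l as [|x l IH]; simpl; [now rewrite exp_0|now rewrite IH, exp_plus]. Qed.

Lemma lsum_seq_S (f : nat -> R) s n : lsum f (seq s (S n)) = lsum f (seq s n) + f (s + n)%nat.
Proof. rewrite seq_S, lsum_app; simpl; ring. Qed.

Lemma dsum_lsum (f : nat -> R) N : dsum f N = lsum f (seq 1 N).
Proof.
  induction N as [|N IH]; [easy|].
  rewrite seq_S, lsum_app, <- IH; simpl; ring.
Qed.

(** * Time averages of continuous functions *)

Definition cont (f : R -> R) : Prop := forall x, continuous f x.

Lemma cont_plus f g : cont f -> cont g -> cont (fun t => f t + g t).
Proof. intros Hf Hg x; exact (continuous_plus f g x (Hf x) (Hg x)). Qed.

Lemma cont_mult f g : cont f -> cont g -> cont (fun t => f t * g t).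
Proof. intros Hf Hg x; exact (continuous_mult f g x (Hf x) (Hg x)). Qed.

Lemma cont_const c : cont (fun _ => c).
Proof. intros x; apply continuous_const. Qed.

Lemma cont_comp f g : cont f -> cont g -> cont (fun t => f (g t)).
Proof. intros Hf Hg x; exact (continuous_comp g f x (Hg x) (Hf (g x))). Qed.

Lemma cont_derivable f : (forall x, ex_derive f x) -> cont f.
Proof. intros H x; exact (ex_derive_continuous f x (H x)). Qed.

Lemma cont_cos : cont cos.
Proof. apply cont_derivable; intros x; auto_derive; easy. Qed.

Lemma cont_sin : cont sin.
Proof. apply cont_derivable; intros x; auto_derive; easy. Qed.

Lemma cont_id : cont (fun t => t).
Proof. intros x; apply continuous_id. Qed.

Lemma cont_lsum {A} (f : A -> R -> R) l :
  (forall x, cont (f x)) -> cont (fun t => lsum (fun x => f x t) l).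
Proof.
  intros H; induction l as [|x l IH]; simpl; [apply cont_const|].
  now apply cont_plus.
Qed.

Lemma cont_Rpower f a : cont f -> (forall t, 0 < f t) -> cont (fun t => Rpower (f t) a).
Proof.
  intros Hf Hp x.
  apply (continuous_comp f (fun y => Rpower y a) x (Hf x)).
  apply (ex_derive_continuous (fun y => Rpower y a)).
  exists (a * Rpower (f x) (a - 1)); apply is_derive_Reals, derivable_pt_lim_power, Hp.
Qed.

Lemma cont_ext f g : (forall t, f t = g t) -> cont f -> cont g.
Proof. intros E H x; apply (continuous_ext f g x E (H x)). Qed.

Lemma cont_ex_RInt f a b : cont f -> ex_RInt f a b.
Proof. intros H; apply (ex_RInt_continuous (V := R_CompleteNormedModule)); auto. Qed.

(** Integral lengths only: [Lim] at [p_infty] is by definition the [Lim_seq] along [INR n]. *)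
Definition Avg (f : R -> R) (n : nat) : R := / INR n * RInt f 0 (INR n).

Lemma Avg_plus f g n : cont f -> cont g -> Avg (fun t => f t + g t) n = Avg f n + Avg g n.
Proof.
  intros Hf Hg; unfold Avg.
  rewrite <- Rmult_plus_distr_l; f_equal.
  apply (RInt_plus f g); now apply cont_ex_RInt.
Qed.

Lemma Avg_scal c f n : cont f -> Avg (fun t => c * f t) n = c * Avg f n.
Proof.
  intros Hf; unfold Avg.
  transitivity (/ INR n * (c * RInt f 0 (INR n))); [|ring].
  f_equal; apply (RInt_scal f); now apply cont_ex_RInt.
Qed.

Lemma Avg_const c n : (1 <= n)%nat -> Avg (fun _ => c) n = c.
Proof.
  intros Hn; unfold Avg; rewrite RInt_const; unfold scal; simpl; unfold mult; simpl.
  assert (0 < INR n) by (apply lt_0_INR; lia).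
  field; lra.
Qed.

Lemma Avg_le f g n : cont f -> cont g -> (forall t, f t <= g t) -> Avg f n <= Avg g n.
Proof.
  intros Hf Hg H; unfold Avg.
  destruct n as [|n].
  - simpl; rewrite !RInt_point; lra.
  - apply Rmult_le_compat_l; [left; apply Rinv_0_lt_compat, lt_0_INR; lia|].
    apply RInt_le; [apply pos_INR| | |auto]; now apply cont_ex_RInt.
Qed.

Lemma Avg_ext f g n : (forall t, f t = g t) -> Avg f n = Avg g n.
Proof. intros H; unfold Avg; f_equal; apply RInt_ext; auto. Qed.

(** Continuity travels with the limit because linearity and monotonicity of [Avg] rest on
    integrability. *)
Definition is_mean (f : R -> R) (m : R) : Prop := cont f /\ is_lim_seq (Avg f) m.

Lemma is_mean_ext f g m : (forall t, f t = g t) -> is_mean f m -> is_mean g m.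
Proof.
  intros E [H1 H2]; split; [now apply cont_ext with f|].
  apply is_lim_seq_ext with (Avg f); [|easy].
  intros n; now apply Avg_ext.
Qed.

Lemma is_mean_plus f g a b : is_mean f a -> is_mean g b -> is_mean (fun t => f t + g t) (a + b).
Proof.
  intros [F1 F2] [G1 G2]; split; [now apply cont_plus|].
  apply is_lim_seq_ext with (fun n => Avg f n + Avg g n); [intros n; now rewrite Avg_plus|].
  now apply is_lim_seq_plus'.
Qed.

Lemma is_mean_scal c f a : is_mean f a -> is_mean (fun t => c * f t) (c * a).
Proof.
  intros [F1 F2]; split; [apply cont_mult; [apply cont_const|easy]|].
  apply is_lim_seq_ext with (fun n => c * Avg f n); [intros n; now rewrite Avg_scal|].
  apply (is_lim_seq_scal_l (Avg f) c a F2).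
Qed.

Lemma is_mean_const c : is_mean (fun _ => c) c.
Proof.
  split; [apply cont_const|].
  apply is_lim_seq_ext_loc with (fun _ => c); [|apply is_lim_seq_const].
  exists 1%nat; intros n Hn; now rewrite Avg_const.
Qed.

Lemma is_mean_lsum {A} (f : A -> R -> R) (m : A -> R) l :
  (forall x, is_mean (f x) (m x)) -> is_mean (fun t => lsum (fun x => f x t) l) (lsum m l).
Proof.
  intros H; induction l as [|x l IH]; simpl; [apply is_mean_const|].
  now apply is_mean_plus.
Qed.

(** A nonzero frequency has the bounded primitive [sin (t mu) / mu], so its average is [O(1/n)]; all
    orthogonality below reduces to this. *)
Lemma is_mean_cos mu : is_mean (fun t => cos (t * mu)) (if Req_EM_T mu 0 then 1 else 0).
Proof.
  destruct (Req_EM_T mu 0) as [->|Hmu].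
  - apply is_mean_ext with (fun _ => 1); [|apply is_mean_const].
    intros t; now rewrite Rmult_0_r, cos_0.
  - assert (Hc : cont (fun t => cos (t * mu))).
    { apply (cont_comp cos (fun t => t * mu)); [apply cont_cos|].
      apply cont_mult; [apply cont_id|apply cont_const]. }
    split; [easy|].
    apply is_lim_seq_ext with (fun n => / INR n * (sin (INR n * mu) / mu)).
    { intros n; unfold Avg; f_equal; symmetry.
      apply is_RInt_unique.
      replace (sin (INR n * mu) / mu)
        with (minus (sin (INR n * mu) / mu) (sin (0 * mu) / mu)).
      2:{ rewrite Rmult_0_l, sin_0; unfold minus, plus, opp; simpl; field; easy. }
      apply (is_RInt_derive (fun t => sin (t * mu) / mu) (fun t => cos (t * mu))).
      - intros x _; auto_derive; [easy|field; easy].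
      - intros x _; apply Hc. }
    apply is_lim_seq_le_le with (fun n => - / Rabs mu * / INR n) (fun n => / Rabs mu * / INR n).
    { intros n.
      assert (Hb : Rabs (sin (INR n * mu) / mu) <= / Rabs mu).
      { unfold Rdiv; rewrite Rabs_mult, Rabs_inv.
        assert (0 < / Rabs mu) by now apply Rinv_0_lt_compat, Rabs_pos_lt.
        assert (Rabs (sin (INR n * mu)) <= 1)
          by (apply Rabs_le; destruct (SIN_bound (INR n * mu)); lra).
        nra. }
      apply Rabs_le_between in Hb.
      assert (0 <= / INR n).
      { destruct n; [simpl; rewrite Rinv_0; lra|].
        left; apply Rinv_0_lt_compat, lt_0_INR; lia. }
      nra. }
    1,2: match goal with |- is_lim_seq (fun n => ?c * _) _ =>
           replace (Finite 0) with (Rbar_mult c 0) by (simpl; f_equal; ring) end;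
         apply is_lim_seq_scal_l;
         replace (Finite 0) with (Rbar_inv p_infty) by easy;
         apply is_lim_seq_inv; [apply is_lim_seq_INR|easy].
Qed.

Lemma is_mean_upper f m B : is_mean f m -> m < B -> eventually (fun n => Avg f n <= B).
Proof.
  intros [_ H] HB.
  apply is_lim_seq_spec in H.
  assert (He : 0 < B - m) by lra.
  destruct (H (mkposreal _ He)) as [n0 Hn]; exists n0; intros n Hn'.
  specialize (Hn n Hn'); simpl in Hn; apply Rabs_lt_between in Hn; lra.
Qed.

Lemma is_mean_lower f m B : is_mean f m -> B < m -> eventually (fun n => B <= Avg f n).
Proof.
  intros [_ H] HB.
  apply is_lim_seq_spec in H.
  assert (He : 0 < m - B) by lra.
  destruct (H (mkposreal _ He)) as [n0 Hn]; exists n0; intros n Hn'.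
  specialize (Hn n Hn'); simpl in Hn; apply Rabs_lt_between in Hn; lra.
Qed.

(** [Lim_seq] is the midpoint of the upper and lower limits, a total function. Eventual bounds on
    both sides pass to it and make it finite; [real] would turn an infinite value into 0. *)
Lemma pseudomoment_between k N B1 B2 :
  eventually (fun n => B1 <= Avg (DirPow k N) n <= B2) -> B1 <= pseudomoment k N <= B2.
Proof.
  intros H.
  change (pseudomoment k N) with (real (Lim_seq (Avg (DirPow k N)))).
  assert (H1 : Rbar_le B1 (Lim_seq (Avg (DirPow k N)))).
  { rewrite <- (Lim_seq_const B1); apply Lim_seq_le_loc.
    destruct H as [n0 H]; exists n0; intros n Hn; apply H; easy. }
  assert (H2 : Rbar_le (Lim_seq (Avg (DirPow k N))) B2).
  { rewrite <- (Lim_seq_const B2); apply Lim_seq_le_loc.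
    destruct H as [n0 H]; exists n0; intros n Hn; apply H; easy. }
  destruct (Lim_seq (Avg (DirPow k N))); simpl in *; easy.
Qed.

(** * Real powers of the Dirichlet polynomial *)

Lemma rpow_pos x y : 0 < x -> rpow x y = Rpower x y.
Proof. intros H; unfold rpow; destruct (Rle_dec x 0); lra. Qed.

Lemma rpow_nonneg x y : 0 <= rpow x y.
Proof. unfold rpow; destruct (Rle_dec x 0); [lra|left; apply exp_pos]. Qed.

Lemma Rpower_pos x y : 0 < Rpower x y.
Proof. apply exp_pos. Qed.

Lemma rpow_le x y k : 0 <= k -> x <= y -> 0 < y -> rpow x k <= Rpower y k.
Proof.
  intros Hk Hxy Hy; unfold rpow; destruct (Rle_dec x 0) as [H|H]; [left; apply exp_pos|].
  apply Rle_Rpower_l; lra.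
Qed.

(** At 0 the convention [0^k = 0] is continuous since [y^k <= y] for [0 < y < 1] and [k >= 1]. *)
Lemma continuous_rpow k x : 1 <= k -> continuous (fun y => rpow y k) x.
Proof.
  intros Hk.
  destruct (Rtotal_order x 0) as [H|[->|H]].
  - apply continuous_ext_loc with (fun _ => 0); [|apply continuous_const].
    assert (He : 0 < - x) by lra.
    exists (mkposreal _ He); intros y Hy.
    apply Rabs_lt_between in Hy; simpl in Hy.
    unfold minus, plus, opp in Hy; simpl in Hy.
    unfold rpow; destruct (Rle_dec y 0); [easy|lra].
  - apply filterlim_locally; intros eps.
    assert (Hd : 0 < Rmin 1 eps) by (apply Rmin_pos; [lra|apply cond_pos]).
    exists (mkposreal _ Hd); intros y Hy.
    apply Rabs_lt_between in Hy; simpl in Hy.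
    unfold minus, plus, opp in Hy; simpl in Hy.
    assert (Hm := Rmin_l 1 eps); assert (Hm' := Rmin_r 1 eps).
    assert (Hz : rpow 0 k = 0) by (unfold rpow; destruct (Rle_dec 0 0); lra).
    change (Rabs (rpow y k - rpow 0 k) < eps); rewrite Hz, Rminus_0_r.
    rewrite Rabs_pos_eq by apply rpow_nonneg.
    unfold rpow; destruct (Rle_dec y 0); [apply cond_pos|].
    apply Rle_lt_trans with y; [|lra].
    rewrite <- (Rpower_1 y) at 2 by lra.
    unfold Rpower.
    assert (Hl : ln y <= 0) by (rewrite <- ln_1; apply ln_le; lra).
    assert (E : k * ln y <= 1 * ln y) by nra.
    destruct E as [E| ->]; [left; now apply exp_increasing|lra].
  - apply continuous_ext_loc with (fun y => Rpower y k).
    + exists (mkposreal _ H); intros y Hy.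
      apply Rabs_lt_between in Hy; simpl in Hy.
      unfold minus, plus, opp in Hy; simpl in Hy.
      symmetry; apply rpow_pos; lra.
    + apply (ex_derive_continuous (fun y => Rpower y k)).
      exists (k * Rpower x (k - 1)); now apply is_derive_Reals, derivable_pt_lim_power.
Qed.

Lemma cont_DirRe N : cont (DirRe N).
Proof.
  apply cont_ext with (fun t => lsum (fun n => / sqrt (INR n) * cos (t * ln (INR n))) (seq 1 N)).
  { intros t; symmetry; apply dsum_lsum. }
  apply cont_lsum; intros n; apply cont_mult; [apply cont_const|].
  apply (cont_comp cos); [apply cont_cos|apply cont_mult; [apply cont_id|apply cont_const]].
Qed.

Lemma cont_DirIm N : cont (DirIm N).
Proof.
  apply cont_ext
    with (fun t => lsum (fun n => (-1) * (/ sqrt (INR n) * sin (t * ln (INR n)))) (seq 1 N)).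
  { intros t; unfold DirIm; rewrite dsum_lsum; apply lsum_ext; intros; ring. }
  apply cont_lsum; intros n; apply cont_mult; [apply cont_const|].
  apply cont_mult; [apply cont_const|].
  apply (cont_comp sin); [apply cont_sin|apply cont_mult; [apply cont_id|apply cont_const]].
Qed.

Lemma cont_sqr f : cont f -> cont (fun t => f t ^ 2).
Proof.
  intros H; apply cont_ext with (fun t => f t * f t); [intros t; ring|now apply cont_mult].
Qed.

Lemma cont_DirPow k N : 1 <= k -> cont (DirPow k N).
Proof.
  intros Hk; apply (cont_comp (fun y => rpow y k)).
  - intros x; now apply continuous_rpow.
  - apply cont_plus; apply cont_sqr; [apply cont_DirRe|apply cont_DirIm].
Qed.

Lemma lsum_abs_le {A} (f g : A -> R) l :
  (forall x, In x l -> Rabs (f x) <= g x) -> Rabs (lsum f l) <= lsum g l.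
Proof.
  induction l as [|x l IH]; simpl; intros H; [rewrite Rabs_R0; lra|].
  eapply Rle_trans; [apply Rabs_triang|].
  apply Rplus_le_compat; auto.
Qed.

(** Supplies the upper bound that [pseudomoment_between] asks for when a lower bound is the aim. *)
Lemma DirPow_bounded k N : 0 <= k -> exists B, forall t, DirPow k N t <= B.
Proof.
  intros Hk; set (S := lsum (fun n => Rabs (/ sqrt (INR n))) (seq 1 N)).
  exists (Rpower (2 * S ^ 2 + 1) k); intros t; apply rpow_le; [easy| |nra].
  assert (H1 : Rabs (DirRe N t) <= S).
  { unfold DirRe; rewrite dsum_lsum; apply lsum_abs_le; intros n _; rewrite Rabs_mult.
    assert (Rabs (cos (t * ln (INR n))) <= 1)
      by (apply Rabs_le; destruct (COS_bound (t * ln (INR n))); lra).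
    assert (H0 := Rabs_pos (/ sqrt (INR n))); nra. }
  assert (H2 : Rabs (DirIm N t) <= S).
  { unfold DirIm; rewrite dsum_lsum; apply lsum_abs_le; intros n _; rewrite Rabs_Ropp, Rabs_mult.
    assert (Rabs (sin (t * ln (INR n))) <= 1)
      by (apply Rabs_le; destruct (SIN_bound (t * ln (INR n))); lra).
    assert (H0 := Rabs_pos (/ sqrt (INR n))); nra. }
  apply Rabs_le_between in H1; apply Rabs_le_between in H2; nra.
Qed.

Lemma pseudomoment_ge k N B :
  1 <= k -> eventually (fun n => B <= Avg (DirPow k N) n) -> B <= pseudomoment k N.
Proof.
  intros Hk [n0 H].
  destruct (DirPow_bounded k N) as [B2 HB]; [lra|].
  apply (pseudomoment_between k N B B2).
  exists (S n0); intros n Hn; split; [apply H; lia|].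
  rewrite <- (Avg_const B2 n) by lia.
  apply Avg_le; [now apply cont_DirPow|apply cont_const|apply HB].
Qed.

Lemma pseudomoment_le k N B :
  1 <= k -> eventually (fun n => Avg (DirPow k N) n <= B) -> pseudomoment k N <= B.
Proof.
  intros Hk [n0 H].
  apply (pseudomoment_between k N 0 B).
  exists (S n0); intros n Hn; split; [|apply H; lia].
  rewrite <- (Avg_const 0 n) by lia.
  apply Avg_le; [apply cont_const|now apply cont_DirPow|intros t; apply rpow_nonneg].
Qed.

Lemma exp_le a b : a <= b -> exp a <= exp b.
Proof. intros [H| ->]; [left; now apply exp_increasing|lra]. Qed.

(** * Primes and Mertens' estimates *)

Module PrimeFacts.
Import ssreflect ssrbool eqtype ssrnat div prime.

Lemma dvdn_divide d n : is_true (dvdn d n) <-> Nat.divide d n.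
Proof.
split; first by move/dvdnP=> [q ->]; exists q.
by move=> [q ->]; apply/dvdnP; exists q.
Qed.

Lemma prime_gt1' p : prime p = true -> (1 < p)%coq_nat.
Proof. by move/prime_gt1/ltP. Qed.

Lemma prime_divide_mul p a b :
  prime p = true -> Nat.divide p (a * b) -> Nat.divide p a \/ Nat.divide p b.
Proof.
move=> pr /dvdn_divide; rewrite Euclid_dvdM //.
by move/orP=> [h|h]; [left|right]; apply/dvdn_divide.
Qed.

Lemma prime_divide_prime p q : prime p = true -> prime q = true -> Nat.divide p q -> p = q.
Proof. by move=> hp hq /dvdn_divide; rewrite dvdn_prime2 //; move/eqP. Qed.

Lemma prime_factor n : (1 < n)%coq_nat -> exists p, prime p = true /\ Nat.divide p n.
Proof.
move/ltP=> h; exists (pdiv n); split; first exact: pdiv_prime.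
by apply/dvdn_divide; apply: pdiv_dvd.
Qed.

End PrimeFacts.

Definition is_prime (n : nat) : bool := prime.prime n.
Definition PR (a b : nat) : list nat := filter is_prime (seq (S a) (b - a)).

Definition primes_list (l : list nat) : Prop := NoDup l /\ forall p, In p l -> is_prime p = true.

Lemma is_prime_gt1 p : is_prime p = true -> (1 < p)%nat.
Proof. apply PrimeFacts.prime_gt1'. Qed.

Lemma primes_list_inv p l :
  primes_list (p :: l) -> is_prime p = true /\ ~ In p l /\ primes_list l.
Proof.
  intros [H1 H2]; inversion H1; subst.
  repeat split; [apply H2; now left|easy|easy|intros q Hq; apply H2; now right].
Qed.

Lemma in_PR a b p : In p (PR a b) <-> (a < p <= b)%nat /\ is_prime p = true.
Proof. unfold PR; rewrite filter_In, in_seq; split; intros [H1 H2]; split; try easy; lia. Qed.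

Lemma PR_primes a b : primes_list (PR a b).
Proof.
  split; [apply NoDup_filter, seq_NoDup|].
  intros p Hp; apply in_PR in Hp; easy.
Qed.

Lemma PR_split a b c : (a <= b <= c)%nat -> PR a c = PR a b ++ PR b c.
Proof.
  intros H; unfold PR; rewrite <- filter_app; f_equal.
  replace (c - a)%nat with ((b - a) + (c - b))%nat by lia.
  rewrite seq_app; do 2 f_equal; lia.
Qed.

(** * Integers composed of given primes *)

Lemma prime_not_divide_mul p q m :
  is_prime p = true -> is_prime q = true -> p <> q -> ~ Nat.divide p m -> ~ Nat.divide p (q * m).
Proof.
  intros Hp Hq Hne Hm H.
  apply PrimeFacts.prime_divide_mul in H; [|easy].
  destruct H as [H|H]; [|easy].
  now apply Hne, PrimeFacts.prime_divide_prime.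
Qed.

Lemma prime_not_divide_pow p q j :
  is_prime p = true -> is_prime q = true -> p <> q -> ~ Nat.divide p (q ^ j).
Proof.
  intros Hp Hq Hne; induction j as [|j IH].
  - intros H; apply Nat.divide_1_r in H; apply is_prime_gt1 in Hp; lia.
  - now apply prime_not_divide_mul.
Qed.

(** Exponents stop at [J], so the list is finite and sums of completely multiplicative functions
    over it factor exactly. With the primes up to [N] and [J >= N] it contains every [n] from 1 to
    [N]; with [J = 1] it lists squarefree products. *)
Fixpoint smooth (J : nat) (ps : list nat) : list nat :=
  match ps with
  | nil => [1%nat]
  | p :: q => flat_map (fun j => map (fun m => (p ^ j * m)%nat) (smooth J q)) (seq 0 (S J))
  end.

Lemma in_smooth_cons J p ps n :
  In n (smooth J (p :: ps)) <->
  exists j m, (j <= J)%nat /\ In m (smooth J ps) /\ n = (p ^ j * m)%nat.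
Proof.
  unfold smooth; fold smooth; rewrite in_flat_map; split.
  - intros (j & Hj & H); apply in_map_iff in H; destruct H as (m & E & Hm).
    exists j, m; apply in_seq in Hj; repeat split; [lia|easy|easy].
  - intros (j & m & Hj & Hm & E); exists j; split; [apply in_seq; lia|].
    apply in_map_iff; exists m; easy.
Qed.

Lemma smooth_pos J ps n :
  (forall p, In p ps -> is_prime p = true) -> In n (smooth J ps) -> (1 <= n)%nat.
Proof.
  revert n; induction ps as [|p ps IH]; intros n Hp Hn.
  - destruct Hn as [<-|[]]; lia.
  - apply in_smooth_cons in Hn; destruct Hn as (j & m & Hj & Hm & ->).
    apply IH in Hm; [|intros q Hq; apply Hp; now right].
    assert (H1 : (1 < p)%nat) by (apply is_prime_gt1, Hp; now left).
    assert (p ^ j <> 0)%nat by (apply Nat.pow_nonzero; lia).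
    nia.
Qed.

Lemma smooth_not_divide J ps q n :
  (forall p, In p ps -> is_prime p = true) -> is_prime q = true -> ~ In q ps ->
  In n (smooth J ps) -> ~ Nat.divide q n.
Proof.
  intros Hp Hq; revert n; induction ps as [|p ps IH]; intros n Hni Hn.
  - destruct Hn as [<-|[]]; intros H; apply Nat.divide_1_r in H.
    apply is_prime_gt1 in Hq; lia.
  - apply in_smooth_cons in Hn; destruct Hn as (j & m & Hj & Hm & ->).
    intros H; apply PrimeFacts.prime_divide_mul in H; [|easy]; destruct H as [H|H].
    + revert H; apply prime_not_divide_pow; [easy|apply Hp; now left|].
      intros ->; apply Hni; now left.
    + revert H; apply IH; [intros r Hr; apply Hp; now right| |easy].
      intros Hr; apply Hni; now right.
Qed.

Lemma NoDup_map_inj {A B} (f : A -> B) l :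
  (forall x y, f x = f y -> x = y) -> NoDup l -> NoDup (map f l).
Proof. intros Hf; apply FinFun.Injective_map_NoDup; exact Hf. Qed.

Lemma NoDup_flat_map_disjoint {A B} (f : A -> list B) l :
  NoDup l -> (forall x, In x l -> NoDup (f x)) ->
  (forall x y b, In x l -> In y l -> In b (f x) -> In b (f y) -> x = y) ->
  NoDup (flat_map f l).
Proof.
  induction l as [|x l IH]; intros Hl Hf Hd; [constructor|].
  simpl; inversion Hl as [|? ? Hx Hl']; subst; apply NoDup_app.
  - apply Hf; now left.
  - apply IH; [easy|intros y Hy; apply Hf; now right|].
    intros y z b Hy Hz; apply Hd; now right.
  - intros b Hb H; apply in_flat_map in H; destruct H as (y & Hy & Hby).
    apply Hx; replace x with y; [easy|].
    apply (Hd y x b); [now right|now left|easy|easy].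
Qed.

Lemma smooth_NoDup J ps : primes_list ps -> NoDup (smooth J ps).
Proof.
  induction ps as [|p ps IH]; intros H; [repeat constructor; easy|].
  apply primes_list_inv in H; destruct H as (Hp & Hni & Hps).
  assert (H1 := is_prime_gt1 p Hp).
  change (smooth J (p :: ps))
    with (flat_map (fun j => map (fun m => (p ^ j * m)%nat) (smooth J ps)) (seq 0 (S J))).
  apply NoDup_flat_map_disjoint.
  - apply seq_NoDup.
  - intros j _; apply NoDup_map_inj; [|now apply IH].
    intros x y E; assert (p ^ j <> 0)%nat by (apply Nat.pow_nonzero; lia); nia.
  - intros i j b _ _ Hi Hj.
    apply in_map_iff in Hi; destruct Hi as (x & <- & Hx).
    apply in_map_iff in Hj; destruct Hj as (y & E & Hy).
    assert (Nx : ~ Nat.divide p x) by (apply (smooth_not_divide J ps); auto; apply Hps).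
    assert (Ny : ~ Nat.divide p y) by (apply (smooth_not_divide J ps); auto; apply Hps).
    clear Hx Hy IH.
    (* Cancel [p] on both sides until one exponent is 0; the other is then 0 as well, for [p]
       divides neither cofactor. *)
    revert j E; induction i as [|i IH]; intros [|j] E; [easy| | |f_equal].
    + exfalso; apply Nx; simpl in E; exists (p ^ j * y)%nat; nia.
    + exfalso; apply Ny; simpl in E; exists (p ^ i * x)%nat; nia.
    + apply IH; simpl in E; nia.
Qed.

Lemma smooth_complete J ps n :
  (forall p, In p ps -> is_prime p = true) -> (1 <= n <= J)%nat ->
  (forall q, is_prime q = true -> Nat.divide q n -> In q ps) -> In n (smooth J ps).
Proof.
  intros Hp; revert n; induction ps as [|p ps IH]; intros n Hn Hq.
  - left; destruct (Nat.eq_dec n 1) as [->|Hne]; [easy|exfalso].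
    destruct (PrimeFacts.prime_factor n) as (q & H1 & H2); [lia|].
    exact (Hq q H1 H2).
  - assert (H1 : (1 < p)%nat) by (apply is_prime_gt1, Hp; now left).
    (* Splits off the power of [p] in [n]; the crude bound [j < n] already respects the cap, as
       [n <= J]. *)
    assert (E : forall n, (1 <= n)%nat ->
      exists j m, (j < n)%nat /\ (1 <= m <= n)%nat /\ ~ Nat.divide p m /\ n = (p ^ j * m)%nat).
    { clear n Hn Hq; intros n; induction n as [n IHn] using (well_founded_induction Nat.lt_wf_0); intros Hn.
      destruct (Nat.eq_dec (n mod p) 0) as [E|E].
      - apply Nat.Lcm0.mod_divide in E; destruct E as [q E].
        destruct (IHn q) as (j & m & A1 & A2 & A3 & A4); [nia|nia|].
        exists (S j), m; repeat split; try easy; [nia|nia|].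
        rewrite E, A4; simpl; ring.
      - exists 0%nat, n; repeat split; try lia; [|simpl; lia].
        intros H; now apply E, Nat.Lcm0.mod_divide. }
    destruct (E n) as (j & m & A1 & A2 & A3 & A4); [lia|].
    apply in_smooth_cons; exists j, m; repeat split; [lia| |easy].
    apply IH; [intros r Hr; apply Hp; now right|lia|].
    intros q Pq Dq; destruct (Hq q Pq) as [<-|H]; [|easy|easy].
    rewrite A4; now apply Nat.divide_mul_r.
Qed.

Lemma smooth_contains_range J N n :
  (1 <= n <= N)%nat -> (N <= J)%nat -> In n (smooth J (PR 0 N)).
Proof.
  intros Hn HJ; apply smooth_complete; [apply PR_primes|lia|].
  intros q Pq Dq; apply in_PR; split; [|easy].
  apply is_prime_gt1 in Pq as H1; apply Nat.divide_pos_le in Dq; lia.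
Qed.

Lemma lsum_smooth (phi : nat -> R) J ps :
  phi 1%nat = 1 -> (forall a b, (1 <= a)%nat -> (1 <= b)%nat -> phi (a * b)%nat = phi a * phi b) ->
  (forall p, In p ps -> is_prime p = true) ->
  lsum phi (smooth J ps) = lprod (fun p => lsum (fun j => phi (p ^ j)%nat) (seq 0 (S J))) ps.
Proof.
  intros H1 Hm; induction ps as [|p ps IH]; intros Hp; [simpl; rewrite H1; ring|].
  assert (Hp' : forall q, In q ps -> is_prime q = true) by (intros q Hq; apply Hp; now right).
  assert (Hp1 : (1 < p)%nat) by (apply is_prime_gt1, Hp; now left).
  change (lprod ?f (p :: ps)) with (f p * lprod f ps); cbv beta.
  rewrite <- IH by easy.
  change (smooth J (p :: ps))
    with (flat_map (fun j => map (fun m => (p ^ j * m)%nat) (smooth J ps)) (seq 0 (S J))).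
  generalize (seq 0 (S J)) as l; induction l as [|j l IHl]; simpl; [ring|].
  rewrite lsum_app, IHl, lsum_map.
  rewrite (lsum_ext _ (fun m => phi (p ^ j)%nat * phi m)), lsum_scal; [ring|].
  intros m Hm'; apply Hm; [|now apply (smooth_pos J ps)].
  assert (p ^ j <> 0)%nat by (apply Nat.pow_nonzero; lia); lia.
Qed.

Lemma lsum_incl {A} (f : A -> R) l l' :
  NoDup l -> incl l l' -> (forall x, In x l' -> 0 <= f x) -> lsum f l <= lsum f l'.
Proof.
  revert l'; induction l as [|x l IH]; intros l' Hl Hi Hf; [now apply lsum_nonneg|].
  inversion Hl as [|? ? Hx Hl']; subst.
  destruct (in_split x l') as (l1 & l2 & E); [apply Hi; now left|].
  rewrite (lsum_perm f l' (x :: l1 ++ l2)) by (rewrite E; symmetry; apply Permutation_middle).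
  simpl; apply Rplus_le_compat_l, IH; [easy| |].
  - intros y Hy; assert (Hy' : In y l') by (apply Hi; now right).
    rewrite E in Hy'; apply in_app_iff in Hy'; apply in_app_iff.
    destruct Hy' as [H|[H|H]]; [now left| |now right].
    subst y; easy.
  - intros y Hy; apply Hf; rewrite E; apply in_app_iff; apply in_app_iff in Hy.
    destruct Hy; [now left|right; now right].
Qed.

Lemma list_bound (l : list nat) : exists M, forall n, In n l -> (n <= M)%nat.
Proof.
  exists (list_max l); intros n Hn.
  assert (H := proj1 (list_max_le l (list_max l)) (Nat.le_refl _)).
  rewrite Forall_forall in H; now apply H.
Qed.

(** * Sums of powers of [n^(-1/2)] *)

Definition isq (n : nat) : R := / sqrt (INR n).

Lemma isq_pos n : (1 <= n)%nat -> 0 < isq n.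
Proof. intros H; apply Rinv_0_lt_compat, sqrt_lt_R0, lt_0_INR; lia. Qed.

Lemma isq_sqr n : (1 <= n)%nat -> isq n ^ 2 = / INR n.
Proof.
  intros H; unfold isq; rewrite pow_inv; f_equal.
  simpl; rewrite Rmult_1_r; apply sqrt_sqrt, pos_INR.
Qed.

Lemma isq_decr m n : (1 <= m)%nat -> (m <= n)%nat -> isq n <= isq m.
Proof.
  intros H1 H2; apply Rinv_le_contravar.
  - apply sqrt_lt_R0, lt_0_INR; lia.
  - apply sqrt_le_1_alt, le_INR, H2.
Qed.

(* Telescoping: [n^{-3/2} <= 2 ((n-1)^{-1/2} - n^{-1/2})]. *)
Lemma sum_isq3_seq X M : (1 <= X)%nat ->
  lsum (fun n => isq n ^ 3) (seq (S X) M) <= 2 * isq X - 2 * isq (X + M).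
Proof.
  intros HX; induction M as [|M IH].
  - simpl; replace (X + 0)%nat with X by lia; lra.
  - rewrite lsum_seq_S.
    replace (S X + M)%nat with (X + S M)%nat by lia.
    assert (H : isq (X + S M) ^ 3 <= 2 * (isq (X + M) - isq (X + S M))).
    { assert (Ha := isq_pos (X + M) ltac:(lia)).
      assert (Hb := isq_pos (X + S M) ltac:(lia)).
      unfold isq in *; rewrite <- !Nat.add_succ_comm in *; simpl Nat.add in *.
      rewrite S_INR in *.
      set (x := INR (X + M)) in *.
      assert (Hx : 0 < x) by (apply lt_0_INR; lia).
      set (a := sqrt x) in *; set (b := sqrt (x + 1)) in *.
      assert (Ea : a * a = x) by (apply sqrt_sqrt; lra).
      assert (Eb : b * b = x + 1) by (apply sqrt_sqrt; lra).
      assert (Pa : 0 < a) by (apply sqrt_lt_R0; lra).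
      assert (Pb : 0 < b) by (apply sqrt_lt_R0; lra).
      assert (Hab : a < b) by nra.
      assert (E : / a - / b = / (a * b * (a + b))).
      { replace (/ a - / b) with ((b - a) * (a + b) * / (a * b * (a + b)))
          by (field; repeat split; lra).
        replace ((b - a) * (a + b)) with 1 by nra; ring. }
      rewrite E, pow_inv.
      replace (2 * / (a * b * (a + b))) with (/ (a * b * (a + b) / 2)) by (field; repeat split; lra).
      apply Rinv_le_contravar.
      - assert (0 < a * b) by nra; nra.
      - assert (a * b <= b * b) by nra.
        assert ((a * b) * (a + b) <= (b * b) * (2 * b)).
        { apply Rmult_le_compat; nra. }
        simpl; nra. }
    lra.
Qed.

Lemma sum_isq3 X l : (1 <= X)%nat -> NoDup l -> (forall n, In n l -> (X < n)%nat) ->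
  lsum (fun n => isq n ^ 3) l <= 2 * isq X.
Proof.
  intros HX Hl Hn; destruct (list_bound l) as [M HM].
  apply Rle_trans with (lsum (fun n => isq n ^ 3) (seq (S X) M)).
  - apply lsum_incl; [easy| |].
    + intros n Hin; apply in_seq; specialize (Hn n Hin); specialize (HM n Hin); lia.
    + intros n Hin; apply in_seq in Hin; left; apply pow_lt, isq_pos; lia.
  - assert (H := sum_isq3_seq X M HX).
    assert (H2 := isq_pos (X + M) ltac:(lia)); lra.
Qed.

(* Telescoping: [n^{-1/2} <= 2 (n^{1/2} - (n-1)^{1/2})]. *)
Lemma sum_isq M : lsum isq (seq 1 M) <= 2 * sqrt (INR M).
Proof.
  induction M as [|M IH]; [simpl; rewrite sqrt_0; lra|].
  rewrite lsum_seq_S.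
  assert (H : isq (S M) <= 2 * (sqrt (INR (S M)) - sqrt (INR M))).
  { unfold isq; rewrite S_INR.
    assert (Hx := pos_INR M); set (x := INR M) in *.
    set (a := sqrt x) in *; set (b := sqrt (x + 1)) in *.
    assert (Ea : a * a = x) by (apply sqrt_sqrt; lra).
    assert (Eb : b * b = x + 1) by (apply sqrt_sqrt; lra).
    assert (Pa : 0 <= a) by apply sqrt_pos.
    assert (Pb : 0 < b) by (apply sqrt_lt_R0; lra).
    apply Rmult_le_reg_l with b; [easy|]; rewrite Rinv_r by lra; nra. }
  change (1 + M)%nat with (S M); lra.
Qed.

(** Comparison with the sum over all integers is accurate enough: for [X] of order [k^2] it yields
    [k sqrt X = O(k^2)]. *)
Lemma sum_isq_primes X : lsum isq (PR 0 X) <= 2 * sqrt (INR X).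
Proof.
  eapply Rle_trans; [|apply sum_isq].
  apply lsum_incl; [apply PR_primes| |].
  - intros p Hp; apply in_PR in Hp; apply in_seq; lia.
  - intros n Hn; apply in_seq in Hn; left; apply isq_pos; lia.
Qed.

Lemma one_plus_le_exp x : 1 + x <= exp x.
Proof. apply exp_ineq1_le. Qed.

Lemma ln_le_sub x : 0 < x -> ln x <= x - 1.
Proof.
  intros H; rewrite <- (ln_exp (x - 1)); apply ln_le; [easy|].
  assert (E := one_plus_le_exp (x - 1)); lra.
Qed.

Lemma inv_sqr_le_isq3 n : (1 <= n)%nat -> (/ INR n) ^ 2 <= isq n ^ 3.
Proof.
  intros H; rewrite <- isq_sqr by easy.
  assert (H1 := isq_pos n H).
  assert (H2 : isq n <= 1).
  { assert (E := isq_decr 1 n ltac:(lia) H); unfold isq at 2 in E; simpl in E.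
    rewrite sqrt_1, Rinv_1 in E; easy. }
  replace ((isq n ^ 2) ^ 2) with (isq n ^ 3 * isq n) by ring.
  rewrite <- (Rmult_1_r (isq n ^ 3)) at 2; apply Rmult_le_compat_l; [left; now apply pow_lt|easy].
Qed.

Lemma sum_inv_sqr l : primes_list l -> lsum (fun n => (/ INR n) ^ 2) l <= 2.
Proof.
  intros [Hl Hp].
  apply Rle_trans with (lsum (fun n => isq n ^ 3) l).
  - apply lsum_le; intros n Hn; apply inv_sqr_le_isq3.
    apply Hp, is_prime_gt1 in Hn; lia.
  - replace 2 with (2 * isq 1).
    + apply sum_isq3; [lia|easy|intros n Hn; now apply is_prime_gt1, Hp].
    + unfold isq; simpl; rewrite sqrt_1; field.
Qed.

(** The distinct primes dividing [m] can be divided out one after another; removing one leaves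
    divisibility by the others unchanged. *)
Lemma sum_log_dividing l m : primes_list l -> (1 <= m)%nat ->
  lsum (fun p => if Nat.eqb (m mod p) 0 then ln (INR p) else 0) l <= ln (INR m).
Proof.
  revert m; induction l as [|p l IH]; intros m Hl Hm.
  - simpl; rewrite <- ln_1; apply ln_le; [lra|].
    change 1 with (INR 1); apply le_INR; lia.
  - apply primes_list_inv in Hl; destruct Hl as (Hp & Hni & Hl).
    assert (H1 := is_prime_gt1 p Hp).
    simpl; destruct (Nat.eqb_spec (m mod p) 0) as [E|E].
    2:{ rewrite Rplus_0_l; now apply IH. }
    apply Nat.Lcm0.mod_divide in E; destruct E as [m' ->].
    assert (Hm' : (1 <= m')%nat) by nia.
    rewrite mult_INR, ln_mult by (apply lt_0_INR; lia).
    specialize (IH m' Hl Hm').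
    replace (lsum _ l) with
      (lsum (fun q => if Nat.eqb (m' mod q) 0 then ln (INR q) else 0) l); [lra|].
    apply lsum_ext; intros q Hq.
    assert (Pq : is_prime q = true) by (now apply Hl).
    assert (Hq1 := is_prime_gt1 q Pq).
    destruct (Nat.eqb_spec (m' mod q) 0) as [E1|E1];
      destruct (Nat.eqb_spec ((m' * p) mod q) 0) as [E2|E2]; try easy; exfalso.
    + apply E2, Nat.Lcm0.mod_divide; apply Nat.Lcm0.mod_divide in E1.
      now apply Nat.divide_mul_l.
    + apply Nat.Lcm0.mod_divide in E2.
      apply PrimeFacts.prime_divide_mul in E2; [|easy]; destruct E2 as [E2|E2].
      * now apply E1, Nat.Lcm0.mod_divide.
      * apply PrimeFacts.prime_divide_prime in E2; [|easy|easy]; subst q; easy.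
Qed.

Lemma count_multiples p n : (1 <= p)%nat ->
  lsum (fun m => if Nat.eqb (m mod p) 0 then 1 else 0) (seq 1 n) = INR (n / p).
Proof.
  intros Hp; induction n as [|n IH].
  - rewrite Nat.Div0.div_0_l; easy.
  - rewrite lsum_seq_S, IH.
    change (1 + n)%nat with (S n).
    assert (E := Nat.div_mod_eq n p); assert (E' := Nat.mod_upper_bound n p ltac:(lia)).
    assert (F := Nat.div_mod_eq (S n) p); assert (F' := Nat.mod_upper_bound (S n) p ltac:(lia)).
    destruct (Nat.eqb_spec (S n mod p) 0) as [G|G].
    + rewrite <- S_INR; f_equal; nia.
    + rewrite Rplus_0_r; f_equal; nia.
Qed.

(** Chebyshev's double count of [log p] over pairs [p | m <= n]. Summed by [m] it is at most
    [n log n]; summed by [p] it is [log p] times the integer part of [n / p], which is at least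
    [n / (2 p)]. Hence the 2. *)
Lemma mertens_log n : (1 <= n)%nat ->
  lsum (fun p => ln (INR p) / INR p) (PR 0 n) <= 2 * ln (INR n).
Proof.
  intros Hn.
  assert (Pn : 0 < INR n) by (apply lt_0_INR; lia).
  assert (H1 : lsum (fun m => lsum (fun p => if Nat.eqb (m mod p) 0 then ln (INR p) else 0) (PR 0 n))
                 (seq 1 n) <= INR n * ln (INR n)).
  { apply Rle_trans with (lsum (fun _ => ln (INR n)) (seq 1 n)).
    - apply lsum_le; intros m Hm; apply in_seq in Hm.
      eapply Rle_trans; [apply sum_log_dividing; [apply PR_primes|lia]|].
      apply ln_le; [apply lt_0_INR; lia|apply le_INR; lia].
    - clear Pn; generalize (ln (INR n)) as c; generalize 1%nat as s; clear Hn.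
      induction n as [|n IH]; intros s c; [simpl; lra|].
      rewrite S_INR; simpl seq; simpl lsum; specialize (IH (S s) c); lra. }
  rewrite lsum_swap in H1.
  assert (H2 : lsum (fun p => INR n / 2 * (ln (INR p) / INR p)) (PR 0 n) <= INR n * ln (INR n)).
  { eapply Rle_trans; [|apply H1].
    apply lsum_le; intros p Hp; apply in_PR in Hp; destruct Hp as [Hp Pp].
    apply is_prime_gt1 in Pp.
    rewrite (lsum_ext _ (fun m => ln (INR p) * (if Nat.eqb (m mod p) 0 then 1 else 0)))
      by (intros m _; destruct (Nat.eqb (m mod p) 0); ring).
    rewrite lsum_scal, count_multiples by lia.
    assert (Hq : INR n <= 2 * INR p * INR (n / p)).
    { assert (E := Nat.div_mod_eq n p); assert (E' := Nat.mod_upper_bound n p ltac:(lia)).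
      assert (1 <= n / p)%nat by (apply Nat.div_le_lower_bound; lia).
      change 2 with (INR 2); rewrite <- !mult_INR; apply le_INR; nia. }
    assert (Pp' : 0 < INR p) by (apply lt_0_INR; lia).
    assert (Hl : 0 <= ln (INR p)).
    { rewrite <- ln_1; apply ln_le; [lra|]; change 1 with (INR 1); apply le_INR; lia. }
    replace (INR n / 2 * (ln (INR p) / INR p)) with (ln (INR p) * (INR n / (2 * INR p)))
      by (field; lra).
    apply Rmult_le_compat_l; [easy|].
    apply Rmult_le_reg_r with (2 * INR p); [lra|].
    unfold Rdiv; rewrite Rmult_assoc, Rinv_l; lra. }
  rewrite lsum_scal in H2.
  apply Rmult_le_reg_l with (INR n / 2); lra.
Qed.

Lemma Rpower_mult_base x y a : 0 < x -> 0 < y -> Rpower (x * y) a = Rpower x a * Rpower y a.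
Proof. intros; unfold Rpower; rewrite ln_mult by easy; rewrite <- exp_plus; f_equal; ring. Qed.

Lemma Rpower_INR_mult a x y : (1 <= x)%nat -> (1 <= y)%nat ->
  Rpower (INR (x * y)) a = Rpower (INR x) a * Rpower (INR y) a.
Proof. intros; rewrite mult_INR, Rpower_mult_base; [easy|apply lt_0_INR; lia..]. Qed.

Lemma Rpower_1_base a : Rpower 1 a = 1.
Proof. unfold Rpower; rewrite ln_1, Rmult_0_r; apply exp_0. Qed.

(** Comparison with the integral of [x^(-1-d)] in telescoping form: [(1 - 1/x)^(-d) >= 1 + d/x]
    gives [x^(-1-d) <= ((x-1)^(-d) - x^(-d)) / d]. *)
Lemma zeta_partial d M : 0 < d ->
  lsum (fun n => Rpower (INR n) (-1 - d)) (seq 1 (S M)) <= 1 + / d * (1 - Rpower (INR (S M)) (- d)).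
Proof.
  intros Hd; induction M as [|M IH].
  - simpl; rewrite !Rpower_1_base; lra.
  - rewrite lsum_seq_S.
    change (1 + S M)%nat with (S (S M)).
    set (x := INR (S (S M))).
    assert (Ex : INR (S M) = x - 1) by (unfold x; rewrite (S_INR (S M)); lra).
    assert (Hx : 2 <= x) by (unfold x; rewrite !S_INR; assert (H := pos_INR M); lra).
    assert (Hs : Rpower x (-1 - d) <= / d * (Rpower (x - 1) (- d) - Rpower x (- d))).
    { replace (-1 - d) with (- d + Ropp 1) by ring; rewrite Rpower_plus.
      replace (Rpower x (Ropp 1)) with (/ x) by (rewrite Rpower_Ropp, Rpower_1; lra).
      replace (x - 1) with (x * (1 - / x)) by (field; lra).
      assert (Hi : 0 < / x <= / 2) by
        (split; [apply Rinv_0_lt_compat; lra|apply Rinv_le_contravar; lra]).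
      rewrite Rpower_mult_base by lra.
      assert (He : 1 + d * / x <= Rpower (1 - / x) (- d)).
      { eapply Rle_trans; [apply one_plus_le_exp|]; unfold Rpower.
        apply exp_le; assert (Hl := ln_le_sub (1 - / x) ltac:(lra)); nra. }
      assert (P := Rpower_pos x (- d)).
      apply Rmult_le_reg_l with d; [easy|].
      replace (d * (/ d * (Rpower x (- d) * Rpower (1 - / x) (- d) - Rpower x (- d))))
        with (Rpower x (- d) * (Rpower (1 - / x) (- d) - 1)) by (field; lra).
      nra. }
    fold x; rewrite Ex in IH.
    assert (E : / d * (1 - Rpower x (- d)) =
      / d * (1 - Rpower (x - 1) (- d)) + / d * (Rpower (x - 1) (- d) - Rpower x (- d))) by ring.
    lra.
Qed.

(** [smooth 1 l] lists squarefree products, so [prod (1 + p^(-1-d))] is a part of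
    [zeta (1 + d) <= 1 + 1/d]. Take logarithms with [ln (1 + x) >= x - x^2]; the 2 bounds
    [sum p^(-2)]. *)
Lemma sum_prime_power l d : primes_list l -> 0 < d ->
  lsum (fun p => Rpower (INR p) (-1 - d)) l <= ln (1 + / d) + 2.
Proof.
  intros Hl Hd; assert (Hd' := Rinv_0_lt_compat d Hd).
  set (f := fun n => Rpower (INR n) (-1 - d)).
  assert (H1 : lsum f (smooth 1 l) <= 1 + / d).
  { destruct (list_bound (smooth 1 l)) as [M HM].
    apply Rle_trans with (lsum f (seq 1 (S M))).
    - apply lsum_incl; [now apply smooth_NoDup| |intros n _; left; apply Rpower_pos].
      intros n Hn; apply in_seq; specialize (HM n Hn).
      apply smooth_pos in Hn; [lia|apply Hl].
    - eapply Rle_trans; [now apply zeta_partial|].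
      assert (P := Rpower_pos (INR (S M)) (- d)); nra. }
  rewrite (lsum_smooth f) in H1.
  2:{ unfold f; simpl; apply Rpower_1_base. }
  2:{ intros; now apply Rpower_INR_mult. }
  2:{ apply Hl. }
  assert (H2 : exp (lsum (fun p => f p - f p ^ 2) l) <= 1 + / d).
  { eapply Rle_trans; [|apply H1].
    rewrite <- lprod_exp; apply lprod_le; intros p Hp; split; [left; apply exp_pos|].
    simpl lsum; rewrite Nat.mul_1_r, Rplus_0_r.
    replace (f 1%nat) with 1 by (unfold f; simpl; now rewrite Rpower_1_base).
    assert (Hf : 0 < f p) by apply Rpower_pos.
    rewrite <- (exp_ln (1 + f p)) by lra; apply exp_le.
    assert (Hl1 := ln_le_sub (/ (1 + f p)) ltac:(apply Rinv_0_lt_compat; lra)).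
    rewrite ln_Rinv in Hl1 by lra.
    assert (E : / (1 + f p) - 1 <= - f p + f p ^ 2).
    { apply Rmult_le_reg_r with (1 + f p); [lra|].
      rewrite Rmult_minus_distr_r, Rinv_l by lra.
      assert (0 < f p ^ 3) by (apply pow_lt; easy); nra. }
    lra. }
  assert (H3 : lsum (fun p => f p ^ 2) l <= 2).
  { eapply Rle_trans; [|apply (sum_inv_sqr l Hl)].
    apply lsum_le; intros p Hp; apply Hl, is_prime_gt1 in Hp.
    apply pow_incr; split; [left; apply Rpower_pos|].
    assert (Hp1 : 1 < INR p) by (change 1 with (INR 1); apply lt_INR; lia).
    unfold f; rewrite <- (Rpower_1 (INR p)) at 2 by lra; rewrite <- Rpower_Ropp.
    apply Rle_Rpower; lra. }
  assert (H4 : lsum (fun p => f p - f p ^ 2) l <= ln (1 + / d)).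
  { rewrite <- (ln_exp (lsum _ _)); apply ln_le; [apply exp_pos|easy]. }
  assert (E : lsum f l = lsum (fun p => f p - f p ^ 2) l + lsum (fun p => f p ^ 2) l).
  { rewrite <- lsum_plus; apply lsum_ext; intros; ring. }
  rewrite E; lra.
Qed.

Lemma ln_le_harmonic n : ln (INR (S n)) <= lsum (fun m => / INR m) (seq 1 n).
Proof.
  induction n as [|n IH]; [simpl; rewrite ln_1; lra|].
  rewrite lsum_seq_S.
  change (1 + n)%nat with (S n).
  assert (P : 0 < INR (S n)) by (apply lt_0_INR; lia).
  assert (E : INR (S (S n)) = INR (S n) * (1 + / INR (S n))).
  { rewrite (S_INR (S n)); field; lra. }
  assert (Pi := Rinv_0_lt_compat _ P).
  rewrite E, ln_mult by lra.
  assert (H := ln_le_sub (1 + / INR (S n)) ltac:(lra)).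
  lra.
Qed.

Lemma geometric_le x l0 J : 0 <= x < 1 ->
  lsum (fun j => x ^ j) (seq l0 J) <= x ^ l0 / (1 - x).
Proof.
  intros Hx; revert l0; induction J as [|J IH]; intros l0; simpl.
  - apply Rdiv_le_0_compat; [apply pow_le; lra|lra].
  - specialize (IH (S l0)); simpl in IH.
    replace (x ^ l0 / (1 - x)) with (x ^ l0 + x * x ^ l0 / (1 - x)) by (field; lra); lra.
Qed.

Lemma inv_one_minus_le x : 0 <= x <= / 2 -> / (1 - x) <= exp (x + 2 * x ^ 2).
Proof.
  intros Hx; replace (/ (1 - x)) with (1 + x / (1 - x)) by (field; lra).
  eapply Rle_trans; [apply one_plus_le_exp|]; apply exp_le.
  apply Rmult_le_reg_r with (1 - x); [lra|].
  unfold Rdiv; rewrite Rmult_assoc, Rinv_l by lra.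
  assert (0 <= x ^ 2 * (1 - 2 * x)) by (apply Rmult_le_pos; [apply pow2_ge_0|lra]); nra.
Qed.

(** Euler's argument: with exponents up to [n] the products contain every [m <= n], so [ln n] is at
    most [prod 1 / (1 - 1/p)]. The 4 bounds [2 sum p^(-2)]. *)
Lemma mertens_lower n : (2 <= n)%nat ->
  ln (ln (INR n)) - 4 <= lsum (fun p => / INR p) (PR 0 n).
Proof.
  intros Hn; set (f := fun m => / INR m).
  assert (H1 : ln (INR n) <= lsum f (smooth n (PR 0 n))).
  { apply Rle_trans with (ln (INR (S n))).
    { apply ln_le; [apply lt_0_INR; lia|apply le_INR; lia]. }
    eapply Rle_trans; [apply ln_le_harmonic|].
    apply lsum_incl; [apply seq_NoDup| |].
    - intros m Hm; apply in_seq in Hm; apply smooth_contains_range; lia.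
    - intros m Hm; apply smooth_pos in Hm; [|apply PR_primes].
      left; apply Rinv_0_lt_compat, lt_0_INR; lia. }
  rewrite (lsum_smooth f) in H1.
  2:{ unfold f; simpl; apply Rinv_1. }
  2:{ intros a b _ _; unfold f; rewrite mult_INR; apply Rinv_mult. }
  2:{ apply PR_primes. }
  assert (H2 : ln (INR n) <= exp (lsum (fun p => / INR p + 2 * (/ INR p) ^ 2) (PR 0 n))).
  { eapply Rle_trans; [apply H1|].
    rewrite <- lprod_exp; apply lprod_le; intros p Hp.
    apply PR_primes, is_prime_gt1 in Hp.
    assert (Hp2 : 2 <= INR p) by (change 2 with (INR 2); apply le_INR; lia).
    assert (Hi : 0 < / INR p <= / 2) by
      (split; [apply Rinv_0_lt_compat; lra|apply Rinv_le_contravar; lra]).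
    rewrite (lsum_ext _ (fun j => (/ INR p) ^ j)).
    2:{ intros j _; unfold f; rewrite pow_INR, pow_inv; easy. }
    split; [apply lsum_nonneg; intros j _; apply pow_le; lra|].
    eapply Rle_trans; [apply geometric_le; lra|].
    unfold Rdiv; rewrite pow_O, Rmult_1_l; apply inv_one_minus_le; lra. }
  assert (Pl : 0 < ln (INR n)).
  { rewrite <- ln_1; apply ln_increasing; [lra|]; change 1 with (INR 1); apply lt_INR; lia. }
  apply ln_le in H2; [|easy]; rewrite ln_exp, lsum_plus, lsum_scal in H2.
  assert (H3 := sum_inv_sqr _ (PR_primes 0 n)).
  unfold f; simpl in *; lra.
Qed.

(** Since [p^(-d) >= 1 - d ln p], the weight costs at most [d] times Chebyshev's sum, which is
    [O(1)] while [d ln n] is. *)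
Lemma sum_prime_power_ge n d : (1 <= n)%nat -> 0 <= d ->
  lsum (fun p => / INR p) (PR 0 n) - 2 * d * ln (INR n)
  <= lsum (fun p => Rpower (INR p) (-1 - d)) (PR 0 n).
Proof.
  intros Hn Hd.
  assert (H : lsum (fun p => / INR p + - d * (ln (INR p) / INR p)) (PR 0 n)
              <= lsum (fun p => Rpower (INR p) (-1 - d)) (PR 0 n)).
  { apply lsum_le; intros p Hp; apply PR_primes, is_prime_gt1 in Hp.
    assert (P : 0 < INR p) by (apply lt_0_INR; lia).
    replace (-1 - d) with (Ropp 1 + - d) by ring; rewrite Rpower_plus, Rpower_Ropp, Rpower_1 by easy.
    assert (E : 1 + - d * ln (INR p) <= Rpower (INR p) (- d)) by apply one_plus_le_exp.
    assert (Pi := Rinv_0_lt_compat _ P).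
    replace (/ INR p + - d * (ln (INR p) / INR p)) with (/ INR p * (1 + - d * ln (INR p)))
      by (field; lra).
    apply Rmult_le_compat_l; lra. }
  rewrite lsum_plus, lsum_scal in H.
  assert (M := mertens_log n Hn); nra.
Qed.

(** At [d = 1 / ln n] the weights [p^(-d)] cost only a constant over [p <= n], so the bound for
    [sum p^(-1-d)] serves for [sum 1/p]. The 6 is 2 for the weights, 2 from [sum_prime_power] and 2
    for [ln (1 + ln n)]. *)
Lemma mertens_upper n : (2 <= n)%nat ->
  lsum (fun p => / INR p) (PR 0 n) <= ln (ln (INR n)) + 6.
Proof.
  intros Hn.
  assert (H2 : 2 <= INR n) by (change 2 with (INR 2); apply le_INR; lia).
  assert (Hl : / 2 < ln (INR n)).
  { apply Rlt_le_trans with (ln 2); [exact ln_lt_2|apply ln_le; lra]. }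
  assert (Hd : 0 < / ln (INR n)) by (apply Rinv_0_lt_compat; lra).
  assert (A := sum_prime_power_ge n (/ ln (INR n)) ltac:(lia) ltac:(lra)).
  assert (B := sum_prime_power (PR 0 n) (/ ln (INR n)) (PR_primes 0 n) Hd).
  rewrite Rinv_inv in B.
  replace (2 * / ln (INR n) * ln (INR n)) with 2 in A by (field; lra).
  assert (C : ln (1 + ln (INR n)) <= 2 + ln (ln (INR n))).
  { apply Rle_trans with (ln (3 * ln (INR n))); [apply ln_le; lra|].
    rewrite ln_mult by lra; assert (D := ln_le_sub 3 ltac:(lra)); lra. }
  lra.
Qed.

(** * The conjugate function of an exponential sum *)

Definition cont2 (f : R -> R -> R) : Prop :=
  forall z : R * R, continuous (fun z => f (fst z) (snd z)) z.

Lemma cont2_plus f g : cont2 f -> cont2 g -> cont2 (fun s t => f s t + g s t).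
Proof.
  intros Hf Hg z.
  exact (continuous_plus (fun z => f (fst z) (snd z)) (fun z => g (fst z) (snd z)) z (Hf z) (Hg z)).
Qed.

Lemma cont2_mult f g : cont2 f -> cont2 g -> cont2 (fun s t => f s t * g s t).
Proof.
  intros Hf Hg z.
  exact (continuous_mult (fun z => f (fst z) (snd z)) (fun z => g (fst z) (snd z)) z (Hf z) (Hg z)).
Qed.

Lemma cont2_const c : cont2 (fun _ _ => c).
Proof. intros z; apply continuous_const. Qed.

Lemma cont2_comp f g : cont f -> cont2 g -> cont2 (fun s t => f (g s t)).
Proof.
  intros Hf Hg z.
  exact (continuous_comp (fun z => g (fst z) (snd z)) f z (Hg z) (Hf _)).
Qed.

Lemma cont2_fst f : cont f -> cont2 (fun s _ => f s).
Proof. intros Hf z; apply (continuous_comp fst f z); [apply continuous_fst|apply Hf]. Qed.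

Lemma cont2_snd f : cont f -> cont2 (fun _ t => f t).
Proof. intros Hf z; apply (continuous_comp snd f z); [apply continuous_snd|apply Hf]. Qed.

Lemma cont2_ext f g : (forall s t, f s t = g s t) -> cont2 f -> cont2 g.
Proof. intros E H z; apply (continuous_ext (fun z => f (fst z) (snd z))); [intros; apply E|apply H]. Qed.

Lemma cont2_sub f g : cont2 f -> cont2 g -> cont2 (fun s t => f s t - g s t).
Proof.
  intros Hf Hg; apply cont2_ext with (fun s t => f s t + (-1) * g s t); [intros; ring|].
  apply cont2_plus; [easy|]; apply cont2_mult; [apply cont2_const|easy].
Qed.

Lemma cont2_opp f : cont2 f -> cont2 (fun s t => - f s t).
Proof.
  intros Hf; apply cont2_ext with (fun s t => (-1) * f s t); [intros; ring|].
  apply cont2_mult; [apply cont2_const|easy].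
Qed.

Lemma cont2_sqr f : cont2 f -> cont2 (fun s t => f s t ^ 2).
Proof. intros Hf; apply cont2_ext with (fun s t => f s t * f s t); [intros; ring|now apply cont2_mult]. Qed.

Lemma cont2_lsum {A} (f : A -> R -> R -> R) l :
  (forall x, cont2 (f x)) -> cont2 (fun s t => lsum (fun x => f x s t) l).
Proof.
  intros H; induction l as [|x l IH]; simpl; [apply cont2_const|].
  now apply cont2_plus.
Qed.

Lemma cont2_Rpower f a : cont2 f -> cont2 (fun s t => Rpower (1 + f s t ^ 2) a).
Proof.
  intros Hf; apply (cont2_comp (fun y => Rpower (1 + y ^ 2) a)); [|easy].
  apply cont_Rpower; [|intros t; nra].
  apply cont_plus; [apply cont_const|apply cont_sqr, cont_id].
Qed.

Lemma cont2_section f s : cont2 f -> cont (f s).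
Proof.
  intros Hf t.
  apply (continuous_comp (fun t : R => (s, t)) (fun z : R * R => f (fst z) (snd z)) t); [|apply Hf].
  apply filterlim_locally; intros eps.
  exists eps; intros y Hy; split; [apply ball_center|exact Hy].
Qed.

Lemma is_derive_RInt_cont2 (f df : R -> R -> R) T s :
  (forall s t, is_derive (fun s => f s t) s (df s t)) -> cont2 df -> cont2 f ->
  is_derive (fun s => RInt (f s) 0 T) s (RInt (df s) 0 T).
Proof.
  intros Hd Hdf Hf.
  replace (RInt (df s) 0 T) with (RInt (fun t => Derive (fun s => f s t) s) 0 T).
  2:{ apply RInt_ext; intros t _; apply is_derive_unique, Hd. }
  apply (is_derive_RInt_param f).
  - exists (mkposreal 1 Rlt_0_1); intros y _ t _; exists (df y t); apply Hd.
  - intros t _; apply continuity_2d_pt_ext with df.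
    + intros x y; symmetry; apply is_derive_unique, Hd.
    + apply continuity_2d_pt_filterlim, (Hdf (s, t)).
  - exists (mkposreal 1 Rlt_0_1); intros y _; now apply cont_ex_RInt, cont2_section.
Qed.

Lemma mean_value f df a b : a < b -> (forall x, is_derive f x (df x)) ->
  exists c, a <= c <= b /\ f b - f a = df c * (b - a).
Proof.
  intros Hab Hf.
  destruct (MVT_gen f a b df) as (c & Hc & E).
  - intros x _; apply Hf.
  - intros x _; apply continuity_pt_filterlim.
    apply (ex_derive_continuous f); exists (df x); apply Hf.
  - rewrite Rmin_left, Rmax_right in Hc by lra; exists c; easy.
Qed.

(** A positive slope, once reached, persists by convexity and forces linear growth beyond [B]. *)
Lemma convex_bounded_decreasing f df ddf B :
  (forall s, is_derive f s (df s)) -> (forall s, is_derive df s (ddf s)) ->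
  (forall s, 0 <= s -> 0 <= ddf s) -> (forall s, 0 <= s -> f s <= B) ->
  forall s, 0 <= s -> f s <= f 0.
Proof.
  intros H1 H2 Hc HB s Hs.
  destruct (Rle_lt_dec (f s) (f 0)) as [H|H]; [easy|exfalso].
  assert (Hs0 : 0 < s) by (destruct Hs as [?|<-]; lra).
  destruct (mean_value f df 0 s Hs0 H1) as (c & Hc' & E).
  assert (Hd : 0 < df c) by nra.
  (* Far enough for growth at slope [df c] to have passed [B]. *)
  set (x := c + (Rabs (B - f c) + 1) / df c).
  assert (Hx : c < x).
  { assert (0 < (Rabs (B - f c) + 1) / df c); [|unfold x; lra].
    apply Rdiv_lt_0_compat; [assert (Q := Rabs_pos (B - f c)); lra|easy]. }
  destruct (mean_value f df c x Hx H1) as (e & He & E2).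
  assert (Hde : df c <= df e).
  { destruct (proj1 He) as [Hce|<-]; [|lra].
    destruct (mean_value df ddf c e Hce H2) as (y & Hy & E3).
    specialize (Hc y ltac:(lra)); nra. }
  assert (E4 : df c * (x - c) = Rabs (B - f c) + 1) by (unfold x; field; lra).
  assert (Q := Rle_abs (B - f c)).
  specialize (HB x ltac:(lra)); nra.
Qed.

(** * Exponential sums continued to a half-plane *)

Definition term : Type := R * (R * R).
Definition lam (x : term) : R := fst x.
Definition co (x : term) : R := fst (snd x).
Definition so (x : term) : R := snd (snd x).

(* Real and imaginary parts of [sum (co + i so) lam^m exp (lam (-s + i t))], a boundary
   exponential sum extended to the half-plane [s >= 0]. *)
Definition Um (m : nat) (l : list term) (s t : R) : R :=
  lsum (fun x => lam x ^ m * exp (- lam x * s) * (co x * cos (lam x * t) - so x * sin (lam x * t))) l.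
Definition Vm (m : nat) (l : list term) (s t : R) : R :=
  lsum (fun x => lam x ^ m * exp (- lam x * s) * (co x * sin (lam x * t) + so x * cos (lam x * t))) l.

Lemma is_derive_lsum {A} (f df : A -> R -> R) l s :
  (forall x, is_derive (f x) s (df x s)) ->
  is_derive (fun s => lsum (fun x => f x s) l) s (lsum (fun x => df x s) l).
Proof.
  intros H; induction l as [|x l IH]; simpl; [apply (is_derive_const (V := R_NormedModule))|].
  apply (is_derive_plus (f x) (fun s => lsum (fun x => f x s) l)); [apply H|apply IH].
Qed.

Lemma lsum_opp {A} (f : A -> R) l : - lsum f l = lsum (fun x => - f x) l.
Proof. induction l as [|x l IH]; simpl; [ring|rewrite <- IH; ring]. Qed.

(** Together with the next three lemmas, the Cauchy-Riemann equations; raising [m]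
    differentiates. *)
Lemma Um_ds m l s t : is_derive (fun s => Um m l s t) s (- Um (S m) l s t).
Proof.
  unfold Um; rewrite lsum_opp.
  apply (is_derive_lsum (fun x s => lam x ^ m * exp (- lam x * s)
           * (co x * cos (lam x * t) - so x * sin (lam x * t)))
         (fun x s => - (lam x ^ S m * exp (- lam x * s)
           * (co x * cos (lam x * t) - so x * sin (lam x * t))))).
  intros x; auto_derive; [easy|simpl; ring].
Qed.

Lemma Vm_ds m l s t : is_derive (fun s => Vm m l s t) s (- Vm (S m) l s t).
Proof.
  unfold Vm; rewrite lsum_opp.
  apply (is_derive_lsum (fun x s => lam x ^ m * exp (- lam x * s)
           * (co x * sin (lam x * t) + so x * cos (lam x * t)))
         (fun x s => - (lam x ^ S m * exp (- lam x * s)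
           * (co x * sin (lam x * t) + so x * cos (lam x * t))))).
  intros x; auto_derive; [easy|simpl; ring].
Qed.

Lemma Um_dt m l s t : is_derive (fun t => Um m l s t) t (- Vm (S m) l s t).
Proof.
  unfold Um, Vm; rewrite lsum_opp.
  apply (is_derive_lsum (fun x t => lam x ^ m * exp (- lam x * s)
           * (co x * cos (lam x * t) - so x * sin (lam x * t)))
         (fun x t => - (lam x ^ S m * exp (- lam x * s)
           * (co x * sin (lam x * t) + so x * cos (lam x * t))))).
  intros x; auto_derive; [easy|simpl; ring].
Qed.

Lemma Vm_dt m l s t : is_derive (fun t => Vm m l s t) t (Um (S m) l s t).
Proof.
  unfold Um, Vm.
  apply (is_derive_lsum (fun x t => lam x ^ m * exp (- lam x * s)
           * (co x * sin (lam x * t) + so x * cos (lam x * t)))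
         (fun x t => lam x ^ S m * exp (- lam x * s)
           * (co x * cos (lam x * t) - so x * sin (lam x * t)))).
  intros x; auto_derive; [easy|simpl; ring].
Qed.

Lemma cont_exp : cont exp.
Proof. apply cont_derivable; intros x; auto_derive; easy. Qed.

Lemma cont2_term_factors (x : term) m :
  cont2 (fun s _ => lam x ^ m * exp (- lam x * s)) /\
  cont2 (fun _ t => cos (lam x * t)) /\ cont2 (fun _ t => sin (lam x * t)).
Proof.
  repeat split.
  - apply cont2_mult; [apply cont2_const|].
    apply (cont2_fst (fun s => exp (- lam x * s))), cont_comp; [apply cont_exp|].
    apply cont_mult; [apply cont_const|apply cont_id].
  - apply (cont2_snd (fun t => cos (lam x * t))), cont_comp; [apply cont_cos|].
    apply cont_mult; [apply cont_const|apply cont_id].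
  - apply (cont2_snd (fun t => sin (lam x * t))), cont_comp; [apply cont_sin|].
    apply cont_mult; [apply cont_const|apply cont_id].
Qed.

Lemma cont2_Um m l : cont2 (Um m l).
Proof.
  apply cont2_lsum; intros x; destruct (cont2_term_factors x m) as (H1 & H2 & H3).
  apply cont2_mult; [easy|apply cont2_sub; apply cont2_mult; try apply cont2_const; easy].
Qed.

Lemma cont2_Vm m l : cont2 (Vm m l).
Proof.
  apply cont2_lsum; intros x; destruct (cont2_term_factors x m) as (H1 & H2 & H3).
  apply cont2_mult; [easy|apply cont2_plus; apply cont2_mult; try apply cont2_const; easy].
Qed.

Definition mass (m : nat) (l : list term) : R :=
  lsum (fun x => Rabs (lam x) ^ m * (Rabs (co x) + Rabs (so x))) l.

Lemma trig_bound c d x y : Rabs x <= 1 -> Rabs y <= 1 -> Rabs (c * x + d * y) <= Rabs c + Rabs d.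
Proof.
  intros Hx Hy; eapply Rle_trans; [apply Rabs_triang|]; rewrite !Rabs_mult.
  assert (A := Rabs_pos c); assert (B := Rabs_pos d); nra.
Qed.

Lemma Rabs_cos_le x : Rabs (cos x) <= 1.
Proof. apply Rabs_le; destruct (COS_bound x); lra. Qed.

Lemma Rabs_sin_le x : Rabs (sin x) <= 1.
Proof. apply Rabs_le; destruct (SIN_bound x); lra. Qed.

(** For [l0 > 0] this is exponential decay uniform in [t]; it controls both the boundary terms at
    the ends of a time interval and the behaviour at infinity. *)
Lemma UV_bound m l l0 s t :
  0 <= s -> (forall x, In x l -> l0 <= lam x) ->
  Rabs (Um m l s t) <= mass m l * exp (- l0 * s) /\ Rabs (Vm m l s t) <= mass m l * exp (- l0 * s).
Proof.
  intros Hs Hl; unfold mass; rewrite (Rmult_comm _ (exp _)), <- lsum_scal.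
  assert (E : forall x c, In x l -> Rabs c <= Rabs (co x) + Rabs (so x) ->
    Rabs (lam x ^ m * exp (- lam x * s) * c)
    <= exp (- l0 * s) * (Rabs (lam x) ^ m * (Rabs (co x) + Rabs (so x)))).
  { intros x c Hx Hc; rewrite !Rabs_mult, <- RPow_abs, (Rabs_pos_eq (exp _)) by (left; apply exp_pos).
    assert (H1 : exp (- lam x * s) <= exp (- l0 * s)) by (apply exp_le; specialize (Hl x Hx); nra).
    assert (H2 : 0 <= Rabs (lam x) ^ m) by (apply pow_le, Rabs_pos).
    assert (H3 := exp_pos (- lam x * s)); assert (H4 := Rabs_pos c).
    replace (exp (- l0 * s) * (Rabs (lam x) ^ m * (Rabs (co x) + Rabs (so x))))
      with (Rabs (lam x) ^ m * exp (- l0 * s) * (Rabs (co x) + Rabs (so x))) by ring.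
    apply Rmult_le_compat; [nra|easy| |easy].
    apply Rmult_le_compat_l; easy. }
  split; apply lsum_abs_le; intros x Hx; apply E; try easy.
  - unfold Rminus; rewrite Ropp_mult_distr_r.
    apply trig_bound; [apply Rabs_cos_le|rewrite Rabs_Ropp; apply Rabs_sin_le].
  - apply trig_bound; [apply Rabs_sin_le|apply Rabs_cos_le].
Qed.

Lemma min_frequency (l : list term) : (forall x, In x l -> 0 < lam x) ->
  exists l0, 0 < l0 /\ forall x, In x l -> l0 <= lam x.
Proof.
  induction l as [|y l IH]; intros H.
  - exists 1; split; [lra|intros x []].
  - destruct IH as (l0 & H0 & H1); [intros x Hx; apply H; now right|].
    exists (Rmin l0 (lam y)); split.
    + apply Rmin_pos; [easy|apply H; now left].
    + intros x [->|Hx]; [apply Rmin_r|].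
      eapply Rle_trans; [apply Rmin_l|now apply H1].
Qed.

Ltac derive_subst H :=
  match type of H with
  | is_derive ?f ?x ?d => change (Derive (fun y => f y) x) with (Derive f x);
                          rewrite ?(is_derive_unique f x d H)
  end.

Ltac cont2_tac :=
  lazymatch goal with
  | |- cont2 (fun s t => - @?f s t) => apply (cont2_opp f); cont2_tac
  | |- cont2 (fun s t => @?f s t + @?g s t) => apply (cont2_plus f g); cont2_tac
  | |- cont2 (fun s t => @?f s t - @?g s t) => apply (cont2_sub f g); cont2_tac
  | |- cont2 (fun s t => @?f s t * @?g s t) => apply (cont2_mult f g); cont2_tac
  | |- cont2 (fun s t => Rpower (1 + @?f s t ^ 2) ?a) => apply (cont2_Rpower f a); cont2_tac
  | |- cont2 (fun s t => @?f s t ^ 2) => apply (cont2_sqr f); cont2_tac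
  | |- cont2 (fun s t => Um ?m ?l s t) => exact (cont2_Um m l)
  | |- cont2 (fun s t => Vm ?m ?l s t) => exact (cont2_Vm m l)
  | |- cont2 (Um ?m ?l) => exact (cont2_Um m l)
  | |- cont2 (Vm ?m ?l) => exact (cont2_Vm m l)
  | |- _ => exact (cont2_const _)
  end.

(** Stands in for [|v|^(2a)]: the added 1 keeps it smooth and positive at [v = 0] for every real
    [a]. In the end it costs a factor [2^k] and an additive constant. *)
Definition onesq_pow (a v : R) : R := Rpower (1 + v ^ 2) a.

Lemma onesq_pow_pos a v : 0 < onesq_pow a v.
Proof. apply exp_pos. Qed.

Lemma onesq_pow_succ a v : onesq_pow a v = (1 + v ^ 2) * onesq_pow (a - 1) v.
Proof.
  unfold onesq_pow; rewrite <- (Rpower_1 (1 + v ^ 2)) at 2 by nra.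
  rewrite <- Rpower_plus; f_equal; ring.
Qed.

Lemma onesq_pow_derive a v s dv : is_derive v s dv ->
  is_derive (fun s => onesq_pow a (v s)) s (a * onesq_pow (a - 1) (v s) * (2 * v s * dv)).
Proof.
  intros H.
  assert (H1 : is_derive (fun y => Rpower y a) (1 + v s ^ 2) (a * Rpower (1 + v s ^ 2) (a - 1))).
  { apply is_derive_Reals, derivable_pt_lim_power; nra. }
  assert (H2 : is_derive (fun s => 1 + v s ^ 2) s (2 * v s * dv)).
  { auto_derive; [now exists dv|].
    derive_subst H; ring. }
  assert (H3 := is_derive_comp _ _ _ _ _ H1 H2).
  unfold scal in H3; simpl in H3; unfold mult in H3; simpl in H3.
  unfold onesq_pow; replace (a * Rpower (1 + v s ^ 2) (a - 1) * (2 * v s * dv))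
    with (2 * v s * dv * (a * Rpower (1 + v s ^ 2) (a - 1))) by ring.
  exact H3.
Qed.

Lemma onesq_pow_le a v M : 0 <= a -> Rabs v <= M -> onesq_pow a v <= onesq_pow a M.
Proof.
  intros Ha Hv; apply Rle_Rpower_l; [easy|].
  assert (v ^ 2 <= M ^ 2) by (rewrite <- Rsqr_pow2, <- (Rsqr_pow2 M); apply Rsqr_le_abs_1;
    assert (H := Rabs_pos v); rewrite (Rabs_pos_eq M); lra).
  nra.
Qed.

Lemma mass_nonneg m l : 0 <= mass m l.
Proof.
  apply lsum_nonneg; intros x _; apply Rmult_le_pos; [apply pow_le, Rabs_pos|].
  apply Rplus_le_le_0_compat; apply Rabs_pos.
Qed.

Lemma Rabs_mult_le a b x y : Rabs a <= x -> Rabs b <= y -> Rabs (a * b) <= x * y.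
Proof.
  intros; rewrite Rabs_mult; apply Rmult_le_compat; try easy; apply Rabs_pos.
Qed.

Lemma Rabs_plus_le a b x y : Rabs a <= x -> Rabs b <= y -> Rabs (a + b) <= x + y.
Proof. intros; eapply Rle_trans; [apply Rabs_triang|lra]. Qed.

(** * Subharmonic functions of an analytic exponential sum *)

Section Subharmonic.

Variables k A B : R.
Hypothesis Hk : 2 <= k.

(** Two instances matter: [A = 0], [B = 1] for moving between the boundary and the interior, and
    Essen's [A = 2 k^2], [B = -1] for passing to the conjugate. *)
Definition essen (u v : R) : R := A * u ^ 2 * onesq_pow (k - 1) v + B * onesq_pow k v.
Definition essen_x (u v : R) : R := 2 * A * u * onesq_pow (k - 1) v.
Definition essen_y (u v : R) : R :=
  2 * A * (k - 1) * u ^ 2 * v * onesq_pow (k - 2) v + 2 * B * k * v * onesq_pow (k - 1) v.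
Definition essen_xx (u v : R) : R := 2 * A * onesq_pow (k - 1) v.
Definition essen_xy (u v : R) : R := 4 * A * (k - 1) * u * v * onesq_pow (k - 2) v.
Definition essen_yy (u v : R) : R :=
  2 * A * (k - 1) * u ^ 2 * (onesq_pow (k - 2) v + 2 * (k - 2) * v ^ 2 * onesq_pow (k - 3) v)
  + 2 * B * k * (onesq_pow (k - 1) v + 2 * (k - 1) * v ^ 2 * onesq_pow (k - 2) v).

(** Stated along a curve, so that the same rules serve for derivatives in [s] and in [t]. *)
Lemma chain_rules u v s du dv : is_derive u s du -> is_derive v s dv ->
  is_derive (fun s => essen (u s) (v s)) s (essen_x (u s) (v s) * du + essen_y (u s) (v s) * dv) /\
  is_derive (fun s => essen_x (u s) (v s)) s (essen_xx (u s) (v s) * du + essen_xy (u s) (v s) * dv) /\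
  is_derive (fun s => essen_y (u s) (v s)) s (essen_xy (u s) (v s) * du + essen_yy (u s) (v s) * dv).
Proof.
  intros Hu Hv.
  assert (H0 := onesq_pow_derive k v s dv Hv).
  assert (H1 := onesq_pow_derive (k - 1) v s dv Hv).
  assert (H2 := onesq_pow_derive (k - 2) v s dv Hv).
  replace (k - 1 - 1) with (k - 2) in H1 by ring.
  replace (k - 2 - 1) with (k - 3) in H2 by ring.
  unfold essen, essen_x, essen_y, essen_xx, essen_xy, essen_yy.
  pose (p0 := fun s => onesq_pow k (v s)); pose (p1 := fun s => onesq_pow (k - 1) (v s)).
  pose (p2 := fun s => onesq_pow (k - 2) (v s)).
  change (is_derive p0 s (k * onesq_pow (k - 1) (v s) * (2 * v s * dv))) in H0.
  change (is_derive p1 s ((k - 1) * onesq_pow (k - 2) (v s) * (2 * v s * dv))) in H1.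
  change (is_derive p2 s ((k - 2) * onesq_pow (k - 3) (v s) * (2 * v s * dv))) in H2.
  assert (Eu : ex_derive u s) by now exists du.
  assert (Ev : ex_derive v s) by now exists dv.
  assert (E0 : ex_derive p0 s) by (eexists; exact H0).
  assert (E1 : ex_derive p1 s) by (eexists; exact H1).
  assert (E2 : ex_derive p2 s) by (eexists; exact H2).
  refine (conj _ (conj _ _)).
  - change (is_derive (fun s => A * u s ^ 2 * p1 s + B * p0 s) s
      (2 * A * u s * p1 s * du + (2 * A * (k - 1) * u s ^ 2 * v s * p2 s + 2 * B * k * v s * p1 s) * dv)).
    auto_derive; [repeat split; easy|].
    derive_subst Hu;
    derive_subst H0;
    derive_subst H1.
    unfold p0, p1, p2; ring.
  - change (is_derive (fun s => 2 * A * u s * p1 s) s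
      (2 * A * p1 s * du + 4 * A * (k - 1) * u s * v s * p2 s * dv)).
    auto_derive; [repeat split; easy|].
    derive_subst Hu;
    derive_subst H1.
    unfold p1, p2; ring.
  - change (is_derive (fun s => 2 * A * (k - 1) * u s ^ 2 * v s * p2 s + 2 * B * k * v s * p1 s) s
      (4 * A * (k - 1) * u s * v s * p2 s * du
       + (2 * A * (k - 1) * u s ^ 2 * (p2 s + 2 * (k - 2) * v s ^ 2 * onesq_pow (k - 3) (v s))
          + 2 * B * k * (p1 s + 2 * (k - 1) * v s ^ 2 * p2 s)) * dv)).
    auto_derive; [repeat split; easy|].
    derive_subst Hu;
    derive_subst Hv;
    derive_subst H1;
    derive_subst H2.
    unfold p1, p2; ring.
Qed.

Hypothesis HA : 0 <= A.
Hypothesis HAB1 : 0 <= A + B * k.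
Hypothesis HAB2 : 0 <= A + B * (k * (2 * k - 1)).

(** Half of the Laplacian, apart from its nonnegative [u^2] part, is [onesq_pow (k-2) v] times
    [(A + B k) + (A + B k (2k-1)) v^2]; the hypotheses are the signs of these two coefficients. For
    [B = -1] the second asks [A >= 2 k^2 - k], which explains the choice [2 k^2]. *)
Lemma laplacian_nonneg u v : 0 <= essen_xx u v + essen_yy u v.
Proof.
  unfold essen_xx, essen_yy.
  assert (P2 := onesq_pow_pos (k - 2) v); assert (P3 := onesq_pow_pos (k - 3) v).
  assert (E : onesq_pow (k - 1) v = (1 + v ^ 2) * onesq_pow (k - 2) v).
  { rewrite onesq_pow_succ; do 2 f_equal; ring. }
  rewrite E.
  assert (T1 : 0 <= 2 * A * (k - 1) * u ^ 2 * (onesq_pow (k - 2) v + 2 * (k - 2) * v ^ 2 * onesq_pow (k - 3) v)).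
  { apply Rmult_le_pos; [apply Rmult_le_pos; [nra|apply pow2_ge_0]|].
    apply Rplus_le_le_0_compat; [lra|].
    apply Rmult_le_pos; [apply Rmult_le_pos; [lra|apply pow2_ge_0]|lra]. }
  assert (T2 : 0 <= (A + B * k) * onesq_pow (k - 2) v) by (apply Rmult_le_pos; lra).
  assert (T3 : 0 <= (A + B * (k * (2 * k - 1))) * (v ^ 2 * onesq_pow (k - 2) v)).
  { apply Rmult_le_pos; [lra|apply Rmult_le_pos; [apply pow2_ge_0|lra]]. }
  nra.
Qed.

Variable l : list term.
Variable l0 : R.
Hypothesis Hl0 : 0 < l0.
Hypothesis Hl : forall x, In x l -> l0 <= lam x.

Definition phi s t : R := essen (Um 0 l s t) (Vm 0 l s t).
Definition phi_s s t : R :=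
  - (essen_x (Um 0 l s t) (Vm 0 l s t) * Um 1 l s t + essen_y (Um 0 l s t) (Vm 0 l s t) * Vm 1 l s t).
Definition phi_t s t : R :=
  essen_y (Um 0 l s t) (Vm 0 l s t) * Um 1 l s t - essen_x (Um 0 l s t) (Vm 0 l s t) * Vm 1 l s t.
(** In [phi_ss + phi_tt] the mixed terms and those with [Um 2], [Vm 2] cancel, leaving the Laplacian
    of [essen] times [Um 1 ^ 2 + Vm 1 ^ 2]. *)
Definition phi_ss s t : R :=
  essen_xx (Um 0 l s t) (Vm 0 l s t) * Um 1 l s t ^ 2
  + 2 * essen_xy (Um 0 l s t) (Vm 0 l s t) * Um 1 l s t * Vm 1 l s t
  + essen_yy (Um 0 l s t) (Vm 0 l s t) * Vm 1 l s t ^ 2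
  + essen_x (Um 0 l s t) (Vm 0 l s t) * Um 2 l s t + essen_y (Um 0 l s t) (Vm 0 l s t) * Vm 2 l s t.
Definition phi_tt s t : R :=
  essen_xx (Um 0 l s t) (Vm 0 l s t) * Vm 1 l s t ^ 2
  - 2 * essen_xy (Um 0 l s t) (Vm 0 l s t) * Um 1 l s t * Vm 1 l s t
  + essen_yy (Um 0 l s t) (Vm 0 l s t) * Um 1 l s t ^ 2
  - essen_x (Um 0 l s t) (Vm 0 l s t) * Um 2 l s t - essen_y (Um 0 l s t) (Vm 0 l s t) * Vm 2 l s t.

Lemma phi_ds s t : is_derive (fun s => phi s t) s (phi_s s t).
Proof.
  assert (H := proj1 (chain_rules (fun s => Um 0 l s t) (fun s => Vm 0 l s t) s _ _
                        (Um_ds 0 l s t) (Vm_ds 0 l s t))).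
  unfold phi, phi_s; simpl in H |- *.
  match type of H with is_derive _ _ ?x => match goal with |- is_derive _ _ ?y =>
    replace y with x by ring end end; exact H.
Qed.

Lemma phi_s_ds s t : is_derive (fun s => phi_s s t) s (phi_ss s t).
Proof.
  destruct (chain_rules (fun s => Um 0 l s t) (fun s => Vm 0 l s t) s _ _
                        (Um_ds 0 l s t) (Vm_ds 0 l s t)) as (_ & H1 & H2).
  assert (H3 := Um_ds 1 l s t); assert (H4 := Vm_ds 1 l s t).
  unfold phi_s.
  pose (x := fun s => essen_x (Um 0 l s t) (Vm 0 l s t)).
  pose (y := fun s => essen_y (Um 0 l s t) (Vm 0 l s t)).
  pose (u1 := fun s => Um 1 l s t); pose (v1 := fun s => Vm 1 l s t).
  match type of H1 with is_derive _ _ ?d => change (is_derive x s d) in H1 end.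
  match type of H2 with is_derive _ _ ?d => change (is_derive y s d) in H2 end.
  match type of H3 with is_derive _ _ ?d => change (is_derive u1 s d) in H3 end.
  match type of H4 with is_derive _ _ ?d => change (is_derive v1 s d) in H4 end.
  change (is_derive (fun s => - (x s * u1 s + y s * v1 s)) s (phi_ss s t)).
  auto_derive; [repeat split; try easy; eexists; eassumption|].
  derive_subst H1;
    derive_subst H2;
    derive_subst H3;
    derive_subst H4.
  unfold phi_ss, x, y, u1, v1; ring.
Qed.

Lemma phi_t_dt s t : is_derive (fun t => phi_t s t) t (phi_tt s t).
Proof.
  destruct (chain_rules (fun t => Um 0 l s t) (fun t => Vm 0 l s t) t _ _
                        (Um_dt 0 l s t) (Vm_dt 0 l s t)) as (_ & H1 & H2).
  assert (H3 := Um_dt 1 l s t); assert (H4 := Vm_dt 1 l s t).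
  unfold phi_t.
  pose (x := fun t => essen_x (Um 0 l s t) (Vm 0 l s t)).
  pose (y := fun t => essen_y (Um 0 l s t) (Vm 0 l s t)).
  pose (u1 := fun t => Um 1 l s t); pose (v1 := fun t => Vm 1 l s t).
  match type of H1 with is_derive _ _ ?d => change (is_derive x t d) in H1 end.
  match type of H2 with is_derive _ _ ?d => change (is_derive y t d) in H2 end.
  match type of H3 with is_derive _ _ ?d => change (is_derive u1 t d) in H3 end.
  match type of H4 with is_derive _ _ ?d => change (is_derive v1 t d) in H4 end.
  change (is_derive (fun t => y t * u1 t - x t * v1 t) t (phi_tt s t)).
  auto_derive; [repeat split; try easy; eexists; eassumption|].
  derive_subst H1;
    derive_subst H2;
    derive_subst H3;
    derive_subst H4.
  unfold phi_tt, x, y, u1, v1; ring.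
Qed.

Lemma cont2_all : cont2 phi /\ cont2 phi_s /\ cont2 phi_ss /\ cont2 phi_tt.
Proof.
  unfold phi, phi_s, phi_ss, phi_tt, essen, essen_x, essen_y, essen_xx, essen_xy, essen_yy, onesq_pow.
  refine (conj _ (conj _ (conj _ _))); cont2_tac.
Qed.

Lemma exp_decay_le_1 s : 0 <= s -> 0 < exp (- l0 * s) <= 1.
Proof. intros Hs; split; [apply exp_pos|]; rewrite <- exp_0; apply exp_le; nra. Qed.

Lemma gradient_bound M : 0 <= M ->
  exists K, 0 <= K /\ forall u v, Rabs u <= M -> Rabs v <= M -> Rabs (essen_x u v) <= K /\ Rabs (essen_y u v) <= K
    /\ Rabs (essen u v) <= K.
Proof.
  intros HM.
  set (K1 := Rabs (2 * A) * M * onesq_pow (k - 1) M).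
  set (K2 := Rabs (2 * A * (k - 1)) * (M * M) * M * onesq_pow (k - 2) M + Rabs (2 * B * k) * M * onesq_pow (k - 1) M).
  set (K3 := Rabs A * (M * M) * onesq_pow (k - 1) M + Rabs B * onesq_pow k M).
  assert (HP : forall a v, 0 <= a -> Rabs v <= M -> Rabs (onesq_pow a v) <= onesq_pow a M).
  { intros a v Ha Hv; rewrite Rabs_pos_eq by (left; apply onesq_pow_pos); now apply onesq_pow_le. }
  assert (Q := onesq_pow_pos).
  assert (HK1 : 0 <= K1) by (unfold K1; repeat apply Rmult_le_pos; try apply Rabs_pos; try easy; left; apply Q).
  assert (HK2 : 0 <= K2).
  { unfold K2; apply Rplus_le_le_0_compat; repeat apply Rmult_le_pos; try apply Rabs_pos; try easy; left; apply Q. }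
  assert (HK3 : 0 <= K3).
  { unfold K3; apply Rplus_le_le_0_compat; repeat apply Rmult_le_pos; try apply Rabs_pos; try easy; left; apply Q. }
  exists (K1 + K2 + K3); split; [lra|]; intros u v Hu Hv; unfold essen_x, essen_y, essen.
  replace (u ^ 2) with (u * u) by ring.
  repeat split.
  - apply Rle_trans with K1; [|lra].
    repeat (apply Rmult_le_pos || apply Rabs_mult_le); try easy; try lra; apply HP; lra || easy.
  - apply Rle_trans with K2; [|lra].
    apply Rabs_plus_le; repeat apply Rabs_mult_le; try easy; try lra; apply HP; lra || easy.
  - apply Rle_trans with K3; [|lra].
    apply Rabs_plus_le; repeat apply Rabs_mult_le; try easy; try lra; apply HP; lra || easy.
Qed.

(** Let [I(s)] be the integral of [phi s] over [[0, T]]. Subharmonicity gives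
    [I'' >= - (phi_t s T - phi_t s 0)], boundary terms of size [exp (-l0 s)]. Once these are
    compensated, [I] is convex and bounded on [s >= 0], so it cannot grow. As [K] is independent of
    [T], it disappears in long averages. *)
Lemma subharmonic_mean_decreasing :
  exists K, 0 <= K /\ forall T, 0 <= T -> forall s, 0 <= s -> RInt (phi s) 0 T <= RInt (phi 0) 0 T + K.
Proof.
  assert (M0 := mass_nonneg 0 l); assert (M1 := mass_nonneg 1 l).
  destruct (gradient_bound (mass 0 l) M0) as (K & HK & HGK).
  assert (HUV : forall s t, 0 <= s -> Rabs (Um 0 l s t) <= mass 0 l /\ Rabs (Vm 0 l s t) <= mass 0 l).
  { intros s t Hs; destruct (UV_bound 0 l l0 s t Hs Hl) as [E1 E2].
    assert (E := exp_decay_le_1 s Hs); split; nra. }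
  assert (Hgt : forall s t, 0 <= s -> Rabs (phi_t s t) <= 2 * (K * mass 1 l) * exp (- l0 * s)).
  { intros s t Hs; destruct (HUV s t Hs) as [E1 E2]; destruct (HGK _ _ E1 E2) as (F1 & F2 & _).
    destruct (UV_bound 1 l l0 s t Hs Hl) as [E3 E4].
    unfold phi_t; replace (2 * (K * mass 1 l) * exp (- l0 * s)) with
      (K * (mass 1 l * exp (- l0 * s)) + K * (mass 1 l * exp (- l0 * s))) by ring.
    apply Rabs_plus_le; [|rewrite Rabs_Ropp]; now apply Rabs_mult_le. }
  destruct cont2_all as (C0 & C1 & C2 & C3).
  (* Two boundary terms, each at most [2 (K mass 1 l) exp (-l0 s)]; the correction
     [c / l0^2 exp (-l0 s)] has a second derivative that outweighs them. *)
  set (c := 4 * (K * mass 1 l)).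
  assert (Hc : 0 <= c) by (unfold c; nra).
  exists (c / l0 ^ 2); split.
  { apply Rdiv_le_0_compat; [easy|apply pow_lt; easy]. }
  intros T HT s Hs.
  set (f := fun s => RInt (phi s) 0 T + c / l0 ^ 2 * exp (- l0 * s)).
  set (df := fun s => RInt (phi_s s) 0 T - c / l0 * exp (- l0 * s)).
  set (ddf := fun s => RInt (phi_ss s) 0 T + c * exp (- l0 * s)).
  assert (Hf : f s <= f 0).
  { apply (convex_bounded_decreasing f df ddf (T * K + c / l0 ^ 2)); [| | | |easy].
    - intros x; apply (is_derive_plus (fun s => RInt (phi s) 0 T)).
      + apply is_derive_RInt_cont2; [apply phi_ds|easy|easy].
      + auto_derive; [easy|field; lra].
    - intros x; apply (is_derive_plus (fun s => RInt (phi_s s) 0 T)).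
      + apply is_derive_RInt_cont2; [apply phi_s_ds|easy|easy].
      + auto_derive; [easy|field; lra].
    - intros x Hx; unfold ddf.
      assert (E : - (phi_t x T - phi_t x 0) <= RInt (phi_ss x) 0 T).
      { assert (I : RInt (phi_tt x) 0 T = phi_t x T - phi_t x 0).
        { apply is_RInt_unique, (is_RInt_derive (phi_t x)).
          - intros t _; apply phi_t_dt.
          - intros t _; apply (cont2_section phi_tt x C3). }
        rewrite <- I.
        rewrite <- (Rmult_1_l (RInt (phi_tt x) 0 T)), Ropp_mult_distr_l.
        replace (- (1) * RInt (phi_tt x) 0 T) with (RInt (fun t => - (1) * phi_tt x t) 0 T).
        2:{ apply (RInt_scal (phi_tt x)); now apply cont_ex_RInt, cont2_section. }
        apply RInt_le; [easy| | |].
        - apply cont_ex_RInt, cont_mult; [apply cont_const|now apply cont2_section].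
        - now apply cont_ex_RInt, cont2_section.
        - intros t _; unfold phi_ss, phi_tt.
          assert (L := laplacian_nonneg (Um 0 l x t) (Vm 0 l x t)).
          assert (L2 : 0 <= (essen_xx (Um 0 l x t) (Vm 0 l x t) + essen_yy (Um 0 l x t) (Vm 0 l x t))
                       * (Um 1 l x t ^ 2 + Vm 1 l x t ^ 2)) by
            (apply Rmult_le_pos; [easy|apply Rplus_le_le_0_compat; apply pow2_ge_0]).
          lra. }
      assert (F1 := Hgt x T Hx); assert (F2 := Hgt x 0 Hx).
      apply Rabs_le_between in F1; apply Rabs_le_between in F2.
      unfold c; lra.
    - intros x Hx; unfold f.
      assert (E : RInt (phi x) 0 T <= T * K).
      { replace (T * K) with (RInt (fun _ => K) 0 T).
        2:{ rewrite RInt_const; unfold scal; simpl; unfold mult; simpl; ring. }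
        apply RInt_le; [easy|now apply cont_ex_RInt, cont2_section|apply cont_ex_RInt, cont_const|].
        intros t _; destruct (HUV x t Hx) as [E1 E2]; destruct (HGK _ _ E1 E2) as (_ & _ & F).
        apply Rabs_le_between in F; apply F. }
      assert (D := exp_decay_le_1 x Hx).
      assert (0 <= c / l0 ^ 2) by (apply Rdiv_le_0_compat; [easy|apply pow_lt; easy]).
      nra. }
  unfold f in Hf; rewrite Rmult_0_r, exp_0, Rmult_1_r in Hf.
  assert (0 <= c / l0 ^ 2 * exp (- l0 * s)).
  { apply Rmult_le_pos; [apply Rdiv_le_0_compat; [easy|apply pow_lt; easy]|left; apply exp_pos]. }
  lra.
Qed.

End Subharmonic.

Lemma cont_onesq_pow_Vm a m l s : cont (fun t => onesq_pow a (Vm m l s t)).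
Proof.
  apply (cont2_section (fun s t => onesq_pow a (Vm m l s t))).
  exact (cont2_Rpower (Vm m l) a (cont2_Vm m l)).
Qed.

Lemma cont_onesq_pow_Um a m l s : cont (fun t => onesq_pow a (Um m l s t)).
Proof.
  apply (cont2_section (fun s t => onesq_pow a (Um m l s t))).
  exact (cont2_Rpower (Um m l) a (cont2_Um m l)).
Qed.

Lemma Avg_le_of_RInt f phi K n : (1 <= n)%nat ->
  RInt f 0 (INR n) <= RInt phi 0 (INR n) + K -> Avg f n <= Avg phi n + K / INR n.
Proof.
  intros Hn H; unfold Avg, Rdiv.
  assert (P1 : 0 < / INR n) by (apply Rinv_0_lt_compat, lt_0_INR; lia).
  nra.
Qed.

(** The instance [A = 0], [B = 1]: means of powers decrease into the half-plane, up to an error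
    uniform in the depth [s]. *)
Lemma mean_power_shift k l : 2 <= k -> (forall x, In x l -> 0 < lam x) ->
  exists K, forall n s, (1 <= n)%nat -> 0 <= s ->
  Avg (fun t => onesq_pow k (Vm 0 l s t)) n <= Avg (fun t => onesq_pow k (Vm 0 l 0 t)) n + K / INR n.
Proof.
  intros Hk Hl; destruct (min_frequency l Hl) as (l0 & H0 & Hl0).
  destruct (subharmonic_mean_decreasing k 0 1 Hk ltac:(lra) ltac:(lra) ltac:(nra) l l0 H0 Hl0)
    as (K & HK & H).
  exists K; intros n s Hn Hs; apply Avg_le_of_RInt; [easy|].
  specialize (H (INR n) (pos_INR n) s Hs).
  assert (E : forall s, RInt (fun t => onesq_pow k (Vm 0 l s t)) 0 (INR n) = RInt (phi k 0 1 l s) 0 (INR n)).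
  { intros s'; apply RInt_ext; intros t _; unfold phi, essen.
    match goal with |- ?a = ?b => change (@eq R a b) end; ring. }
  rewrite !E; exact H.
Qed.

(** Either [4 k^2 u^2 <= 1 + v^2], and half of the [v]-power suffices, or the term is bounded by a
    power of [u] alone. The 1/2 leaves half of [onesq_pow k v] over in Essen's inequality. *)
Lemma Young_conj k u v : 2 <= k ->
  2 * k ^ 2 * u ^ 2 * onesq_pow (k - 1) v <= / 2 * onesq_pow k v + Rpower (4 * k ^ 2) k * onesq_pow k u.
Proof.
  intros Hk.
  assert (P1 := onesq_pow_pos (k - 1) v); assert (P2 := onesq_pow_pos k u); assert (P0 := onesq_pow_pos k v).
  assert (Q := Rpower_pos (4 * k ^ 2) k).
  assert (Ev := onesq_pow_succ k v).
  destruct (Rle_lt_dec (4 * k ^ 2 * u ^ 2) (1 + v ^ 2)) as [H|H].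
  - assert (2 * k ^ 2 * u ^ 2 * onesq_pow (k - 1) v <= / 2 * (1 + v ^ 2) * onesq_pow (k - 1) v)
      by (apply Rmult_le_compat_r; lra).
    nra.
  - assert (Hu : 0 < 4 * k ^ 2 * u ^ 2) by nra.
    assert (H1 : onesq_pow (k - 1) v <= Rpower (4 * k ^ 2 * u ^ 2) (k - 1))
      by (apply Rle_Rpower_l; [lra|nra]).
    assert (H2 : 4 * k ^ 2 * u ^ 2 * onesq_pow (k - 1) v <= Rpower (4 * k ^ 2 * u ^ 2) k).
    { replace (Rpower (4 * k ^ 2 * u ^ 2) k)
        with (4 * k ^ 2 * u ^ 2 * Rpower (4 * k ^ 2 * u ^ 2) (k - 1)).
      - apply Rmult_le_compat_l; lra.
      - rewrite <- (Rpower_1 (4 * k ^ 2 * u ^ 2)) at 1 by easy.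
        rewrite <- Rpower_plus; f_equal; ring. }
    assert (H3 : Rpower (4 * k ^ 2 * u ^ 2) k <= Rpower (4 * k ^ 2) k * onesq_pow k u).
    { unfold onesq_pow; rewrite <- Rpower_mult_distr by nra.
      apply Rmult_le_compat_l; [lra|]; apply Rle_Rpower_l; nra. }
    assert (0 < onesq_pow (k - 1) v) by apply onesq_pow_pos; nra.
Qed.

Lemma exp_decay_small M l0 eps : 0 < l0 -> 0 <= M -> 0 < eps ->
  exists s, 0 <= s /\ M * exp (- l0 * s) <= eps.
Proof.
  intros H0 HM He; exists (M / (l0 * eps)); split.
  { apply Rdiv_le_0_compat; [easy|nra]. }
  set (s := M / (l0 * eps)).
  assert (Es : eps * (l0 * s) = M) by (unfold s; field; lra).
  replace (- l0 * s) with (- (l0 * s)) by ring; rewrite exp_Ropp.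
  assert (E := exp_ineq1_le (l0 * s)); assert (E2 := exp_pos (l0 * s)).
  apply Rmult_le_reg_r with (exp (l0 * s)); [easy|].
  rewrite Rmult_assoc, Rinv_l by lra; nra.
Qed.

(* Essen's test function [2 k^2 u^2 (1 + v^2)^(k-1) - (1 + v^2)^k] is subharmonic and is
   [-1] at infinity. *)
Lemma mean_power_conjugate k l : 2 <= k -> (forall x, In x l -> 0 < lam x) ->
  exists K, forall n, (1 <= n)%nat ->
  Avg (fun t => onesq_pow k (Vm 0 l 0 t)) n
  <= (2 * Rpower (4 * k ^ 2) k + 4) * Avg (fun t => onesq_pow k (Um 0 l 0 t)) n + K / INR n.
Proof.
  intros Hk Hl; destruct (min_frequency l Hl) as (l0 & H0 & Hl0).
  destruct (subharmonic_mean_decreasing k (2 * k ^ 2) (-1) Hk ltac:(nra) ltac:(nra) ltac:(nra)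
              l l0 H0 Hl0) as (K & HK & H).
  exists (2 * K); intros n Hn.
  assert (Pn : 0 < INR n) by (apply lt_0_INR; lia).
  (* [|v| <= eta] means [(1 + v^2)^k <= 2]; at a depth where the sum is that small the test function
     is at least [-2]. *)
  set (eta := sqrt (Rpower 2 (/ k) - 1)).
  assert (Heta : 0 < Rpower 2 (/ k) - 1).
  { assert (Rpower 2 0 < Rpower 2 (/ k)); [|rewrite Rpower_O in *; lra].
    apply Rpower_lt; [lra|apply Rinv_0_lt_compat; lra]. }
  destruct (exp_decay_small (mass 0 l) l0 eta H0 (mass_nonneg 0 l)) as (s & Hs & Hsm).
  { now apply sqrt_lt_R0. }
  specialize (H (INR n) ltac:(lra) s Hs).
  assert (Hlow : - 2 * INR n <= RInt (phi k (2 * k ^ 2) (-1) l s) 0 (INR n)).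
  { replace (- 2 * INR n) with (RInt (fun _ => - 2) 0 (INR n)).
    2:{ rewrite RInt_const; unfold scal; simpl; unfold mult; simpl; ring. }
    apply RInt_le; [lra|apply cont_ex_RInt, cont_const| |].
    - apply cont_ex_RInt, cont2_section, cont2_all.
    - intros t _; unfold phi, essen.
      assert (Hv : onesq_pow k (Vm 0 l s t) <= 2).
      { apply Rle_trans with (onesq_pow k eta).
        - apply onesq_pow_le; [lra|].
          eapply Rle_trans; [|apply Hsm]; now apply UV_bound.
        - unfold onesq_pow, eta; rewrite <- Rsqr_pow2, Rsqr_sqrt by lra.
          replace (1 + (Rpower 2 (/ k) - 1)) with (Rpower 2 (/ k)) by ring.
          rewrite Rpower_mult, Rinv_l, Rpower_1; lra. }
      assert (P1 := onesq_pow_pos (k - 1) (Vm 0 l s t)).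
      assert (0 <= 2 * k ^ 2 * Um 0 l s t ^ 2 * onesq_pow (k - 1) (Vm 0 l s t)).
      { apply Rmult_le_pos; [|lra]; apply Rmult_le_pos; [nra|apply pow2_ge_0]. }
      lra. }
  assert (HR : - 2 <= Avg (phi k (2 * k ^ 2) (-1) l 0) n + K / INR n).
  { unfold Avg, Rdiv; apply Rmult_le_reg_l with (INR n); [easy|].
    rewrite Rmult_plus_distr_l, <- Rmult_assoc, Rinv_r, Rmult_1_l by lra.
    replace (INR n * (K * / INR n)) with K by (field; lra); lra. }
  set (a := Avg (fun t => onesq_pow k (Vm 0 l 0 t)) n) in *.
  set (b := Avg (fun t => onesq_pow k (Um 0 l 0 t)) n) in *.
  assert (C1 := cont_onesq_pow_Vm k 0 l 0); assert (C2 := cont_onesq_pow_Um k 0 l 0).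
  assert (HA : Avg (phi k (2 * k ^ 2) (-1) l 0) n <= - / 2 * a + Rpower (4 * k ^ 2) k * b).
  { unfold a, b; rewrite <- !Avg_scal, <- Avg_plus by
      (try (apply cont_mult; [apply cont_const|]); easy).
    apply Avg_le.
    - apply cont2_section, cont2_all.
    - apply cont_plus; apply cont_mult; try apply cont_const; easy.
    - intros t; unfold phi, essen.
      assert (Y := Young_conj k (Um 0 l 0 t) (Vm 0 l 0 t) Hk); lra. }
  (* Since [b >= 1], the additive constant 4 can be counted in the coefficient of [b]. *)
  assert (Hb : 1 <= b).
  { rewrite <- (Avg_const 1 n Hn); apply Avg_le; [apply cont_const|easy|].
    intros t; assert (Hu : 0 <= Um 0 l 0 t ^ 2) by apply pow2_ge_0.
    apply Rle_trans with (Rpower (1 + Um 0 l 0 t ^ 2) 0); [rewrite Rpower_O; lra|].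
    apply Rle_Rpower; lra. }
  replace (2 * K / INR n) with (2 * (K / INR n)) by (unfold Rdiv; ring).
  lra.
Qed.

(** * Means of trigonometric products over primes *)

Lemma ln_INR_mult a b : (1 <= a)%nat -> (1 <= b)%nat ->
  ln (INR (a * b)) = ln (INR a) + ln (INR b).
Proof. intros; rewrite mult_INR; apply ln_mult; apply lt_0_INR; lia. Qed.

Lemma ln_INR_inj a b : (1 <= a)%nat -> (1 <= b)%nat -> ln (INR a) = ln (INR b) -> a = b.
Proof. intros Ha Hb H; apply INR_eq, ln_inv; [apply lt_0_INR; lia..|easy]. Qed.

(** The degree 2 allows an expansion to second order at each prime; in the mean of a product only
    [c0] survives. *)
Definition trig2 (c0 c1 c2 : nat -> R) (t : R) (p : nat) : R :=
  c0 p + c1 p * cos (t * ln (INR p)) + c2 p * cos (2 * (t * ln (INR p))).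

Lemma cos_mul_cos x y : cos x * cos y = / 2 * cos (y + x) + / 2 * cos (y - x).
Proof. rewrite cos_plus, cos_minus; field. Qed.

(** Independence of the [log p], read as unique factorisation: the cosines at [p] shift the
    frequency [log (a/b)] by multiples of [log p], recorded by multiplying [a] or [b] by [p] or
    [p^2]. The twist carries the induction; the application is at [a = b = 1]. *)
Lemma mean_prod_trig2_twisted c0 c1 c2 ps : primes_list ps -> forall a b,
  (1 <= a)%nat -> (1 <= b)%nat ->
  (forall p, In p ps -> ~ Nat.divide p a /\ ~ Nat.divide p b) ->
  is_mean (fun t => lprod (trig2 c0 c1 c2 t) ps * cos (t * (ln (INR a) - ln (INR b))))
          (if Nat.eq_dec a b then lprod c0 ps else 0).
Proof.
  induction ps as [|p ps IH]; intros Hps a b Ha Hb Hd.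
  - apply is_mean_ext with (fun t => cos (t * (ln (INR a) - ln (INR b)))); [intros; simpl; ring|].
    assert (H := is_mean_cos (ln (INR a) - ln (INR b))).
    destruct (Req_EM_T _ 0) as [E|E]; destruct (Nat.eq_dec a b) as [F|F]; try easy; exfalso.
    + apply F, ln_INR_inj; lra || easy.
    + apply E; rewrite F; ring.
  - apply primes_list_inv in Hps; destruct Hps as (Pp & Hni & Hps).
    assert (Hp1 := is_prime_gt1 p Pp).
    assert (Hdp : ~ Nat.divide p a /\ ~ Nat.divide p b) by (apply Hd; now left).
    assert (Hd' : forall q, In q ps -> ~ Nat.divide q a /\ ~ Nat.divide q b)
      by (intros q Hq; apply Hd; now right).
    assert (Hm : forall x, (forall q, In q ps -> ~ Nat.divide q x) ->
                  forall q, In q ps -> ~ Nat.divide q (p * x)).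
    { intros x Hx q Hq; apply prime_not_divide_mul; [now apply Hps|easy| |now apply Hx].
      intros ->; easy. }
    assert (Ma := Hm a (fun q Hq => proj1 (Hd' q Hq))).
    assert (Mb := Hm b (fun q Hq => proj2 (Hd' q Hq))).
    assert (Maa := Hm _ Ma); assert (Mbb := Hm _ Mb).
    assert (I0 := IH Hps a b Ha Hb Hd').
    assert (I1 := IH Hps (p * a)%nat b ltac:(nia) Hb (fun q Hq => conj (Ma q Hq) (proj2 (Hd' q Hq)))).
    assert (I2 := IH Hps a (p * b)%nat Ha ltac:(nia) (fun q Hq => conj (proj1 (Hd' q Hq)) (Mb q Hq))).
    assert (I3 := IH Hps (p * (p * a))%nat b ltac:(nia) Hb
                    (fun q Hq => conj (Maa q Hq) (proj2 (Hd' q Hq)))).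
    assert (I4 := IH Hps a (p * (p * b))%nat Ha ltac:(nia)
                    (fun q Hq => conj (proj1 (Hd' q Hq)) (Mbb q Hq))).
    (* Each of the four shifts unbalances the power of [p] and so has mean 0; [c0 p] times the old
       mean remains. *)
    destruct (Nat.eq_dec (p * a) b) as [E|_].
    { exfalso; apply (proj2 Hdp); rewrite <- E; apply Nat.divide_factor_l. }
    destruct (Nat.eq_dec a (p * b)) as [E|_].
    { exfalso; apply (proj1 Hdp); rewrite E; apply Nat.divide_factor_l. }
    destruct (Nat.eq_dec (p * (p * a)) b) as [E|_].
    { exfalso; apply (proj2 Hdp); rewrite <- E; apply Nat.divide_factor_l. }
    destruct (Nat.eq_dec a (p * (p * b))) as [E|_].
    { exfalso; apply (proj1 Hdp); rewrite E; apply Nat.divide_factor_l. }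
    assert (Hsum := is_mean_plus _ _ _ _ (is_mean_scal (c0 p) _ _ I0)
      (is_mean_plus _ _ _ _ (is_mean_scal (c1 p / 2) _ _ (is_mean_plus _ _ _ _ I1 I2))
                            (is_mean_scal (c2 p / 2) _ _ (is_mean_plus _ _ _ _ I3 I4)))).
    replace (if Nat.eq_dec a b then lprod c0 (p :: ps) else 0) with
      (c0 p * (if Nat.eq_dec a b then lprod c0 ps else 0)
       + (c1 p / 2 * (0 + 0) + c2 p / 2 * (0 + 0))).
    2:{ destruct (Nat.eq_dec a b); simpl; ring. }
    eapply is_mean_ext; [|exact Hsum].
    intros t; cbv beta.
    rewrite !ln_INR_mult by nia.
    set (th := ln (INR p)); set (la := ln (INR a)); set (lb := ln (INR b)).
    change (lprod (trig2 c0 c1 c2 t) (p :: ps))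
      with (trig2 c0 c1 c2 t p * lprod (trig2 c0 c1 c2 t) ps).
    unfold trig2 at 6; fold th.
    set (Z := lprod (trig2 c0 c1 c2 t) ps).
    assert (E1 := cos_mul_cos (t * th) (t * (la - lb))).
    assert (E2 := cos_mul_cos (2 * (t * th)) (t * (la - lb))).
    replace (t * (la - lb) + t * th) with (t * (th + la - lb)) in E1 by ring.
    replace (t * (la - lb) - t * th) with (t * (la - (th + lb))) in E1 by ring.
    replace (t * (la - lb) + 2 * (t * th)) with (t * (th + (th + la) - lb)) in E2 by ring.
    replace (t * (la - lb) - 2 * (t * th)) with (t * (la - (th + (th + lb)))) in E2 by ring.
    transitivity (Z * (c0 p * cos (t * (la - lb)) + c1 p * (cos (t * th) * cos (t * (la - lb)))
                  + c2 p * (cos (2 * (t * th)) * cos (t * (la - lb))))); [|ring].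
    rewrite E1, E2; field.
Qed.

Lemma mean_prod_trig2 c0 c1 c2 ps : primes_list ps ->
  is_mean (fun t => lprod (trig2 c0 c1 c2 t) ps) (lprod c0 ps).
Proof.
  intros Hps.
  assert (H := mean_prod_trig2_twisted c0 c1 c2 ps Hps 1 1 ltac:(lia) ltac:(lia)).
  simpl in H; eapply is_mean_ext; [|apply H].
  - intros t; simpl; rewrite Rminus_diag, Rmult_0_r, cos_0; ring.
  - intros p Hp; split; intros D; apply Nat.divide_1_r in D;
      apply Hps, is_prime_gt1 in Hp; lia.
Qed.

(** * Third-order bounds and single Euler factors *)

Lemma nonneg_of_derive_pos f df x : f 0 = 0 -> 0 <= x -> (forall y, 0 <= y <= x -> is_derive f y (df y)) ->
  (forall y, 0 <= y <= x -> 0 <= df y) -> 0 <= f x.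
Proof.
  intros E [Hx| <-] Hd Hp; [|lra].
  destruct (MVT_gen f 0 x df) as (c & Hc & Ec).
  - intros y Hy; rewrite Rmin_left, Rmax_right in Hy by lra; apply Hd; lra.
  - intros y Hy; rewrite Rmin_left, Rmax_right in Hy by lra.
    apply continuity_pt_filterlim, (ex_derive_continuous f); exists (df y); now apply Hd.
  - rewrite Rmin_left, Rmax_right in Hc by lra.
    specialize (Hp c Hc); nra.
Qed.

Lemma exp_taylor2 x : -1 <= x <= 2 / 3 -> exp x <= 1 + x + x ^ 2 / 2 + Rabs x ^ 3.
Proof.
  intros Hx; destruct (Rle_lt_dec 0 x) as [H|H].
  - rewrite Rabs_pos_eq by easy.
    apply Rminus_le_0.
    apply (nonneg_of_derive_pos (fun x => 1 + x + x ^ 2 / 2 + x ^ 3 - exp x)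
             (fun x => 1 + x + 3 * x ^ 2 - exp x)); [rewrite exp_0; field|easy| |].
    + intros y Hy; auto_derive; [easy|field].
    + intros y Hy; assert (E := exp_ineq1_le (- y)).
      rewrite exp_Ropp in E; assert (Pe := exp_pos y).
      assert (E2 : exp y * (1 - y) <= 1).
      { apply (Rmult_le_compat_l (exp y)) in E; [|lra]; rewrite Rinv_r in E; lra. }
      (* The product equals [1 + y^2 (2 - 3 y)], whence the range up to 2/3. *)
      assert (E3 : 1 <= (1 + y + 3 * y ^ 2) * (1 - y)).
      { assert (0 <= y ^ 2 * (2 - 3 * y)) by (apply Rmult_le_pos; [apply pow2_ge_0|lra]); nra. }
      assert (exp y * (1 - y) <= (1 + y + 3 * y ^ 2) * (1 - y)) by lra.
      apply Rmult_le_reg_r in H0; lra.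
  - rewrite Rabs_left by easy.
    set (z := - x); replace x with (- z) by (unfold z; ring).
    apply Rminus_le_0.
    apply (nonneg_of_derive_pos (fun z => 1 + - z + (- z) ^ 2 / 2 + z ^ 3 - exp (- z))
             (fun z => - 1 + z + 3 * z ^ 2 + exp (- z))).
    + rewrite Ropp_0, exp_0; field.
    + unfold z; lra.
    + intros y Hy; auto_derive; [easy|field].
    + intros y Hy; assert (E := exp_ineq1_le (- y)); assert (Hy2 := pow2_ge_0 y); lra.
Qed.

Lemma ln_taylor2 w : - / 2 <= w <= / 2 -> ln (1 + w) <= w - w ^ 2 / 2 + Rabs w ^ 3.
Proof.
  intros Hw; destruct (Rle_lt_dec 0 w) as [H|H].
  - rewrite Rabs_pos_eq by easy; apply Rminus_le_0.
    apply (nonneg_of_derive_pos (fun w => w - w ^ 2 / 2 + w ^ 3 - ln (1 + w))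
             (fun w => w ^ 2 * (3 - / (1 + w)))).
    + rewrite Rplus_0_r, ln_1; field.
    + easy.
    + intros y Hy; auto_derive; [lra|field; lra].
    + intros y Hy; apply Rmult_le_pos; [apply pow2_ge_0|].
      assert (/ (1 + y) <= / 1) by (apply Rinv_le_contravar; lra); lra.
  - rewrite Rabs_left by easy.
    set (z := - w); replace w with (- z) by (unfold z; ring); apply Rminus_le_0.
    apply (nonneg_of_derive_pos (fun z => - z - (- z) ^ 2 / 2 + z ^ 3 - ln (1 + - z))
             (fun z => z ^ 2 * (3 + / (1 - z)))).
    + rewrite Ropp_0, Rplus_0_r, ln_1; field.
    + unfold z; lra.
    + intros y Hy; unfold z in Hy; auto_derive; [lra|field; lra].
    + intros y Hy; unfold z in Hy; apply Rmult_le_pos; [apply pow2_ge_0|].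
      assert (0 < / (1 - y)) by (apply Rinv_0_lt_compat; lra); lra.
Qed.

Lemma ln_inv_taylor2 w : - / 2 <= w <= / 2 -> - ln (1 - w) <= w + w ^ 2 / 2 + Rabs w ^ 3.
Proof.
  intros Hw; destruct (Rle_lt_dec 0 w) as [H|H].
  - rewrite Rabs_pos_eq by easy; apply Rminus_le_0.
    apply (nonneg_of_derive_pos (fun w => w + w ^ 2 / 2 + w ^ 3 - - ln (1 - w))
             (fun w => w ^ 2 * (3 - / (1 - w)))).
    + rewrite Rminus_0_r, ln_1; field.
    + easy.
    + intros y Hy; auto_derive; [lra|field; lra].
    + intros y Hy; apply Rmult_le_pos; [apply pow2_ge_0|].
      assert (/ (1 - y) <= / (/ 2)) by (apply Rinv_le_contravar; lra).
      rewrite Rinv_inv in *; lra.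
  - rewrite Rabs_left by easy.
    set (z := - w); replace w with (- z) by (unfold z; ring); apply Rminus_le_0.
    apply (nonneg_of_derive_pos (fun z => - z + (- z) ^ 2 / 2 + z ^ 3 - - ln (1 - - z))
             (fun z => z ^ 2 * (3 + / (1 + z)))).
    + rewrite Ropp_0, Rminus_0_r, ln_1; field.
    + unfold z; lra.
    + intros y Hy; unfold z in Hy; auto_derive; [lra|field; lra].
    + intros y Hy; unfold z in Hy; apply Rmult_le_pos; [apply pow2_ge_0|].
      assert (0 < / (1 + y)) by (apply Rinv_0_lt_compat; lra); lra.
Qed.

Lemma cos_double x : cos (2 * x) = 2 * cos x ^ 2 - 1.
Proof. rewrite cos_2a_cos; ring. Qed.

Lemma Rabs_pow3_le x M : Rabs x <= M -> Rabs x ^ 3 <= M ^ 3.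
Proof. intros; apply pow_incr; split; [apply Rabs_pos|easy]. Qed.

(** The phase is ignored: [|1 - z| >= 1 - r], and [- ln (1 - r) <= 4 r] because [r <= 3/4]. *)
Lemma euler_factor_small_prime k r c : 0 <= k -> 0 < r -> r ^ 2 <= / 2 -> -1 <= c <= 1 ->
  Rpower (/ (1 - 2 * r * c + r ^ 2)) k <= exp (8 * k * r).
Proof.
  intros Hk Hr Hr2 Hc.
  assert (Hr3 : r <= 3 / 4) by nra.
  assert (H0 : 0 < (1 - r) ^ 2) by (apply pow_lt; lra).
  assert (H1 : (1 - r) ^ 2 <= 1 - 2 * r * c + r ^ 2) by nra.
  unfold Rpower; apply exp_le.
  rewrite ln_Rinv by lra.
  assert (H2 : ln ((1 - r) ^ 2) <= ln (1 - 2 * r * c + r ^ 2)) by (apply ln_le; lra).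
  rewrite <- Rsqr_pow2 in H2; unfold Rsqr in H2; rewrite ln_mult in H2 by lra.
  assert (H3 : - ln (1 - r) <= 4 * r).
  { rewrite <- ln_Rinv by lra.
    eapply Rle_trans; [apply ln_le_sub, Rinv_0_lt_compat; lra|].
    replace (/ (1 - r) - 1) with (r * / (1 - r)) by (field; lra).
    assert (/ (1 - r) <= / (/ 4)) by (apply Rinv_le_contravar; lra).
    rewrite Rinv_inv in *; nra. }
  nra.
Qed.

(** The majorant has the shape [trig2], as exact averaging demands, so the third-order error joins
    the constant coefficient. There [k^2 r^2] is the mean of [(2 k r cos th)^2 / 2]. *)
Lemma euler_factor_large_prime k r th : 2 <= k -> 0 < r -> k * r <= / 4 ->
  Rpower (/ (1 - 2 * r * cos th + r ^ 2)) k
  <= 1 + k ^ 2 * r ^ 2 + 32 * k ^ 3 * r ^ 3 + 2 * k * r * cos th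
     + (k * r ^ 2 + k ^ 2 * r ^ 2) * cos (2 * th).
Proof.
  intros Hk Hr Hkr.
  assert (Hc := COS_bound th).
  assert (Hr8 : r <= / 8) by nra.
  set (c := cos th) in *.
  assert (E2 : cos (2 * th) = 2 * c ^ 2 - 1) by apply cos_double.
  assert (Hc2 : 0 <= c ^ 2 <= 1) by nra.
  set (w := 2 * r * c - r ^ 2).
  assert (Hw : Rabs w <= 17 / 8 * r) by (apply Rabs_le; unfold w; nra).
  assert (Hw' := Hw); apply Rabs_le_between in Hw'.
  replace (1 - 2 * r * c + r ^ 2) with (1 - w) by (unfold w; ring).
  set (x := 2 * k * r * c + k * r ^ 2 * cos (2 * th) + 13 * k * r ^ 3).
  assert (Hr3 : 0 < r ^ 3) by (apply pow_lt; easy).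
  assert (H1 : k * ln (/ (1 - w)) <= x).
  { rewrite ln_Rinv by lra.
    assert (L := ln_inv_taylor2 w ltac:(lra)).
    assert (W3 := Rabs_pow3_le w _ Hw).
    assert (W2 : w ^ 2 <= 4 * r ^ 2 * c ^ 2 + 5 * r ^ 3).
    { unfold w; replace ((2 * r * c - r ^ 2) ^ 2) with (4 * r ^ 2 * c ^ 2 - 4 * r ^ 3 * c + r ^ 3 * r) by ring.
      nra. }
    unfold x; rewrite E2.
    replace (2 * k * r * c + k * r ^ 2 * (2 * c ^ 2 - 1) + 13 * k * r ^ 3)
      with (k * (2 * r * c - r ^ 2 + 2 * r ^ 2 * c ^ 2 + 13 * r ^ 3)) by ring.
    apply Rmult_le_compat_l; [lra|].
    replace ((17 / 8 * r) ^ 3) with (4913 / 512 * r ^ 3) in W3 by field.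
    unfold w in L at 2; lra. }
  unfold Rpower; eapply Rle_trans; [apply exp_le, H1|].
  set (q := k * r) in *.
  set (y := q * (r * cos (2 * th) + 13 * r ^ 2)).
  assert (Hq : 0 < q) by (unfold q; nra).
  assert (Ex : x = 2 * q * c + y) by (unfold x, y, q; ring).
  assert (Hy : Rabs y <= 21 / 8 * q * r).
  { assert (C2 := COS_bound (2 * th)).
    unfold y; apply Rabs_le.
    assert (- (21 / 8 * r) <= r * cos (2 * th) + 13 * r ^ 2 <= 21 / 8 * r) by nra.
    nra. }
  (* As [q <= 1/4], this puts [x] in the range of [exp_taylor2]. *)
  assert (Hx : Rabs x <= 7 / 3 * q).
  { rewrite Ex; apply Rabs_le; apply Rabs_le_between in Hy; nra. }
  assert (Hx' := Hx); apply Rabs_le_between in Hx'.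
  eapply Rle_trans; [apply exp_taylor2; lra|].
  assert (X3 := Rabs_pow3_le x _ Hx).
  replace ((7 / 3 * q) ^ 3) with (343 / 27 * q ^ 3) in X3 by field.
  assert (X2 : x ^ 2 <= 4 * q ^ 2 * c ^ 2 + 12 * q ^ 2 * r).
  { rewrite Ex; replace ((2 * q * c + y) ^ 2) with (4 * q ^ 2 * c ^ 2 + (4 * q * c * y + y ^ 2)) by ring.
    apply Rabs_le_between in Hy.
    assert (c * y <= 21 / 8 * q * r) by nra.
    assert (y ^ 2 <= (21 / 8 * q * r) * (21 / 8 * q * r)) by nra.
    assert (4 * q * (c * y) <= 4 * q * (21 / 8 * q * r)) by (apply Rmult_le_compat_l; lra).
    assert (0 < q * q * r) by (apply Rmult_lt_0_compat; nra).
    assert (q * q * r * r <= q * q * r * / 8) by (apply Rmult_le_compat_l; lra).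
    nra. }
  assert (Q3 : k ^ 3 * r ^ 3 = q ^ 3) by (unfold q; ring).
  assert (Q2 : k ^ 2 * r ^ 2 = q ^ 2) by (unfold q; ring).
  assert (Q1 : q ^ 2 * r <= / 2 * q ^ 3).
  { assert (r <= / 2 * q) by (unfold q; nra).
    replace (/ 2 * q ^ 3) with (q ^ 2 * (/ 2 * q)) by ring.
    apply Rmult_le_compat_l; [nra|easy]. }
  assert (Q0 : 13 * k * r ^ 3 <= 13 / 4 * q ^ 3).
  { replace (13 / 4 * q ^ 3) with (13 * k * r ^ 3 * (k * k / 4)) by (unfold q; field).
    rewrite <- (Rmult_1_r (13 * k * r ^ 3)) at 1; apply Rmult_le_compat_l; nra. }
  assert (Q4 : 0 < q ^ 3) by (apply pow_lt; easy).
  replace (32 * k ^ 3 * r ^ 3) with (32 * q ^ 3) by (rewrite <- Q3; ring).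
  rewrite Q2.
  replace (k * r ^ 2) with (q * r) by (unfold q; ring).
  replace (2 * k * r * c) with (2 * q * c) by (unfold q; ring).
  unfold x in *; replace (k * r ^ 2) with (q * r) in * by (unfold q; ring).
  replace (2 * k * r * c) with (2 * q * c) in * by (unfold q; ring).
  rewrite E2 in *; nra.
Qed.

(** * The truncated Euler product *)

Definition csum {A} (f : A -> C) (l : list A) : C :=
  fold_right (fun x s => (f x + s)%C) (RtoC 0) l.

Lemma csum_parts {A} (f : A -> C) l :
  csum f l = (lsum (fun x => fst (f x)) l, lsum (fun x => snd (f x)) l).
Proof. induction l as [|x l IH]; [easy|]; simpl; rewrite IH; easy. Qed.

Lemma csum_app {A} (f : A -> C) l l' : csum f (l ++ l') = (csum f l + csum f l')%C.
Proof. induction l as [|x l IH]; simpl; [ring|rewrite IH; ring]. Qed.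

Lemma csum_map {A B} (f : B -> C) (g : A -> B) l : csum f (map g l) = csum (fun x => f (g x)) l.
Proof. induction l as [|x l IH]; simpl; [easy|now rewrite IH]. Qed.

Lemma csum_scal {A} c (f : A -> C) l : csum (fun x => (c * f x)%C) l = (c * csum f l)%C.
Proof. induction l as [|x l IH]; simpl; [ring|rewrite IH; ring]. Qed.

Lemma csum_ext {A} (f g : A -> C) l : (forall x, In x l -> f x = g x) -> csum f l = csum g l.
Proof.
  induction l as [|x l IH]; intros H; [easy|]; simpl.
  rewrite (H x) by (now left); rewrite IH; [easy|intros y Hy; apply H; now right].
Qed.

(** [n^(-a + it)], conjugate to the convention of [DirRe] and [DirIm] and of the same modulus. *)
Definition nterm (a t : R) (n : nat) : C :=
  (Rpower (INR n) (- a) * cos (t * ln (INR n)), Rpower (INR n) (- a) * sin (t * ln (INR n))).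

Lemma nterm_1 a t : nterm a t 1 = RtoC 1.
Proof.
  unfold nterm; simpl; rewrite Rpower_1_base, ln_1, Rmult_0_r, cos_0, sin_0, !Rmult_1_l; easy.
Qed.

Lemma nterm_mult a t m n : (1 <= m)%nat -> (1 <= n)%nat ->
  nterm a t (m * n) = (nterm a t m * nterm a t n)%C.
Proof.
  intros Hm Hn; unfold nterm, Cmult; simpl.
  rewrite ln_INR_mult, Rpower_INR_mult, Rmult_plus_distr_l, cos_plus, sin_plus by easy.
  f_equal; ring.
Qed.

Lemma nterm_pow a t p j : (1 <= p)%nat -> nterm a t (p ^ j) = (nterm a t p ^ j)%C.
Proof.
  intros Hp; induction j as [|j IH]; [apply nterm_1|].
  simpl Nat.pow; rewrite nterm_mult, IH; [easy|easy|].
  assert (p ^ j <> 0)%nat by (apply Nat.pow_nonzero; lia); lia.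
Qed.

Lemma Cmod_nterm a t n : Cmod (nterm a t n) = Rpower (INR n) (- a).
Proof.
  unfold Cmod, nterm; simpl fst; simpl snd.
  replace (_ ^ 2 + _ ^ 2) with (Rpower (INR n) (- a) ^ 2).
  - rewrite <- Rsqr_pow2; apply sqrt_Rsqr; left; apply Rpower_pos.
  - assert (E := sin2_cos2 (t * ln (INR n))); unfold Rsqr in E.
    set (c := cos _) in *; set (s := sin _) in *; set (r := Rpower _ _).
    transitivity (r ^ 2 * (s * s + c * c)); [rewrite E; ring|ring].
Qed.

Lemma csum_smooth a t J ps : (forall p, In p ps -> is_prime p = true) ->
  csum (nterm a t) (smooth J ps)
  = fold_right (fun p s => (csum (fun j => (nterm a t p ^ j)%C) (seq 0 (S J)) * s)%C) (RtoC 1) ps.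
Proof.
  induction ps as [|p ps IH]; intros Hp.
  - simpl; rewrite nterm_1; ring.
  - assert (Hp' : forall q, In q ps -> is_prime q = true) by (intros q Hq; apply Hp; now right).
    assert (Hp1 : (1 < p)%nat) by (apply is_prime_gt1, Hp; now left).
    change (fold_right ?f ?e (p :: ps)) with (f p (fold_right f e ps)); cbv beta.
    rewrite <- IH by easy.
    change (smooth J (p :: ps))
      with (flat_map (fun j => map (fun m => (p ^ j * m)%nat) (smooth J ps)) (seq 0 (S J))).
    generalize (seq 0 (S J)) as l; induction l as [|j l IHl]; simpl; [ring|].
    rewrite csum_app, IHl, csum_map.
    rewrite (csum_ext _ (fun m => (nterm a t p ^ j * nterm a t m)%C)), csum_scal; [ring|].
    intros m Hm; rewrite <- nterm_pow by lia; apply nterm_mult; [|now apply (smooth_pos J ps)].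
    assert (p ^ j <> 0)%nat by (apply Nat.pow_nonzero; lia); lia.
Qed.

Lemma geometric_C z s J :
  ((1 - z) * csum (fun j => (z ^ j)%C) (seq s J) = z ^ s - z ^ (s + J))%C.
Proof.
  revert s; induction J as [|J IH]; intros s; simpl.
  - rewrite Nat.add_0_r; ring.
  - replace (s + S J)%nat with (S s + J)%nat by lia.
    rewrite Cmult_plus_distr_l, IH; simpl; ring.
Qed.

Lemma Cmod_geometric z J : z <> RtoC 1 ->
  Cmod (csum (fun j => (z ^ j)%C) (seq 0 (S J))) <= (1 + Cmod z ^ S J) / Cmod (1 - z).
Proof.
  intros Hz.
  assert (Hz' : Cmod (1 - z) > 0).
  { apply Cmod_gt_0; intros E; apply Hz.
    replace z with (1 - (1 - z))%C by ring; rewrite E; ring. }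
  assert (E := geometric_C z 0 (S J)).
  apply (f_equal Cmod) in E; rewrite Cmod_mult in E.
  apply Rmult_le_reg_l with (Cmod (1 - z)); [easy|].
  rewrite E; replace (Cmod (1 - z) * ((1 + Cmod z ^ S J) / Cmod (1 - z))) with (1 + Cmod z ^ S J)
    by (field; lra).
  eapply Rle_trans; [apply Cmod_triangle|].
  rewrite Cmod_opp, !Cmod_pow; change (0 + S J)%nat with (S J); rewrite pow_O; lra.
Qed.

Lemma Cmod_one_minus_nterm a t n :
  Cmod (1 - nterm a t n) ^ 2
  = 1 - 2 * Rpower (INR n) (- a) * cos (t * ln (INR n)) + Rpower (INR n) (- a) ^ 2.
Proof.
  unfold Cmod; rewrite <- Rsqr_pow2, Rsqr_sqrt.
  2:{ apply Rplus_le_le_0_compat; apply pow2_ge_0. }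
  unfold nterm; simpl fst; simpl snd.
  assert (E := sin2_cos2 (t * ln (INR n))); unfold Rsqr in E.
  set (c := cos _) in *; set (s := sin _) in *; set (r := Rpower _ _).
  transitivity (1 - 2 * r * c + r ^ 2 * (s * s + c * c)); [ring|rewrite E; ring].
Qed.

Lemma Rpower_half_le_isq n a : (1 <= n)%nat -> / 2 <= a -> Rpower (INR n) (- a) <= isq n.
Proof.
  intros Hn Ha.
  assert (H1 : 1 <= INR n) by (change 1 with (INR 1); apply le_INR; lia).
  unfold isq; rewrite <- Rpower_sqrt, <- Rpower_Ropp by lra.
  apply Rle_Rpower; lra.
Qed.

(** This is [|1 - p^(-a + it)|^(-2)]. *)
Definition euler_factor (a t : R) (p : nat) : R :=
  / (1 - 2 * Rpower (INR p) (- a) * cos (t * ln (INR p)) + Rpower (INR p) (- a) ^ 2).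

Lemma prime_power_half p a : is_prime p = true -> / 2 <= a ->
  0 < Rpower (INR p) (- a) /\ Rpower (INR p) (- a) ^ 2 <= / 2.
Proof.
  intros Hp Ha; apply is_prime_gt1 in Hp; split; [apply Rpower_pos|].
  apply Rle_trans with (isq p ^ 2).
  - apply pow_incr; split; [left; apply Rpower_pos|apply Rpower_half_le_isq; [lia|easy]].
  - rewrite isq_sqr by lia; apply Rinv_le_contravar; [lra|].
    change 2 with (INR 2); apply le_INR; lia.
Qed.

Lemma euler_factor_pos a t p : is_prime p = true -> / 2 <= a -> 0 < euler_factor a t p.
Proof.
  intros Hp Ha; destruct (prime_power_half p a Hp Ha) as [H1 H2].
  apply Rinv_0_lt_compat.
  assert (Hc := COS_bound (t * ln (INR p))).
  set (r := Rpower _ _) in *; set (c := cos _) in *.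
  assert (r < 1) by nra.
  assert (0 < (1 - r) ^ 2) by (apply pow_lt; lra); nra.
Qed.

Lemma half_pow_small N : INR N * (/ 2) ^ N <= 1.
Proof.
  assert (H : INR N <= 2 ^ N).
  { induction N as [|N IH]; [simpl; lra|].
    rewrite S_INR; simpl; assert (1 <= 2 ^ N) by (apply pow_R1_Rle; lra); lra. }
  rewrite pow_inv; assert (0 < 2 ^ N) by (apply pow_lt; lra).
  apply Rmult_le_reg_r with (2 ^ N); [easy|].
  rewrite Rmult_assoc, Rinv_l by lra; lra.
Qed.

Lemma lsum_const_le {A} c (l : list A) : lsum (fun _ => c) l = INR (length l) * c.
Proof. induction l as [|x l IH]; [simpl; ring|]; simpl length; rewrite S_INR; simpl; rewrite IH; ring. Qed.

Lemma PR_length N : (length (PR 0 N) <= N)%nat.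
Proof.
  unfold PR; eapply Nat.le_trans; [apply filter_length_le|]; rewrite length_seq; lia.
Qed.

(** The cap [2 N] makes truncation of the Euler factors harmless: [r^2 <= 1/2] gives
    [r^(2N+1) <= 2^(-N)], and at most [N] factors [(1 + 2^(-N))^2] multiply to at most
    [exp (2 N 2^(-N)) <= e^2]. *)
Lemma smooth_sum_bound a t N : / 2 <= a ->
  lsum (fun n => Rpower (INR n) (- a) * cos (t * ln (INR n))) (smooth (2 * N) (PR 0 N)) ^ 2
  + lsum (fun n => Rpower (INR n) (- a) * sin (t * ln (INR n))) (smooth (2 * N) (PR 0 N)) ^ 2
  <= exp 2 * lprod (euler_factor a t) (PR 0 N).
Proof.
  intros Ha.
  assert (E := csum_smooth a t (2 * N) (PR 0 N) (proj2 (PR_primes 0 N))).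
  rewrite csum_parts in E; simpl fst in E; simpl snd in E.
  apply (f_equal (fun z => Cmod z ^ 2)) in E.
  unfold Cmod at 1 in E; rewrite <- Rsqr_pow2, Rsqr_sqrt in E
    by (apply Rplus_le_le_0_compat; apply pow2_ge_0).
  simpl fst in E; simpl snd in E.
  match type of E with ?x = _ => match goal with |- ?y <= _ => change (y) with x end end.
  rewrite E; clear E.
  set (h := fun p => exp (2 * (/ 2) ^ N) * euler_factor a t p).
  apply Rle_trans with (lprod h (PR 0 N)).
  - assert (Hp := proj2 (PR_primes 0 N)); revert Hp.
    generalize (PR 0 N) as ps; induction ps as [|p ps IH]; intros Hp.
    + simpl; rewrite Cmod_1; lra.
    + assert (Pp : is_prime p = true) by (apply Hp; now left).
      change (fold_right ?f ?e (p :: ps)) with (f p (fold_right f e ps)); cbv beta.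
      rewrite Cmod_mult, Rpow_mult_distr.
      change (lprod h (p :: ps)) with (h p * lprod h ps).
      assert (IH' := IH (fun q Hq => Hp q (or_intror Hq))).
      apply Rmult_le_compat; [apply pow2_ge_0|apply pow2_ge_0| |exact IH'].
      destruct (prime_power_half p a Pp Ha) as [R1 R2].
      set (r := Rpower (INR p) (- a)) in *.
      assert (Hz : nterm a t p <> RtoC 1).
      { intros Ez; apply (f_equal Cmod) in Ez; rewrite Cmod_nterm, Cmod_1 in Ez.
        fold r in Ez; rewrite Ez in R2; lra. }
      assert (G := Cmod_geometric (nterm a t p) (2 * N) Hz).
      rewrite Cmod_nterm in G; fold r in G.
      apply Rle_trans with (((1 + r ^ S (2 * N)) / Cmod (1 - nterm a t p)) ^ 2).
      { apply pow_incr; split; [apply Cmod_ge_0|exact G]. }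
      unfold Rdiv; rewrite Rpow_mult_distr, pow_inv, Cmod_one_minus_nterm.
      fold r; change (/ _) with (euler_factor a t p).
      apply Rmult_le_compat_r; [left; now apply euler_factor_pos|].
      assert (Hr : r ^ S (2 * N) <= (/ 2) ^ N).
      { rewrite <- tech_pow_Rmult, pow_mult, <- (Rmult_1_l ((/ 2) ^ N)).
        apply Rmult_le_compat; [lra|apply pow_le; nra|nra|].
        apply pow_incr; nra. }
      assert (Hr0 : 0 < r ^ S (2 * N)) by (apply pow_lt; easy).
      replace (2 * (/ 2) ^ N) with ((/ 2) ^ N + (/ 2) ^ N) by ring; rewrite exp_plus.
      assert (E1 := exp_ineq1_le ((/ 2) ^ N)).
      set (y := r ^ S (2 * N)) in *.
      replace ((1 + y) ^ 2) with ((1 + y) * (1 + y)) by ring; apply Rmult_le_compat; lra.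
  - unfold h; rewrite lprod_mult, lprod_exp, lsum_const_le.
    apply Rmult_le_compat_r.
    { left; apply lprod_pos; intros p Hp; apply euler_factor_pos; [now apply PR_primes in Hp|easy]. }
    apply exp_le.
    assert (H := half_pow_small N).
    assert (HL : INR (length (PR 0 N)) <= INR N) by (apply le_INR, PR_length).
    assert (0 < (/ 2) ^ N) by (apply pow_lt; lra); nra.
Qed.

Lemma Rpower_lprod {A} (f : A -> R) k l : (forall x, In x l -> 0 < f x) ->
  Rpower (lprod f l) k = lprod (fun x => Rpower (f x) k) l.
Proof.
  induction l as [|x l IH]; intros H; simpl; [apply Rpower_1_base|].
  rewrite <- Rpower_mult_distr, IH; [easy|intros y Hy; apply H; now right|apply H; now left|].
  apply lprod_pos; intros y Hy; apply H; now right.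
Qed.

Lemma lprod_app {A} (f : A -> R) l l' : lprod f (l ++ l') = lprod f l * lprod f l'.
Proof. induction l as [|x l IH]; simpl; [ring|rewrite IH; ring]. Qed.

Lemma lprod_le_exp {A} (f g : A -> R) l : (forall x, In x l -> 0 <= f x <= exp (g x)) ->
  0 <= lprod f l <= exp (lsum g l).
Proof. intros H; rewrite <- lprod_exp; now apply lprod_le. Qed.

Lemma isq_le_of_large X y : 0 < y -> y ^ 2 <= INR X -> isq X <= / y.
Proof.
  intros Hy HX; apply Rinv_le_contravar; [easy|].
  rewrite <- (sqrt_pow2 y) by lra; now apply sqrt_le_1_alt.
Qed.

(** [X] trades the crude bound, of cost [k sqrt X], against the third-order error [k^3 / sqrt X];
    both are of order [k^2] when [X] is. [D] is the product of the pointwise majorants, whose mean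
    is known exactly. *)
Lemma euler_product_mean k N X sg :
  2 <= k -> 0 <= sg -> 16 * k ^ 2 <= INR X -> (X <= N)%nat ->
  exists D m, is_mean D m
    /\ (forall t, Rpower (lprod (euler_factor (/ 2 + sg) t) (PR 0 N)) k <= D t)
    /\ m <= exp (16 * k * sqrt (INR X)
                 + k ^ 2 * lsum (fun p => Rpower (INR p) (-1 - 2 * sg)) (PR X N)
                 + 64 * k ^ 3 * isq X).
Proof.
  intros Hk Hs HX HN.
  assert (HX1 : (1 <= X)%nat) by (apply INR_le; simpl; nra).
  set (a := / 2 + sg).
  set (r := fun p => Rpower (INR p) (- a)).
  set (c0 := fun p => if Nat.leb p X then exp (8 * k * isq p)
                      else 1 + k ^ 2 * r p ^ 2 + 32 * k ^ 3 * r p ^ 3).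
  set (c1 := fun p => if Nat.leb p X then 0 else 2 * k * r p).
  set (c2 := fun p => if Nat.leb p X then 0 else k * r p ^ 2 + k ^ 2 * r p ^ 2).
  exists (fun t => lprod (trig2 c0 c1 c2 t) (PR 0 N)), (lprod c0 (PR 0 N)).
  split; [apply mean_prod_trig2, PR_primes|].
  assert (Ha : / 2 <= a) by (unfold a; lra).
  split.
  - intros t; rewrite Rpower_lprod.
    2:{ intros p Hp; apply euler_factor_pos; [now apply PR_primes in Hp|easy]. }
    apply lprod_le; intros p Hp; split; [left; apply Rpower_pos|].
    assert (Pp : is_prime p = true) by now apply PR_primes in Hp.
    assert (Hp1 := is_prime_gt1 p Pp).
    destruct (prime_power_half p a Pp Ha) as [R1 R2].
    assert (Hri := Rpower_half_le_isq p a ltac:(lia) Ha).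
    unfold euler_factor, trig2, c0, c1, c2; fold (r p) in R1, R2, Hri |- *.
    destruct (Nat.leb_spec p X) as [HpX|HpX].
    + rewrite !Rmult_0_l, !Rplus_0_r.
      eapply Rle_trans; [apply euler_factor_small_prime; [lra|easy|easy|apply COS_bound]|].
      apply exp_le; nra.
    + apply euler_factor_large_prime; [easy|easy|].
      assert (HpX' : isq p <= / (4 * k)).
      { apply isq_le_of_large; [lra|].
        assert (INR X <= INR p) by (apply le_INR; lia); nra. }
      apply Rle_trans with (k * / (4 * k)); [apply Rmult_le_compat_l; lra|].
      right; field; lra.
  - rewrite (PR_split 0 X N) by lia; rewrite lprod_app, Rplus_assoc, exp_plus.
    apply Rmult_le_compat.
    + apply (lprod_le_exp c0 (fun p => 8 * k * isq p)).
      intros p Hp; apply in_PR in Hp; unfold c0.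
      destruct (Nat.leb_spec p X); [|lia]; split; [left; apply exp_pos|lra].
    + apply (lprod_le_exp c0 (fun p => k ^ 2 * r p ^ 2 + 32 * k ^ 3 * r p ^ 3)).
      intros p Hp; apply in_PR in Hp; unfold c0.
      destruct (Nat.leb_spec p X); [lia|].
      assert (0 < r p) by apply Rpower_pos.
      assert (0 <= k ^ 2 * r p ^ 2) by (apply Rmult_le_pos; apply pow2_ge_0).
      assert (0 <= 32 * k ^ 3 * r p ^ 3)
        by (repeat apply Rmult_le_pos; try lra; apply pow_le; lra).
      split; [lra|].
      eapply Rle_trans; [|apply exp_ineq1_le]; lra.
    + eapply Rle_trans; [apply (lprod_le_exp c0 (fun p => 8 * k * isq p))|].
      * intros p Hp; apply in_PR in Hp; unfold c0.
        destruct (Nat.leb_spec p X); [|lia]; split; [left; apply exp_pos|lra].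
      * apply exp_le; rewrite lsum_scal.
        assert (S1 := sum_isq_primes X).
        replace (16 * k * sqrt (INR X)) with (8 * k * (2 * sqrt (INR X))) by ring.
        apply Rmult_le_compat_l; lra.
    + eapply Rle_trans;
        [apply (lprod_le_exp c0 (fun p => k ^ 2 * r p ^ 2 + 32 * k ^ 3 * r p ^ 3))|].
      * intros p Hp; apply in_PR in Hp; unfold c0.
        destruct (Nat.leb_spec p X); [lia|].
        assert (0 < r p) by apply Rpower_pos.
        assert (0 <= k ^ 2 * r p ^ 2) by (apply Rmult_le_pos; apply pow2_ge_0).
        assert (0 <= 32 * k ^ 3 * r p ^ 3)
          by (repeat apply Rmult_le_pos; try lra; apply pow_le; lra).
        split; [lra|].
        eapply Rle_trans; [|apply exp_ineq1_le]; lra.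
      * apply exp_le; rewrite lsum_plus, !lsum_scal.
        apply Rplus_le_compat.
        -- right; f_equal; apply lsum_ext; intros p Hp.
           unfold r; rewrite <- Rpower_pow by apply Rpower_pos.
           rewrite Rpower_mult; f_equal; unfold a; simpl; field.
        -- assert (S3 := sum_isq3 X (PR X N) HX1 (proj1 (PR_primes X N))
                          (fun p Hp => proj1 (proj1 (proj1 (in_PR X N p) Hp)))).
           replace (64 * k ^ 3 * isq X) with (32 * k ^ 3 * (2 * isq X)) by ring.
           apply Rmult_le_compat_l; [assert (0 <= k ^ 3) by (apply pow_le; lra); lra|].
           eapply Rle_trans; [|apply S3].
           apply lsum_le; intros p Hp; apply PR_primes, is_prime_gt1 in Hp.
           apply pow_incr; split; [left; apply Rpower_pos|].
           apply Rpower_half_le_isq; [lia|easy].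
Qed.

(** * Splitting at the frequency [log (N + 1/2)] *)

Definition rot (l : list term) : list term := map (fun x => (lam x, (- so x, co x))) l.

(** [rot] multiplies the coefficients by [i], so results on imaginary parts apply to real parts. *)
Lemma Vm_rot m l s t : Vm m (rot l) s t = Um m l s t.
Proof.
  unfold Vm, Um, rot; rewrite lsum_map; apply lsum_ext; intros x _.
  unfold lam, co, so; simpl; ring.
Qed.

(** For [N >= 1] strictly between [ln N] and [ln (N + 1)]: no frequency [cut N - ln n] vanishes, and
    its sign tells [n <= N] from [n > N]. *)
Definition cut (N : nat) : R := ln (INR N + / 2).
Definition sgN (N n : nat) : R := if Nat.leb n N then 1 else -1.
Definition frq (N n : nat) : R := Rabs (cut N - ln (INR n)).

(** Let [W = sum n^(-a) e^(i t (cut - log n))]. On the boundary the real parts of the sums over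
    [zlist1] and [zlist2] are [Re W] and [- Im W]. Signs of frequencies are moved into the
    coefficients, so both sums are analytic in the half-plane. *)
Definition zlist1 (a : R) (N : nat) (L : list nat) : list term :=
  map (fun n => (frq N n, (Rpower (INR n) (- a), 0))) L.
Definition zlist2 (a : R) (N : nat) (L : list nat) : list term :=
  map (fun n => (frq N n, (0, sgN N n * Rpower (INR n) (- a)))) L.

Lemma frq_sign N n : (1 <= n)%nat -> 0 < frq N n /\ cut N - ln (INR n) = sgN N n * frq N n.
Proof.
  intros Hn; unfold frq, sgN, cut.
  assert (Pn : 0 < INR n) by (apply lt_0_INR; lia).
  destruct (Nat.leb_spec n N) as [H|H].
  - assert (INR n <= INR N) by (apply le_INR; lia).
    assert (ln (INR n) < ln (INR N + / 2)) by (apply ln_increasing; lra).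
    rewrite Rabs_pos_eq by lra; lra.
  - assert (E : INR N + 1 <= INR n) by (rewrite <- S_INR; apply le_INR; lia).
    assert (PN := pos_INR N).
    assert (ln (INR N + / 2) < ln (INR n)) by (apply ln_increasing; lra).
    rewrite Rabs_left by lra; lra.
Qed.

Lemma frq_cos N n t : (1 <= n)%nat -> cos (frq N n * t) = cos (t * (cut N - ln (INR n))).
Proof.
  intros Hn; destruct (frq_sign N n Hn) as [_ E]; rewrite E; unfold sgN.
  destruct (Nat.leb n N); [f_equal; ring|].
  rewrite <- (cos_neg (frq N n * t)); f_equal; ring.
Qed.

Lemma frq_sin N n t : (1 <= n)%nat ->
  sgN N n * sin (frq N n * t) = sin (t * (cut N - ln (INR n))).
Proof.
  intros Hn; destruct (frq_sign N n Hn) as [_ E]; rewrite E; unfold sgN.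
  destruct (Nat.leb n N); [rewrite Rmult_1_l; f_equal; ring|].
  replace (t * (-1 * frq N n)) with (- (frq N n * t)) by ring; rewrite sin_neg; ring.
Qed.

Lemma lsum_rotation (w : nat -> R) c t L :
  lsum (fun n => w n * cos (t * (c - ln (INR n)))) L ^ 2
  + lsum (fun n => w n * sin (t * (c - ln (INR n)))) L ^ 2
  = lsum (fun n => w n * cos (t * ln (INR n))) L ^ 2
    + lsum (fun n => w n * sin (t * ln (INR n))) L ^ 2.
Proof.
  set (A := lsum (fun n => w n * cos (t * ln (INR n))) L).
  set (B := lsum (fun n => w n * sin (t * ln (INR n))) L).
  replace (lsum (fun n => w n * cos (t * (c - ln (INR n)))) L)
    with (cos (t * c) * A + sin (t * c) * B).
  2:{ unfold A, B; rewrite <- !lsum_scal, <- lsum_plus; apply lsum_ext; intros n _.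
      rewrite Rmult_minus_distr_l, cos_minus; ring. }
  replace (lsum (fun n => w n * sin (t * (c - ln (INR n)))) L)
    with (sin (t * c) * A + (- cos (t * c)) * B).
  2:{ unfold A, B; rewrite <- !lsum_scal, <- lsum_plus; apply lsum_ext; intros n _.
      rewrite Rmult_minus_distr_l, sin_minus; ring. }
  assert (E := sin2_cos2 (t * c)); unfold Rsqr in E.
  set (x := sin _) in *; set (y := cos _) in *.
  transitivity ((x * x + y * y) * (A ^ 2 + B ^ 2)); [ring|rewrite E; ring].
Qed.

Lemma lsum_filter {A} (f : A -> R) (b : A -> bool) l :
  lsum (fun x => if b x then f x else 0) l = lsum f (filter b l).
Proof.
  induction l as [|x l IH]; [easy|]; simpl; rewrite IH; destruct (b x); simpl; ring.
Qed.

Lemma lsum_smooth_range (f : nat -> R) J N : (N <= J)%nat ->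
  lsum (fun n => if Nat.leb n N then f n else 0) (smooth J (PR 0 N)) = lsum f (seq 1 N).
Proof.
  intros HJ; rewrite lsum_filter; apply lsum_perm, NoDup_Permutation.
  - apply NoDup_filter, smooth_NoDup, PR_primes.
  - apply seq_NoDup.
  - intros n; rewrite filter_In, in_seq; split.
    + intros [H1 H2]; apply Nat.leb_le in H2; apply smooth_pos in H1; [lia|apply PR_primes].
    + intros H; split; [apply smooth_contains_range; lia|apply Nat.leb_le; lia].
Qed.

Section Projection.

Variables (N : nat) (sg : R).
Hypothesis HN : (1 <= N)%nat.
Hypothesis Hsg : 0 <= sg.
Let a := / 2 + sg.
Let L := smooth (2 * N) (PR 0 N).
Let l1 := zlist1 a N L.
Let l2 := zlist2 a N L.

Lemma L_pos n : In n L -> (1 <= n)%nat.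
Proof. apply smooth_pos, PR_primes. Qed.

Lemma zlist_lam_pos x : In x l1 \/ In x l2 -> 0 < lam x.
Proof.
  intros [H|H]; apply in_map_iff in H; destruct H as (n & <- & Hn);
    apply L_pos in Hn; now apply frq_sign.
Qed.

Lemma zlist_boundary t :
  Um 0 l1 0 t ^ 2 + Um 0 l2 0 t ^ 2 <= exp 2 * lprod (euler_factor a t) (PR 0 N).
Proof.
  eapply Rle_trans; [|apply smooth_sum_bound; unfold a; lra].
  rewrite <- (lsum_rotation _ (cut N)).
  right; f_equal.
  - f_equal; unfold Um, l1, zlist1; rewrite lsum_map; apply lsum_ext; intros n Hn.
    unfold lam, co, so; simpl; rewrite Rmult_0_r, exp_0, frq_cos by now apply L_pos.
    ring.
  - rewrite <- !Rsqr_pow2, (Rsqr_neg (Um _ _ _ _)); f_equal.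
    unfold Um, l2, zlist2; rewrite lsum_map, lsum_opp; apply lsum_ext; intros n Hn.
    unfold lam, co, so; simpl; rewrite Rmult_0_r, exp_0, <- frq_sin by now apply L_pos.
    ring.
Qed.

(** For [n <= N] the decay down to depth [sg] is [e^(-sg cut) n^sg], which cancels the weight
    [n^(-sg)] contained in [n^(-a)]. *)
Lemma zlist_shift_coeff n : (1 <= n <= N)%nat ->
  Rpower (INR n) (- a) * exp (- frq N n * sg) = exp (- (sg * cut N)) * isq n.
Proof.
  intros Hn; destruct (frq_sign N n ltac:(lia)) as [_ E]; unfold sgN in E.
  destruct (Nat.leb_spec n N); [|lia].
  assert (Pn : 0 < INR n) by (apply lt_0_INR; lia).
  unfold isq; rewrite <- Rpower_sqrt, <- Rpower_Ropp by easy.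
  unfold Rpower; rewrite <- !exp_plus; f_equal.
  replace (frq N n) with (cut N - ln (INR n)) by lra; unfold a; ring.
Qed.

(** With [f1], [f2] the sums over [l1], [l2], the combination [f1 - i f2] has coefficients
    [(1 + sgN N n) n^(-a)] and so retains exactly the [n <= N], doubled. Then
    [|f1 - i f2|^2 <= 2 (|f1|^2 + |f2|^2)]. *)
Lemma zlist_projection t :
  2 * (exp (- (2 * sg * cut N)) * (DirRe N t ^ 2 + DirIm N t ^ 2))
  <= Um 0 l1 sg t ^ 2 + Vm 0 l1 sg t ^ 2 + Um 0 l2 sg t ^ 2 + Vm 0 l2 sg t ^ 2.
Proof.
  set (e := exp (- (sg * cut N))).
  assert (E1 : Um 0 l1 sg t + Vm 0 l2 sg t
    = 2 * e * lsum (fun n => isq n * cos (t * (cut N - ln (INR n)))) (seq 1 N)).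
  { rewrite <- (lsum_smooth_range _ (2 * N)) by lia; fold L.
    unfold Um, Vm, l1, l2, zlist1, zlist2; rewrite !lsum_map, <- lsum_plus, <- lsum_scal.
    apply lsum_ext; intros n Hn; apply L_pos in Hn.
    unfold lam, co, so; simpl; rewrite frq_cos by easy.
    destruct (Nat.leb_spec n N) as [H|H].
    - assert (E := zlist_shift_coeff n ltac:(lia)); fold e in E.
      unfold sgN; destruct (Nat.leb_spec n N); [|lia].
      replace (2 * e * (isq n * cos (t * (cut N - ln (INR n)))))
        with (2 * (e * isq n) * cos (t * (cut N - ln (INR n)))) by ring.
      rewrite <- E; ring.
    - unfold sgN; destruct (Nat.leb_spec n N); [lia|]; ring. }
  assert (E2 : Vm 0 l1 sg t - Um 0 l2 sg t
    = 2 * e * lsum (fun n => isq n * sin (t * (cut N - ln (INR n)))) (seq 1 N)).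
  { rewrite <- (lsum_smooth_range _ (2 * N)) by lia; fold L.
    unfold Rminus; rewrite (lsum_opp _ _ : - Um 0 l2 sg t = _).
    unfold Um, Vm, l1, l2, zlist1, zlist2; rewrite !lsum_map, <- lsum_plus, <- lsum_scal.
    apply lsum_ext; intros n Hn; apply L_pos in Hn.
    unfold lam, co, so; simpl.
    change (cut N + - ln (INR n)) with (cut N - ln (INR n)).
    rewrite <- frq_sin by easy.
    destruct (Nat.leb_spec n N) as [H|H].
    - assert (E := zlist_shift_coeff n ltac:(lia)); fold e in E.
      unfold sgN; destruct (Nat.leb_spec n N); [|lia].
      replace (2 * e * (isq n * (1 * sin (frq N n * t))))
        with (2 * (e * isq n) * sin (frq N n * t)) by ring.
      rewrite <- E; ring.
    - unfold sgN; destruct (Nat.leb_spec n N); [lia|]; ring. }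
  assert (E3 := lsum_rotation isq (cut N) t (seq 1 N)).
  assert (E4 : lsum (fun n => isq n * cos (t * ln (INR n))) (seq 1 N) ^ 2
    + lsum (fun n => isq n * sin (t * ln (INR n))) (seq 1 N) ^ 2 = DirRe N t ^ 2 + DirIm N t ^ 2).
  { unfold DirRe, DirIm; rewrite !dsum_lsum; f_equal.
    rewrite <- !Rsqr_pow2, Rsqr_neg, lsum_opp; easy. }
  rewrite E4 in E3; rewrite <- E3.
  replace (exp (- (2 * sg * cut N))) with (e * e) by (unfold e; rewrite <- exp_plus; f_equal; ring).
  set (x := lsum _ _) in *; set (y := lsum (fun n => isq n * sin _) _) in *.
  replace (2 * (e * e * (x ^ 2 + y ^ 2))) with (/ 2 * ((2 * e * x) ^ 2 + (2 * e * y) ^ 2)) by field.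
  rewrite <- E1, <- E2.
  set (u := Um 0 l1 sg t); set (v := Vm 0 l1 sg t); set (u' := Um 0 l2 sg t); set (v' := Vm 0 l2 sg t).
  assert (P1 := pow2_ge_0 (u - v')); assert (P2 := pow2_ge_0 (v + u')); nra.
Qed.

End Projection.

(** * The upper bound *)

Lemma Rpower_one_plus_le W k : 0 <= k -> 0 < W -> Rpower (1 + W) k <= Rpower 2 k * (1 + Rpower W k).
Proof.
  intros Hk HW; assert (P2 := Rpower_pos 2 k); assert (PW := Rpower_pos W k).
  destruct (Rle_lt_dec W 1) as [H|H].
  - assert (Rpower (1 + W) k <= Rpower 2 k) by (apply Rle_Rpower_l; lra); nra.
  - apply Rle_trans with (Rpower (2 * W) k); [apply Rle_Rpower_l; lra|].
    rewrite Rpower_mult_base by lra; nra.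
Qed.

(** The largest of four squares carries at least a quarter of their sum, so a single power bounds
    the left side. *)
Lemma rpow_sum4_le c x y1 y2 y3 y4 k : 0 <= k -> 0 < c ->
  2 * x <= c * (y1 ^ 2 + y2 ^ 2 + y3 ^ 2 + y4 ^ 2) ->
  rpow x k <= Rpower (2 * c) k * (onesq_pow k y1 + onesq_pow k y2 + onesq_pow k y3 + onesq_pow k y4).
Proof.
  intros Hk Hc H.
  assert (Q1 := onesq_pow_pos k y1); assert (Q2 := onesq_pow_pos k y2).
  assert (Q3 := onesq_pow_pos k y3); assert (Q4 := onesq_pow_pos k y4).
  assert (Qc := Rpower_pos (2 * c) k).
  assert (E : forall y, x <= 2 * c * (1 + y ^ 2) -> rpow x k <= Rpower (2 * c) k * onesq_pow k y).
  { intros y Hy; assert (Y2 := pow2_ge_0 y).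
    unfold onesq_pow; rewrite <- Rpower_mult_base by lra; apply rpow_le; nra. }
  assert (M : forall y z, rpow x k <= Rpower (2 * c) k * y -> 0 <= z ->
                rpow x k <= Rpower (2 * c) k * (y + z)) by (intros; nra).
  assert (F : exists y, (y = y1 \/ y = y2 \/ y = y3 \/ y = y4)
                        /\ y1 ^ 2 + y2 ^ 2 + y3 ^ 2 + y4 ^ 2 <= 4 * y ^ 2).
  { destruct (Rle_lt_dec (y1 ^ 2 + y2 ^ 2 + y3 ^ 2 + y4 ^ 2) (4 * y1 ^ 2)); [exists y1; tauto|].
    destruct (Rle_lt_dec (y1 ^ 2 + y2 ^ 2 + y3 ^ 2 + y4 ^ 2) (4 * y2 ^ 2)); [exists y2; tauto|].
    destruct (Rle_lt_dec (y1 ^ 2 + y2 ^ 2 + y3 ^ 2 + y4 ^ 2) (4 * y3 ^ 2)); [exists y3; tauto|].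
    exists y4; split; [tauto|lra]. }
  destruct F as (y & Hy & Hm).
  specialize (E y ltac:(nra)).
  eapply Rle_trans; [apply E|]; apply Rmult_le_compat_l; [lra|].
  destruct Hy as [->|[->|[->| ->]]]; lra.
Qed.

Lemma eventually_small K : eventually (fun n => K / INR n <= 1).
Proof.
  destruct (nfloor_ex (Rabs K) (Rabs_pos K)) as [m Hm].
  exists (S m); intros n Hn.
  assert (H : INR m + 1 <= INR n) by (rewrite <- S_INR; apply le_INR; lia).
  assert (Pm := pos_INR m); assert (Q := Rle_abs K).
  apply Rmult_le_reg_r with (INR n); [lra|].
  unfold Rdiv; rewrite Rmult_assoc, Rinv_l; lra.
Qed.

(** [zlist_projection] bounds [F] by real and imaginary parts at depth [sg]; [mean_power_shift]
    brings them to the boundary, [mean_power_conjugate] replaces imaginary by real parts there, and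
    the Euler product dominates these. The added 1 and 2 absorb the errors [K / INR n]. *)
Lemma pseudomoment_upper k N sg D m :
  (1 <= N)%nat -> 2 <= k -> 0 <= sg -> is_mean D m ->
  (forall t, Rpower (lprod (euler_factor (/ 2 + sg) t) (PR 0 N)) k <= D t) ->
  let Bz := Rpower 2 k * (1 + exp (2 * k) * (m + 1)) in
  pseudomoment k N
  <= Rpower (2 * exp (2 * sg * cut N)) k
     * (2 * (Bz + 1) + 2 * ((2 * Rpower (4 * k ^ 2) k + 4) * Bz + 2)).
Proof.
  intros HN Hk Hs HD HDt Bz.
  set (a := / 2 + sg); set (L := smooth (2 * N) (PR 0 N)).
  assert (Pos1 : forall x, In x (zlist1 a N L) -> 0 < lam x)
    by (intros x Hx; apply (zlist_lam_pos N sg); now left).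
  assert (Pos2 : forall x, In x (zlist2 a N L) -> 0 < lam x)
    by (intros x Hx; apply (zlist_lam_pos N sg); now right).
  assert (Posr : forall l, (forall x, In x l -> 0 < lam x) -> forall x, In x (rot l) -> 0 < lam x).
  { intros l Hl x Hx; apply in_map_iff in Hx; destruct Hx as (y & <- & Hy).
    change (0 < lam y); now apply Hl. }
  assert (HU : forall l, (forall t, Um 0 l 0 t ^ 2 <= exp 2 * lprod (euler_factor a t) (PR 0 N)) ->
    eventually (fun n => Avg (fun t => onesq_pow k (Um 0 l 0 t)) n <= Bz)).
  { intros l Hl; destruct HD as [CD HD].
    destruct (is_mean_upper D m (m + 1) (conj CD HD) ltac:(lra)) as [n0 Hn0].
    exists (S n0); intros n Hn; specialize (Hn0 n ltac:(lia)).
    apply Rle_trans with (Avg (fun t => Rpower 2 k * (1 + exp (2 * k) * D t)) n).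
    - apply Avg_le; [apply cont_onesq_pow_Um| |].
      + apply cont_mult; [apply cont_const|apply cont_plus; [apply cont_const|]].
        apply cont_mult; [apply cont_const|easy].
      + intros t; specialize (Hl t); specialize (HDt t); fold a in HDt.
        set (W := lprod (euler_factor a t) (PR 0 N)) in *.
        assert (HW : 0 < W).
        { apply lprod_pos; intros p Hp; apply euler_factor_pos; [now apply PR_primes in Hp|].
          unfold a; lra. }
        assert (He : 0 < exp 2) by apply exp_pos.
        apply Rle_trans with (Rpower (1 + exp 2 * W) k); [apply Rle_Rpower_l; nra|].
        eapply Rle_trans; [apply Rpower_one_plus_le; nra|].
        apply Rmult_le_compat_l; [left; apply Rpower_pos|].
        rewrite Rpower_mult_base by easy.
        replace (Rpower (exp 2) k) with (exp (2 * k)) by (unfold Rpower; rewrite ln_exp; f_equal; ring).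
        assert (0 < exp (2 * k)) by apply exp_pos; nra.
    - rewrite Avg_scal by (apply cont_plus; [apply cont_const|apply cont_mult; [apply cont_const|easy]]).
      rewrite Avg_plus by (apply cont_const || (apply cont_mult; [apply cont_const|easy])).
      rewrite Avg_scal, Avg_const by (easy || lia).
      apply Rmult_le_compat_l; [left; apply Rpower_pos|].
      assert (0 < exp (2 * k)) by apply exp_pos; nra. }
  assert (HB := zlist_boundary N sg Hs); fold a L in HB.
  assert (A1 := HU (zlist1 a N L) ltac:(intros t; specialize (HB t); assert (Q := pow2_ge_0 (Um 0 (zlist2 a N L) 0 t)); lra)).
  assert (A2 := HU (zlist2 a N L) ltac:(intros t; specialize (HB t); assert (Q := pow2_ge_0 (Um 0 (zlist1 a N L) 0 t)); lra)).
  assert (HBz : 0 <= 2 * Rpower (4 * k ^ 2) k + 4) by (assert (Q := Rpower_pos (4 * k ^ 2) k); lra).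
  assert (HV : forall l, (forall x, In x l -> 0 < lam x) ->
    eventually (fun n => Avg (fun t => onesq_pow k (Um 0 l 0 t)) n <= Bz) ->
    eventually (fun n => Avg (fun t => onesq_pow k (Um 0 l sg t)) n <= Bz + 1
      /\ Avg (fun t => onesq_pow k (Vm 0 l sg t)) n <= (2 * Rpower (4 * k ^ 2) k + 4) * Bz + 2)).
  { intros l Hl [n0 H0].
    destruct (mean_power_shift k l Hk Hl) as [K1 H1].
    destruct (mean_power_shift k (rot l) Hk (Posr l Hl)) as [K2 H2].
    destruct (mean_power_conjugate k l Hk Hl) as [K3 H3].
    destruct (eventually_small K1) as [n1 E1], (eventually_small K2) as [n2 E2],
      (eventually_small K3) as [n3 E3].
    exists (S (n0 + n1 + n2 + n3)); intros n Hn.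
    specialize (H0 n ltac:(lia)); specialize (E1 n ltac:(lia)); specialize (E2 n ltac:(lia)).
    specialize (E3 n ltac:(lia)).
    specialize (H1 n sg ltac:(lia) Hs); specialize (H2 n sg ltac:(lia) Hs).
    specialize (H3 n ltac:(lia)).
    rewrite !(Avg_ext (fun t => onesq_pow k (Vm 0 (rot l) _ t)) (fun t => onesq_pow k (Um 0 l _ t)) n) in H2
      by (intros t; now rewrite Vm_rot).
    split; [lra|].
    assert ((2 * Rpower (4 * k ^ 2) k + 4) * Avg (fun t => onesq_pow k (Um 0 l 0 t)) n
            <= (2 * Rpower (4 * k ^ 2) k + 4) * Bz) by (apply Rmult_le_compat_l; lra).
    lra. }
  destruct (HV _ Pos1 A1) as [n1 V1], (HV _ Pos2 A2) as [n2 V2].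
  apply pseudomoment_le; [lra|].
  exists (S (n1 + n2)); intros n Hn.
  specialize (V1 n ltac:(lia)); specialize (V2 n ltac:(lia)).
  set (c := exp (2 * sg * cut N)).
  assert (Hc : 0 < c) by apply exp_pos.
  set (F := fun t => Rpower (2 * c) k * (onesq_pow k (Um 0 (zlist1 a N L) sg t) + onesq_pow k (Vm 0 (zlist1 a N L) sg t)
     + onesq_pow k (Um 0 (zlist2 a N L) sg t) + onesq_pow k (Vm 0 (zlist2 a N L) sg t))).
  assert (C1 := cont_onesq_pow_Um k 0 (zlist1 a N L) sg); assert (C2 := cont_onesq_pow_Vm k 0 (zlist1 a N L) sg).
  assert (C3 := cont_onesq_pow_Um k 0 (zlist2 a N L) sg); assert (C4 := cont_onesq_pow_Vm k 0 (zlist2 a N L) sg).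
  assert (C12 := cont_plus _ _ C1 C2); assert (C123 := cont_plus _ _ C12 C3).
  assert (C1234 := cont_plus _ _ C123 C4).
  apply Rle_trans with (Avg F n).
  - apply Avg_le; [apply cont_DirPow; lra|apply cont_mult; [apply cont_const|easy]|].
    intros t; unfold F, DirPow; apply rpow_sum4_le; [lra|easy|].
    assert (J := zlist_projection N sg HN t); fold a L in J.
    rewrite exp_Ropp in J; fold c in J.
    apply (Rmult_le_compat_l c) in J; [|lra].
    replace (c * (2 * (/ c * (DirRe N t ^ 2 + DirIm N t ^ 2))))
      with (2 * (DirRe N t ^ 2 + DirIm N t ^ 2)) in J by (field; lra).
    exact J.
  - unfold F; rewrite Avg_scal by easy.
    rewrite (Avg_plus (fun t => onesq_pow k (Um 0 (zlist1 a N L) sg t) + onesq_pow k (Vm 0 (zlist1 a N L) sg t)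
     + onesq_pow k (Um 0 (zlist2 a N L) sg t))) by easy.
    rewrite (Avg_plus (fun t => onesq_pow k (Um 0 (zlist1 a N L) sg t) + onesq_pow k (Vm 0 (zlist1 a N L) sg t))) by easy.
    rewrite Avg_plus by easy.
    apply Rmult_le_compat_l; [left; apply Rpower_pos|lra].
Qed.

Lemma exp_ge_nat_pow x : 0 <= x -> x ^ 2 <= exp (2 * x).
Proof.
  intros Hx; replace (2 * x) with (x + x) by ring; rewrite exp_plus.
  assert (E := exp_ineq1_le x); nra.
Qed.

(** [ln L - ln k] is [log (1/s)], from all primes up to [N]; [ln (ln k)] is the share of the primes
    up to [X], where [ln X] has order [ln k]. For these, [k ln k <= L] makes the weights [p^(-2k/L)]
    cost only [O(1)], so their removal gains [ln (ln X) - O(1)]. *)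
Lemma prime_sum_upper k N X L : 2 <= k -> L = ln (INR N) -> k * ln k <= L -> k <= L ->
  16 * k ^ 2 <= INR X <= 17 * k ^ 2 -> (X <= N)%nat ->
  lsum (fun p => Rpower (INR p) (-1 - 2 * (k / L))) (PR X N)
  <= ln L - ln k - ln (ln k) + 160.
Proof.
  intros Hk EL HkL HkL' HX HXN.
  assert (HX2 : 16 <= INR X) by nra.
  assert (HXn : (2 <= X)%nat) by (apply INR_le; simpl; lra).
  assert (Hs : 0 < k / L) by (apply Rdiv_lt_0_compat; lra).
  assert (Hl2 : / 2 <= ln k) by (apply Rle_trans with (ln 2); [left; exact ln_lt_2|apply ln_le; lra]).
  assert (S1 := sum_prime_power (PR 0 N) (2 * (k / L)) (PR_primes 0 N) ltac:(lra)).
  rewrite (PR_split 0 X N), lsum_app in S1 by lia.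
  assert (S2 := sum_prime_power_ge X (2 * (k / L)) ltac:(lia) ltac:(lra)).
  assert (S3 := mertens_lower X HXn).
  assert (T1 : ln (1 + / (2 * (k / L))) <= 2 + ln L - ln k).
  { replace (/ (2 * (k / L))) with (L / (2 * k)) by (field; lra).
    apply Rle_trans with (ln (3 * (L / k))).
    - assert (0 < L / (2 * k)) by (apply Rdiv_lt_0_compat; lra).
      apply ln_le; [lra|].
      apply Rmult_le_reg_r with k; [lra|].
      replace ((1 + L / (2 * k)) * k) with (k + L / 2) by (field; lra).
      replace (3 * (L / k) * k) with (3 * L) by (field; lra); lra.
    - rewrite ln_mult, ln_div by (try apply Rdiv_lt_0_compat; lra).
      assert (E := ln_le_sub 3 ltac:(lra)); lra. }
  assert (T2 : ln (ln k) <= ln (ln (INR X))).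
  { apply ln_le; [lra|]; apply ln_le; nra. }
  assert (T3 : k / L * ln (INR X) <= 34).
  { assert (E : ln (INR X) <= 16 + 2 * ln k).
    { apply Rle_trans with (ln (17 * (k * k))); [apply ln_le; nra|].
      rewrite !ln_mult by nra; assert (E := ln_le_sub 17 ltac:(lra)); lra. }
    assert (E2 : ln (INR X) <= 34 * ln k) by lra.
    apply Rle_trans with (k / L * (34 * ln k)); [apply Rmult_le_compat_l; lra|].
    apply Rmult_le_reg_r with L; [lra|].
    replace (k / L * (34 * ln k) * L) with (34 * (k * ln k)) by (field; lra); lra. }
  lra.
Qed.

Lemma upper_bound_main k N : 2 <= k -> 100 <= ln (INR N) ->
  k <= ln (INR N) / ln (ln (INR N)) ->
  normmoment k N <= exp (- k ^ 2 * ln k - k ^ 2 * ln (ln k) + 300 * k ^ 2).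
Proof.
  intros Hk HL HkL; set (L := ln (INR N)) in *.
  assert (PN : 0 < INR N).
  { destruct (Rle_lt_dec (INR N) 0) as [H|H]; [|easy].
    unfold L, ln in HL; destruct (Rlt_dec 0 (INR N)); lra. }
  assert (HlL : 1 <= ln L).
  { rewrite <- (ln_exp 1); apply ln_le; [apply exp_pos|].
    assert (E := exp_le_3); lra. }
  assert (Hk1 : k * ln L <= L).
  { apply (Rmult_le_compat_r (ln L)) in HkL; [|lra].
    replace (L / ln L * ln L) with L in HkL by (field; lra); easy. }
  assert (Hk2 : k <= L) by nra.
  assert (Hkl : ln k <= ln L) by (apply ln_le; lra).
  assert (Hk3 : k * ln k <= L) by nra.
  assert (EN : INR N = exp L) by (unfold L; rewrite exp_ln; easy).
  assert (HN17 : 17 * L ^ 2 <= INR N).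
  { rewrite EN; assert (E := exp_ge_nat_pow (L / 4) ltac:(lra)).
    replace L with (2 * (L / 4) + 2 * (L / 4)) at 2 by field.
    rewrite exp_plus.
    apply Rle_trans with ((L / 4) ^ 2 * (L / 4) ^ 2).
    - assert (17 <= (L / 4) ^ 2 / 16) by nra.
      replace ((L / 4) ^ 2 * (L / 4) ^ 2) with ((L / 4) ^ 2 / 16 * L ^ 2) by field.
      apply Rmult_le_compat_r; [apply pow2_ge_0|easy].
    - apply Rmult_le_compat; try apply pow2_ge_0; easy. }
  assert (HN : (1 <= N)%nat) by (apply INR_le; simpl; nra).
  (* Primes beyond [16 k^2] have [k p^(-1/2) <= 1/4], as the expansion of their Euler factors
     requires. *)
  destruct (nfloor_ex (16 * k ^ 2) ltac:(nra)) as [X0 HX0].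
  set (X := S X0).
  assert (HX : 16 * k ^ 2 <= INR X <= 17 * k ^ 2) by (unfold X; rewrite S_INR; nra).
  assert (HXN : (X <= N)%nat) by (apply INR_le; nra).
  set (sg := k / L).
  assert (Hsg : 0 < sg) by (apply Rdiv_lt_0_compat; lra).
  destruct (euler_product_mean k N X sg Hk ltac:(lra) ltac:(lra) HXN) as (D & m & HD & HDt & Hm).
  set (tau := ln L - ln k - ln (ln k)).
  (* [k ln k <= L] makes the main exponent nonnegative, so added constants such as the 1 in [m + 1]
     are absorbed by exponentials. *)
  assert (Htau : 0 <= tau).
  { assert (Hl2 : / 2 <= ln k)
      by (apply Rle_trans with (ln 2); [left; exact ln_lt_2|apply ln_le; lra]).
    unfold tau; assert (E : ln (k * ln k) <= ln L) by (apply ln_le; nra).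
    rewrite ln_mult in E by lra; lra. }
  assert (HS := prime_sum_upper k N X L Hk eq_refl Hk3 Hk2 HX HXN); fold sg tau in HS.
  set (E := exp (k ^ 2 * (tau + 256))).
  assert (HmE : m <= E).
  { eapply Rle_trans; [apply Hm|]; apply exp_le.
    assert (T1 : sqrt (INR X) <= 5 * k).
    { rewrite <- (sqrt_pow2 (5 * k)) by lra; apply sqrt_le_1_alt; nra. }
    assert (T2 : isq X <= / (4 * k)) by (apply isq_le_of_large; nra).
    assert (T3 : 64 * k ^ 3 * isq X <= 16 * k ^ 2).
    { replace (16 * k ^ 2) with (64 * k ^ 3 * / (4 * k)) by (field; lra).
      apply Rmult_le_compat_l; [assert (0 <= k ^ 3) by (apply pow_le; lra); lra|easy]. }
    assert (T4 : 16 * k * sqrt (INR X) <= 80 * k ^ 2) by nra.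
    assert (T5 : k ^ 2 * lsum (fun p => Rpower (INR p) (-1 - 2 * sg)) (PR X N) <= k ^ 2 * (tau + 160))
      by (apply Rmult_le_compat_l; [nra|lra]).
    nra. }
  assert (HE1 : 1 <= E) by (unfold E; rewrite <- exp_0; apply exp_le; nra).
  assert (HU := pseudomoment_upper k N sg D m HN Hk ltac:(lra) HD HDt); cbv zeta in HU.
  set (Bz := Rpower 2 k * (1 + exp (2 * k) * (m + 1))) in HU.
  assert (Hln2 : ln 2 <= 1) by (assert (Q := ln_le_sub 2 ltac:(lra)); lra).
  assert (H2k : Rpower 2 k <= exp k) by (apply exp_le; nra).
  assert (P2k := Rpower_pos 2 k).
  assert (He2k : 1 <= exp (2 * k)) by (rewrite <- exp_0; apply exp_le; lra).
  set (Bm := exp (k ^ 2 * (tau + 258))).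
  assert (HBz : Bz <= Bm).
  { apply Rle_trans with (exp k * (exp 2 * exp (2 * k) * E)).
    - unfold Bz; apply Rle_trans with (Rpower 2 k * (exp 2 * exp (2 * k) * E)).
      + apply Rmult_le_compat_l; [lra|].
        assert (Q := exp_ineq1_le 2).
        assert (Q1 : exp (2 * k) * (m + 1) <= exp (2 * k) * (2 * E)) by (apply Rmult_le_compat_l; lra).
        assert (Q2 : 1 <= exp (2 * k) * E) by nra.
        assert (Q3 : 3 * (exp (2 * k) * E) <= exp 2 * (exp (2 * k) * E)) by (apply Rmult_le_compat_r; lra).
        lra.
      + apply Rmult_le_compat_r; [|easy].
        assert (0 < exp 2) by apply exp_pos; apply Rmult_le_pos; nra.
    - unfold E, Bm; rewrite <- !exp_plus; apply exp_le; nra. }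
  assert (HBm : 1 <= Bm) by (unfold Bm; rewrite <- exp_0; apply exp_le; nra).
  (* The cost of conjugation: [2 k ln (2k)] is below [4 k^2]. *)
  assert (Hck : Rpower (4 * k ^ 2) k <= exp (4 * k ^ 2)).
  { apply exp_le; replace (4 * k ^ 2) with ((2 * k) * (2 * k)) at 1 by ring.
    rewrite ln_mult by lra; assert (Q := ln_le_sub (2 * k) ltac:(lra)); nra. }
  assert (H4k : 1 <= exp (4 * k ^ 2)) by (rewrite <- exp_0; apply exp_le; nra).
  assert (HR : 2 * (Bz + 1) + 2 * ((2 * Rpower (4 * k ^ 2) k + 4) * Bz + 2)
               <= exp (k ^ 2 * (tau + 264))).
  { apply Rle_trans with (exp 5 * (exp (4 * k ^ 2) * Bm)).
    2:{ unfold Bm; rewrite <- !exp_plus; apply exp_le; nra. }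
    assert (Q := exp_ineq1_le 1); assert (Q5 : 32 <= exp 5).
    { replace 5 with (1 + 1 + 1 + 1 + 1) by ring; rewrite !exp_plus.
      set (e := exp 1) in *; assert (4 <= e * e) by nra; assert (8 <= e * e * e) by nra.
      assert (16 <= e * e * e * e) by nra; nra. }
    assert (Q6 : (2 * Rpower (4 * k ^ 2) k + 4) * Bz <= 6 * exp (4 * k ^ 2) * Bm).
    { apply Rle_trans with ((2 * Rpower (4 * k ^ 2) k + 4) * Bm).
      - apply Rmult_le_compat_l; [|easy]; assert (Z := Rpower_pos (4 * k ^ 2) k); lra.
      - apply Rmult_le_compat_r; lra. }
    assert (Q7 : 1 <= exp (4 * k ^ 2) * Bm) by nra.
    assert (Q8 : Bm <= exp (4 * k ^ 2) * Bm) by nra.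
    assert (Q9 : 32 * (exp (4 * k ^ 2) * Bm) <= exp 5 * (exp (4 * k ^ 2) * Bm))
      by (apply Rmult_le_compat_r; lra).
    lra. }
  assert (HcN : 2 * sg * cut N <= 4 * k).
  { assert (Q : cut N <= 2 * L).
    { assert (N2 : 2 <= INR N) by nra; unfold cut; apply Rle_trans with (ln (INR N * INR N)); [apply ln_le; nra|].
      rewrite ln_mult by easy; fold L; lra. }
    replace (4 * k) with (2 * sg * (2 * L)) by (unfold sg; field; lra).
    apply Rmult_le_compat_l; lra. }
  assert (HP : Rpower (2 * exp (2 * sg * cut N)) k <= exp (5 * k ^ 2)).
  { apply exp_le; rewrite ln_mult, ln_exp by (try apply exp_pos; lra); nra. }
  assert (Hfin : pseudomoment k N <= exp (5 * k ^ 2) * exp (k ^ 2 * (tau + 264))).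
  { eapply Rle_trans; [apply HU|].
    apply Rle_trans with (Rpower (2 * exp (2 * sg * cut N)) k * exp (k ^ 2 * (tau + 264))).
    - apply Rmult_le_compat_l; [left; apply Rpower_pos|easy].
    - apply Rmult_le_compat_r; [left; apply exp_pos|easy]. }
  unfold normmoment; fold L.
  apply Rmult_le_reg_r with (Rpower L (k ^ 2)); [apply Rpower_pos|].
  unfold Rdiv; rewrite Rmult_assoc, Rinv_l, Rmult_1_r by (assert (Z := Rpower_pos L (k ^ 2)); lra).
  eapply Rle_trans; [apply Hfin|].
  unfold Rpower; rewrite <- !exp_plus; apply exp_le; unfold tau; nra.
Qed.

(** * The lower bound *)

Definition cis (x : R) : C := (cos x, sin x).

Lemma cis_plus x y : cis (x + y) = (cis x * cis y)%C.
Proof. unfold cis, Cmult; simpl; rewrite cos_plus, sin_plus; f_equal; ring. Qed.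

(* With [z = p^{-1/2-it}] this is [1 + k z + (k-1) conj z]. *)
Definition dual_factor (k t : R) (p : nat) : C :=
  (1 + (2 * k - 1) * isq p * cos (t * ln (INR p)), - (isq p * sin (t * ln (INR p)))).

Definition dual (k : R) (ps : list nat) (t : R) : C :=
  fold_right (fun p s => (dual_factor k t p * s)%C) (RtoC 1) ps.

(** The mean of [e^(i t mu) G]: [z_p] and its conjugate shift the frequency by [- log p] and
    [+ log p]. For [k >= 1] all terms are nonnegative, so any of them may be dropped in a lower
    bound. *)
Fixpoint dual_mean (k : R) (ps : list nat) (mu : R) : R :=
  match ps with
  | nil => if Req_EM_T mu 0 then 1 else 0
  | p :: q => dual_mean k q mu + k * isq p * dual_mean k q (mu - ln (INR p))
              + (k - 1) * isq p * dual_mean k q (mu + ln (INR p))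
  end.

Lemma is_mean_dual k ps mu :
  is_mean (fun t => fst (cis (t * mu) * dual k ps t)%C) (dual_mean k ps mu).
Proof.
  revert mu; induction ps as [|p ps IH]; intros mu.
  - eapply is_mean_ext; [|apply is_mean_cos]; intros t; simpl; ring.
  - assert (H := is_mean_plus _ _ _ _ (is_mean_plus _ _ _ _ (IH mu)
        (is_mean_scal (k * isq p) _ _ (IH (mu - ln (INR p)))))
        (is_mean_scal ((k - 1) * isq p) _ _ (IH (mu + ln (INR p))))).
    eapply is_mean_ext; [|exact H]; intros t; cbv beta.
    rewrite Rmult_plus_distr_l, Rmult_minus_distr_l; unfold Rminus; rewrite !cis_plus.
    change (dual k (p :: ps) t) with (dual_factor k t p * dual k ps t)%C.
    destruct (dual k ps t) as [x y]; destruct (cis (t * mu)) as [u v].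
    unfold dual_factor, cis, Cmult; simpl; rewrite cos_neg, sin_neg; ring.
Qed.

Lemma dual_mean_nonneg k ps mu : 1 <= k -> (forall p, In p ps -> is_prime p = true) ->
  0 <= dual_mean k ps mu.
Proof.
  intros Hk; revert mu; induction ps as [|p ps IH]; intros mu Hp; simpl.
  - destruct (Req_EM_T mu 0); lra.
  - assert (Hp' : forall q, In q ps -> is_prime q = true) by (intros q Hq; apply Hp; now right).
    assert (H1 : 0 < isq p).
    { apply isq_pos; assert (Q := is_prime_gt1 p (Hp p (or_introl eq_refl))); lia. }
    assert (A := IH mu Hp'); assert (B := IH (mu - ln (INR p)) Hp').
    assert (D := IH (mu + ln (INR p)) Hp').
    assert (0 <= k * isq p * dual_mean k ps (mu - ln (INR p))) by (apply Rmult_le_pos; nra).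
    assert (0 <= (k - 1) * isq p * dual_mean k ps (mu + ln (INR p))) by (apply Rmult_le_pos; nra).
    lra.
Qed.

(* The sharp cutoff [q <= N] enters through [1_{q <= N} >= 1 - ln q / ln N]. *)
Lemma dual_mean_sum_ge k N ps : 1 <= k -> 0 < ln (INR N) ->
  (forall p, In p ps -> is_prime p = true) -> forall q, (1 <= q)%nat ->
  isq q * lprod (fun p => 1 + k / INR p) ps
    * (1 - (ln (INR q) + lsum (fun p => k * (ln (INR p) / INR p)) ps) / ln (INR N))
  <= lsum (fun n => isq n * dual_mean k ps (ln (INR n) - ln (INR q))) (seq 1 N).
Proof.
  intros Hk HL; induction ps as [|p ps IH]; intros Hp q Hq.
  - simpl; rewrite Rmult_1_r, Rplus_0_r.
    assert (Hnn : forall n, In n (seq 1 N) ->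
      0 <= isq n * (if Req_EM_T (ln (INR n) - ln (INR q)) 0 then 1 else 0)).
    { intros n Hn; apply in_seq in Hn; assert (Q := isq_pos n ltac:(lia)).
      destruct (Req_EM_T _ 0); lra. }
    destruct (Compare_dec.le_lt_dec q N) as [H|H].
    + apply Rle_trans with (isq q).
      * rewrite <- (Rmult_1_r (isq q)) at 2; apply Rmult_le_compat_l; [left; now apply isq_pos|].
        assert (0 <= ln (INR q) / ln (INR N)); [|lra].
        apply Rdiv_le_0_compat; [|easy].
        rewrite <- ln_1; apply ln_le; [lra|]; change 1 with (INR 1); apply le_INR; lia.
      * assert (E := lsum_incl
          (fun n => isq n * (if Req_EM_T (ln (INR n) - ln (INR q)) 0 then 1 else 0))
          [q] (seq 1 N)).
        simpl in E; destruct (Req_EM_T (ln (INR q) - ln (INR q)) 0) as [_|Ne] in E.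
        2:{ exfalso; apply Ne; ring. }
        rewrite Rmult_1_r, Rplus_0_r in E; apply E; [repeat constructor; easy| |exact Hnn].
        intros x [<-|[]]; apply in_seq; lia.
    + apply Rle_trans with 0; [|now apply lsum_nonneg].
      assert (PN : 0 < INR N).
      { destruct (Rle_lt_dec (INR N) 0) as [Hn|Hn]; [|easy].
        unfold ln in HL; destruct (Rlt_dec 0 (INR N)); lra. }
      assert (E : ln (INR N) <= ln (INR q)) by (apply ln_le; [easy|apply le_INR; lia]).
      assert (E2 : 1 <= ln (INR q) / ln (INR N)).
      { apply Rmult_le_reg_r with (ln (INR N)); [easy|].
        unfold Rdiv; rewrite Rmult_assoc, Rinv_l; lra. }
      assert (Q := isq_pos q Hq); nra.
  - assert (Hp' : forall r, In r ps -> is_prime r = true) by (intros r Hr; apply Hp; now right).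
    assert (Hp1 : (1 < p)%nat) by (apply is_prime_gt1, Hp; now left).
    assert (I1 := IH Hp' q Hq); assert (I2 := IH Hp' (p * q)%nat ltac:(nia)).
    set (Pi := lprod (fun p => 1 + k / INR p) ps) in *.
    set (S := lsum (fun p => k * (ln (INR p) / INR p)) ps) in *.
    assert (Pp : 0 < INR p) by (apply lt_0_INR; lia).
    assert (Pip : 0 < / INR p) by (apply Rinv_0_lt_compat; easy).
    assert (Hlp : 0 <= ln (INR p)).
    { rewrite <- ln_1; apply ln_le; [lra|]; change 1 with (INR 1); apply le_INR; lia. }
    assert (HPi : 0 < Pi).
    { apply lprod_pos; intros r Hr; assert (R1 := is_prime_gt1 r (Hp' r Hr)).
      assert (0 < / INR r) by (apply Rinv_0_lt_compat, lt_0_INR; lia); unfold Rdiv; nra. }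
    assert (Ip := isq_pos p ltac:(lia)); assert (Iq := isq_pos q Hq).
    assert (Ipq : isq (p * q) = isq p * isq q).
    { unfold isq; rewrite mult_INR, sqrt_mult by apply pos_INR; apply Rinv_mult. }
    assert (Ipp : isq p * isq p = / INR p) by (rewrite <- isq_sqr by lia; ring).
    (* Of the three terms at [p], the first keeps [q], the second turns it into [p q], and the
       nonnegative third is dropped. This is why the induction ranges over all [q]. *)
    apply Rle_trans with
      (lsum (fun n => isq n * dual_mean k ps (ln (INR n) - ln (INR q))) (seq 1 N)
       + k * isq p * lsum (fun n => isq n * dual_mean k ps (ln (INR n) - ln (INR (p * q)))) (seq 1 N)).
    + rewrite ln_INR_mult in * by lia; rewrite Ipq in I2.
      apply (Rmult_le_compat_l (k * isq p)) in I2; [|nra].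
      change (lprod ?f (p :: ps)) with (f p * Pi); change (lsum ?f (p :: ps)) with (f p + S); cbv beta.
      set (lN := ln (INR N)) in *; set (lp := ln (INR p)) in *; set (lq := ln (INR q)) in *.
      eapply Rle_trans; [|apply Rplus_le_compat; [apply I1|apply I2]].
      replace (k * isq p * (isq p * isq q * Pi * (1 - (lp + lq + S) / lN)))
        with (k * (isq p * isq p) * (isq q * Pi) * (1 - (lp + lq + S) / lN)) by ring.
      rewrite Ipp; set (v := / INR p) in *; unfold Rdiv; fold v.
      set (w := / lN); assert (Pw : 0 < w) by (apply Rinv_0_lt_compat; easy).
      assert (Pqp : 0 < isq q * Pi) by nra.
      assert (Hkv : 0 < k * v) by nra.
      (* The two sides differ by exactly [(k v)^2 lp w]. *)
      assert (E : (1 + k * v) * (1 - (lq + (k * (lp * v) + S)) * w)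
                  <= (1 - (lq + S) * w) + k * v * (1 - (lp + lq + S) * w)).
      { assert (0 <= k * v * (k * v) * (lp * w)) by (apply Rmult_le_pos; nra).
        nra. }
      replace (isq q * ((1 + k * v) * Pi) * (1 - (lq + (k * (lp * v) + S)) * w))
        with (isq q * Pi * ((1 + k * v) * (1 - (lq + (k * (lp * v) + S)) * w))) by ring.
      replace (isq q * Pi * (1 - (lq + S) * w) + k * v * (isq q * Pi) * (1 - (lp + lq + S) * w))
        with (isq q * Pi * ((1 - (lq + S) * w) + k * v * (1 - (lp + lq + S) * w))) by ring.
      apply Rmult_le_compat_l; lra.
    + rewrite <- lsum_scal, <- lsum_plus; apply lsum_le; intros n Hn; apply in_seq in Hn.
      simpl dual_mean; rewrite ln_INR_mult by lia.
      replace (ln (INR n) - ln (INR q) - ln (INR p)) with (ln (INR n) - (ln (INR p) + ln (INR q))) by ring.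
      assert (D := dual_mean_nonneg k ps (ln (INR n) - ln (INR q) + ln (INR p)) Hk Hp').
      assert (In' := isq_pos n ltac:(lia)).
      assert (0 <= isq n * ((k - 1) * isq p * dual_mean k ps (ln (INR n) - ln (INR q) + ln (INR p)))).
      { apply Rmult_le_pos; [lra|]; apply Rmult_le_pos; nra. }
      nra.
Qed.

(** The exponent is that of [|G_p|^(2k/(2k-1))], dual to [2k]. Expanding to second order gives a
    mean of [1 + k^2 / ((2k-1) p)] plus a third-order error, again placed in the constant
    coefficient. *)
Lemma dual_factor_bound k t p : 2 <= k -> (1 <= p)%nat -> k * isq p <= / 16 ->
  0 < Cmod (dual_factor k t p) ^ 2 /\
  Rpower (Cmod (dual_factor k t p) ^ 2) (k / (2 * k - 1))
  <= trig2 (fun p => 1 + k ^ 2 / (2 * k - 1) * / INR p + 90 * k ^ 3 * isq p ^ 3)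
           (fun p => 2 * k * isq p)
           (fun p => / INR p * (k - k / (2 * k - 1)) / 2) t p.
Proof.
  intros Hk Hp Hq.
  unfold Cmod; rewrite <- Rsqr_pow2, Rsqr_sqrt by (apply Rplus_le_le_0_compat; apply pow2_ge_0).
  unfold dual_factor, trig2; simpl fst; simpl snd.
  assert (Hpos := isq_pos p Hp); rewrite <- (isq_sqr p Hp).
  rewrite cos_double.
  set (th := t * ln (INR p)) in *.
  assert (E := sin2_cos2 th); unfold Rsqr in E; assert (Hc := COS_bound th).
  set (rho := isq p) in *; set (c := cos th) in *; set (s := sin th) in *.
  assert (Es : s ^ 2 = 1 - c ^ 2) by (simpl; lra).
  assert (Hc2 : 0 <= c ^ 2 <= 1) by nra.
  set (q := k * rho) in *; assert (Pq : 0 < q) by (unfold q; nra).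
  set (w := 2 * (2 * k - 1) * rho * c + rho ^ 2 * ((2 * k - 1) ^ 2 * c ^ 2 + (1 - c ^ 2))).
  replace ((1 + (2 * k - 1) * rho * c) ^ 2 + (- (rho * s)) ^ 2) with (1 + w).
  2:{ unfold w; replace ((- (rho * s)) ^ 2) with (rho ^ 2 * s ^ 2) by ring; rewrite Es; ring. }
  set (r := k / (2 * k - 1)).
  assert (Hr : 0 < r <= 2 / 3).
  { unfold r; split; [apply Rdiv_lt_0_compat; lra|].
    apply Rmult_le_reg_r with (2 * k - 1); [lra|].
    unfold Rdiv; rewrite Rmult_assoc, Rinv_l; lra. }
  assert (Era : r * (2 * k - 1) = k) by (unfold r; field; lra).
  set (b := (2 * k - 1) * rho).
  assert (Hb : 0 < b <= 2 * q) by (unfold b, q; nra).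
  assert (Hrho : 0 < rho <= q / 2) by (unfold q; nra).
  set (m := rho ^ 2 * ((2 * k - 1) ^ 2 * c ^ 2 + (1 - c ^ 2))).
  assert (Em : m = b ^ 2 * c ^ 2 + rho ^ 2 * (1 - c ^ 2)) by (unfold m, b; ring).
  assert (Hm : 0 <= m <= 4 * q ^ 2).
  { rewrite Em; assert (b ^ 2 <= 4 * q ^ 2) by nra; assert (rho ^ 2 <= 4 * q ^ 2) by nra.
    assert (0 <= b ^ 2) by apply pow2_ge_0; assert (0 <= rho ^ 2) by apply pow2_ge_0. nra. }
  assert (Ew : w = 2 * b * c + m) by (unfold w, b, m; ring).
  assert (Hbc : - (2 * q) <= b * c <= 2 * q) by nra.
  assert (Hw : Rabs w <= 17 / 4 * q) by (rewrite Ew; apply Rabs_le; nra).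
  assert (Hw' := Hw); apply Rabs_le_between in Hw'.
  split; [lra|].
  assert (L := ln_taylor2 w ltac:(lra)).
  assert (W3 := Rabs_pow3_le w _ Hw).
  replace ((17 / 4 * q) ^ 3) with (4913 / 64 * q ^ 3) in W3 by field.
  assert (Pq3 : 0 < q ^ 3) by (apply pow_lt; easy).
  assert (W2 : 4 * b ^ 2 * c ^ 2 - 32 * q ^ 3 <= w ^ 2).
  { rewrite Ew; replace ((2 * b * c + m) ^ 2) with (4 * b ^ 2 * c ^ 2 + (4 * (b * c) * m + m ^ 2)) by ring.
    assert (- (8 * q ^ 3) <= (b * c) * m).
    { replace (8 * q ^ 3) with (2 * q * (4 * q ^ 2)) by ring; nra. }
    assert (0 <= m ^ 2) by apply pow2_ge_0; lra. }
  set (x := 2 * q * c + r * rho ^ 2 * (1 - c ^ 2) - k * (2 * k - 1) * rho ^ 2 * c ^ 2 + 62 * q ^ 3).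
  assert (H1 : r * ln (1 + w) <= x).
  { apply Rle_trans with (r * (w - 2 * b ^ 2 * c ^ 2 + 93 * q ^ 3)); [apply Rmult_le_compat_l; lra|].
    assert (E1 : r * (w - 2 * b ^ 2 * c ^ 2) =
      2 * q * c + r * rho ^ 2 * (1 - c ^ 2) - k * (2 * k - 1) * rho ^ 2 * c ^ 2).
    { assert (Erb : r * b = k * rho) by (unfold b; rewrite <- Rmult_assoc, Era; easy).
      rewrite Ew, Em.
      transitivity (2 * (r * b) * c + r * rho ^ 2 * (1 - c ^ 2) - r * b * b * c ^ 2); [ring|].
      rewrite Erb; unfold b, q; ring. }
    unfold x; nra. }
  unfold Rpower; eapply Rle_trans; [apply exp_le, H1|].
  set (y := r * rho ^ 2 * (1 - c ^ 2) - k * (2 * k - 1) * rho ^ 2 * c ^ 2 + 62 * q ^ 3).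
  assert (Ex : x = 2 * q * c + y) by (unfold x, y; ring).
  assert (Hy : Rabs y <= 25 / 4 * q ^ 2).
  { assert (Y1 : 0 <= r * rho ^ 2 * (1 - c ^ 2) <= / 4 * q ^ 2).
    { assert (0 <= rho ^ 2 <= / 4 * q ^ 2) by nra.
      assert (0 <= r * rho ^ 2 <= / 4 * q ^ 2) by nra. nra. }
    assert (Y2 : 0 <= k * (2 * k - 1) * rho ^ 2 * c ^ 2 <= 2 * q ^ 2).
    { assert (0 <= k * (2 * k - 1) * rho ^ 2 <= 2 * q ^ 2).
      { replace (k * (2 * k - 1) * rho ^ 2) with (q * b) by (unfold q, b; ring); nra. }
      nra. }
    assert (Y3 : 62 * q ^ 3 <= 62 / 16 * q ^ 2).
    { replace (q ^ 3) with (q ^ 2 * q) by ring; assert (0 <= q ^ 2) by apply pow2_ge_0; nra. }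
    unfold y; apply Rabs_le; lra. }
  apply Rabs_le_between in Hy.
  assert (Hq2 : q ^ 2 <= / 16 * q) by nra.
  assert (Hx : Rabs x <= 12 / 5 * q) by (rewrite Ex; apply Rabs_le; nra).
  assert (Hx' := Hx); apply Rabs_le_between in Hx'.
  eapply Rle_trans; [apply exp_taylor2; lra|].
  assert (X3 := Rabs_pow3_le x _ Hx).
  replace ((12 / 5 * q) ^ 3) with (1728 / 125 * q ^ 3) in X3 by field.
  assert (X2 : x ^ 2 <= 4 * q ^ 2 * c ^ 2 + 28 * q ^ 3).
  { rewrite Ex; replace ((2 * q * c + y) ^ 2) with (4 * q ^ 2 * c ^ 2 + (4 * q * (c * y) + y ^ 2)) by ring.
    assert (c * y <= 25 / 4 * q ^ 2) by nra.
    assert (4 * q * (c * y) <= 4 * q * (25 / 4 * q ^ 2)) by (apply Rmult_le_compat_l; lra).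
    assert (y ^ 2 <= (25 / 4 * q ^ 2) * (25 / 4 * q ^ 2)) by nra.
    assert (q ^ 2 * q ^ 2 <= / 16 * q ^ 3).
    { replace (q ^ 2 * q ^ 2) with (q ^ 3 * q) by ring; nra. }
    nra. }
  assert (Ek : k ^ 2 / (2 * k - 1) = (k + r) / 2) by (unfold r; field; lra).
  rewrite Ek; replace (90 * k ^ 3 * rho ^ 3) with (90 * q ^ 3) by (unfold q; ring).
  replace (2 * k * rho * c) with (2 * q * c) by (unfold q; ring).
  (* Half the square of the linear term, [2 q^2 c^2], cancels against the second-order term of the
     logarithm up to [k rho^2 c^2]. So the mean is [1 + O(k/p)] rather than [1 + O(k^2/p)] to second
     order, the sign that [G] is nearly extremal. *)
  assert (Eq2 : k * (2 * k - 1) * rho ^ 2 * c ^ 2 = 2 * q ^ 2 * c ^ 2 - k * rho ^ 2 * c ^ 2)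
    by (unfold q; ring).
  unfold x in X2, X3 |- *; rewrite Eq2 in *; nra.
Qed.

(** Either the first summand or the second dominates the left side: Young's inequality without sharp
    constants, a loss of [e^O(k)] in the result. In the application [x = |F|^2] and [y = |G|^2], so
    the exponents are [2k] and [2k/(2k-1)]. *)
Lemma Young_dual x y mu k : 0 <= x -> 0 < y -> 0 < mu -> 2 <= k ->
  sqrt x * sqrt y
  <= mu * rpow x k + Rpower mu (- / (2 * k - 1)) * Rpower y (k / (2 * k - 1)).
Proof.
  intros [Hx|<-] Hy Hmu Hk.
  2:{ rewrite sqrt_0, Rmult_0_l; apply Rplus_le_le_0_compat.
      - apply Rmult_le_pos; [lra|apply rpow_nonneg].
      - left; apply Rmult_lt_0_compat; apply Rpower_pos. }
  rewrite rpow_pos, <- !Rpower_sqrt by easy.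
  assert (P1 := Rpower_pos mu (- / (2 * k - 1))); assert (P2 := Rpower_pos y (k / (2 * k - 1))).
  assert (P3 := Rpower_pos x k).
  unfold Rpower; rewrite <- !exp_plus.
  destruct (Rle_lt_dec (/ 2 * ln x + / 2 * ln y) (ln mu + k * ln x)) as [H|H].
  - apply exp_le in H; rewrite (exp_plus (ln mu)), exp_ln in H by easy.
    eapply Rle_trans; [apply H|].
    assert (0 < exp (- / (2 * k - 1) * ln mu + k / (2 * k - 1) * ln y)) by apply exp_pos; lra.
  - assert (E : / 2 * ln x + / 2 * ln y <= - / (2 * k - 1) * ln mu + k / (2 * k - 1) * ln y).
    { apply Rmult_le_reg_r with (2 * k - 1); [lra|].
      replace ((- / (2 * k - 1) * ln mu + k / (2 * k - 1) * ln y) * (2 * k - 1))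
        with (- ln mu + k * ln y) by (field; lra).
      nra. }
    apply exp_le in E; eapply Rle_trans; [apply E|].
    assert (0 < mu * exp (k * ln x)) by (apply Rmult_lt_0_compat; [easy|apply exp_pos]); lra.
Qed.

Lemma Cmod_dual k ps t :
  Cmod (dual k ps t) ^ 2 = lprod (fun p => Cmod (dual_factor k t p) ^ 2) ps.
Proof.
  induction ps as [|p ps IH]; [simpl; rewrite Cmod_1; ring|].
  change (dual k (p :: ps) t) with (dual_factor k t p * dual k ps t)%C.
  rewrite Cmod_mult, Rpow_mult_distr, IH; easy.
Qed.

Lemma dual_pairing N k ps t :
  lsum (fun n => isq n * fst (cis (t * ln (INR n)) * dual k ps t)%C) (seq 1 N)
  = DirRe N t * fst (dual k ps t) + DirIm N t * snd (dual k ps t).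
Proof.
  unfold DirRe, DirIm; rewrite !dsum_lsum.
  rewrite !(Rmult_comm (lsum _ _)), <- !lsum_scal, <- lsum_plus.
  apply lsum_ext; intros n _; destruct (dual k ps t) as [g h]; unfold isq, cis, Cmult; simpl; ring.
Qed.

Lemma Cauchy_Schwarz2 a b c d :
  a * c + b * d <= sqrt (a ^ 2 + b ^ 2) * sqrt (c ^ 2 + d ^ 2).
Proof.
  assert (P1 := Rplus_le_le_0_compat _ _ (pow2_ge_0 a) (pow2_ge_0 b)).
  assert (P2 := Rplus_le_le_0_compat _ _ (pow2_ge_0 c) (pow2_ge_0 d)).
  rewrite <- sqrt_mult by easy.
  eapply Rle_trans; [apply Rle_abs|].
  rewrite <- sqrt_Rsqr_abs; apply sqrt_le_1_alt; unfold Rsqr.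
  assert (Q := pow2_ge_0 (a * d - b * c)); nra.
Qed.

Lemma pseudomoment_dual_lower k N ps a b D :
  2 <= k -> 0 < a -> 0 < b ->
  is_mean D b -> (forall t, 0 < Cmod (dual k ps t) ^ 2
    /\ Rpower (Cmod (dual k ps t) ^ 2) (k / (2 * k - 1)) <= D t) ->
  a <= lsum (fun n => isq n * dual_mean k ps (ln (INR n))) (seq 1 N) ->
  a / 4 * Rpower (a / (8 * b)) (2 * k - 1) <= pseudomoment k N.
Proof.
  intros Hk Ha Hb HD HDt Hm.
  set (H := fun t => lsum (fun n => isq n * fst (cis (t * ln (INR n)) * dual k ps t)%C) (seq 1 N)).
  assert (HH : is_mean H (lsum (fun n => isq n * dual_mean k ps (ln (INR n))) (seq 1 N))).
  { apply (is_mean_lsum (fun n t => isq n * fst (cis (t * ln (INR n)) * dual k ps t)%C)).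
    intros n; apply is_mean_scal, is_mean_dual. }
  (* Chosen so that the second summand averages to at most [a/4], half of the [a/2] available on the
     left. *)
  set (mu := Rpower (8 * b / a) (2 * k - 1)).
  assert (Hmu : 0 < mu) by apply Rpower_pos.
  assert (Hab : 0 < 8 * b / a) by (apply Rdiv_lt_0_compat; lra).
  assert (Emu : Rpower mu (- / (2 * k - 1)) = a / (8 * b)).
  { unfold mu; rewrite Rpower_mult.
    replace ((2 * k - 1) * - / (2 * k - 1)) with (Ropp 1) by (field; lra).
    rewrite Rpower_Ropp, Rpower_1 by easy; field; lra. }
  assert (Einv : Rpower (a / (8 * b)) (2 * k - 1) = / mu).
  { unfold mu; rewrite <- Rpower_Ropp; unfold Rpower; f_equal.
    replace (a / (8 * b)) with (/ (8 * b / a)) by (field; lra).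
    rewrite ln_Rinv by easy; ring. }
  destruct (is_mean_lower H _ (a / 2) HH ltac:(lra)) as [n1 H1].
  destruct (is_mean_upper D b (2 * b) HD ltac:(lra)) as [n2 H2].
  apply pseudomoment_ge; [lra|].
  exists (n1 + n2)%nat; intros n Hn.
  specialize (H1 n ltac:(lia)); specialize (H2 n ltac:(lia)).
  assert (CP := cont_DirPow k N ltac:(lra)).
  assert (HA : Avg H n <= mu * Avg (DirPow k N) n + a / (8 * b) * Avg D n).
  { rewrite <- !Avg_scal, <- Avg_plus by
      (first [apply HD | easy | (apply cont_mult; [apply cont_const|first [apply HD|easy]])]).
    apply Avg_le; [apply HH| |].
    - apply cont_plus; (apply cont_mult; [apply cont_const|first [apply HD|easy]]).
    - intros t; destruct (HDt t) as [D1 D2].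
      assert (Dx := Rplus_le_le_0_compat _ _ (pow2_ge_0 (DirRe N t)) (pow2_ge_0 (DirIm N t))).
      assert (Y := Young_dual _ _ mu k Dx D1 Hmu Hk).
      rewrite Emu in Y.
      unfold H; rewrite dual_pairing; eapply Rle_trans; [apply Cauchy_Schwarz2|].
      assert (EC : fst (dual k ps t) ^ 2 + snd (dual k ps t) ^ 2 = Cmod (dual k ps t) ^ 2).
      { unfold Cmod; rewrite <- (Rsqr_pow2 (sqrt _)), Rsqr_sqrt; [easy|].
        apply Rplus_le_le_0_compat; apply pow2_ge_0. }
      rewrite EC; eapply Rle_trans; [apply Y|].
      apply Rplus_le_compat_l, Rmult_le_compat_l; [left; apply Rdiv_lt_0_compat; lra|easy]. }
  assert (HB : a / (8 * b) * Avg D n <= a / 4).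
  { replace (a / 4) with (a / (8 * b) * (2 * b)) by (field; lra).
    apply Rmult_le_compat_l; [left; apply Rdiv_lt_0_compat; lra|easy]. }
  rewrite Einv; apply Rmult_le_reg_l with mu; [easy|].
  replace (mu * (a / 4 * / mu)) with (a / 4) by (field; lra); lra.
Qed.

Lemma ln_one_plus_ge x : 0 <= x -> x - x ^ 2 <= ln (1 + x).
Proof.
  intros Hx; assert (E := ln_le_sub (/ (1 + x)) ltac:(apply Rinv_0_lt_compat; lra)).
  rewrite ln_Rinv in E by lra.
  assert (E2 : / (1 + x) - 1 <= - x + x ^ 2).
  { apply Rmult_le_reg_r with (1 + x); [lra|].
    rewrite Rmult_minus_distr_r, Rinv_l by lra.
    assert (0 <= x ^ 3) by (apply pow_le; easy); nra. }
  lra.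
Qed.

(** With [S1 = sum 1/p] and up to third-order errors, the pairing is at least [exp (k S1) / 2] and
    the dual norm contributes [exp (k^2/(2k-1) S1)]. Hölder's exponents combine to
    [2k * k S1 - k^2 S1 = k^2 S1]. The 182 is [2 * 90] from the dual norm plus 2 from
    [ln (1 + x) >= x - x^2]; [20 k] pays for the powers of 2. *)
Lemma lower_bound_core k N ps : 2 <= k -> 0 < ln (INR N) -> primes_list ps ->
  (forall p, In p ps -> k * isq p <= / 16) ->
  lsum (fun p => k * (ln (INR p) / INR p)) ps <= / 2 * ln (INR N) ->
  exp (k ^ 2 * lsum (fun p => / INR p) ps - 182 * k ^ 4 * lsum (fun p => isq p ^ 3) ps - 20 * k)
  <= pseudomoment k N.
Proof.
  intros Hk HL Hps Hsm Hlog.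
  assert (Hpp : forall p, In p ps -> (1 < p)%nat) by (intros p Hp; now apply is_prime_gt1, Hps).
  set (Pi := lprod (fun p => 1 + k / INR p) ps).
  assert (Hinv : forall p, In p ps -> 0 < / INR p).
  { intros p Hp; specialize (Hpp p Hp); apply Rinv_0_lt_compat, lt_0_INR; lia. }
  set (S1 := lsum (fun p => / INR p) ps); set (S3 := lsum (fun p => isq p ^ 3) ps).
  set (c0 := fun p => 1 + k ^ 2 / (2 * k - 1) * / INR p + 90 * k ^ 3 * isq p ^ 3).
  set (b := lprod c0 ps).
  assert (Hc0 : forall p, In p ps ->
    1 <= c0 p <= exp (k ^ 2 / (2 * k - 1) * / INR p + 90 * k ^ 3 * isq p ^ 3)).
  { intros p Hp; assert (I1 := Hinv p Hp); specialize (Hpp p Hp).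
    assert (0 < isq p ^ 3) by (apply pow_lt, isq_pos; lia).
    assert (0 < k ^ 3) by (apply pow_lt; lra).
    assert (0 < k ^ 2 / (2 * k - 1)) by (apply Rdiv_lt_0_compat; nra).
    assert (0 < k ^ 2 / (2 * k - 1) * / INR p) by (apply Rmult_lt_0_compat; easy).
    assert (0 < 90 * k ^ 3 * isq p ^ 3) by (apply Rmult_lt_0_compat; lra).
    unfold c0; split; [lra|].
    eapply Rle_trans; [|apply exp_ineq1_le]; lra. }
  assert (Hb : 0 < b).
  { apply lprod_pos; intros p Hp; destruct (Hc0 p Hp); lra. }
  assert (Hlnb : ln b <= k ^ 2 / (2 * k - 1) * S1 + 90 * k ^ 3 * S3).
  { unfold S1, S3; rewrite <- !lsum_scal, <- lsum_plus.
    rewrite <- (ln_exp (lsum _ _)); apply ln_le; [easy|].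
    apply lprod_le_exp; intros p Hp; destruct (Hc0 p Hp); split; lra. }
  assert (HPi : exp (k * S1 - k ^ 2 * S3) <= Pi).
  { replace (k * S1 - k ^ 2 * S3) with (lsum (fun p => k * / INR p + - k ^ 2 * isq p ^ 3) ps)
      by (rewrite lsum_plus, !lsum_scal; unfold S1, S3; ring).
    rewrite <- lprod_exp; apply lprod_le; intros p Hp; split; [left; apply exp_pos|].
    assert (I1 := Hinv p Hp).
    assert (Hx : 0 <= k * / INR p) by nra.
    assert (E := ln_one_plus_ge _ Hx).
    rewrite <- (exp_ln (1 + k / INR p)) by (unfold Rdiv; lra).
    apply exp_le; unfold Rdiv; eapply Rle_trans; [|apply E].
    assert (E2 := inv_sqr_le_isq3 p ltac:(specialize (Hpp p Hp); lia)).
    rewrite Rpow_mult_distr; nra. }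
  assert (PPi : 0 < Pi) by (eapply Rlt_le_trans; [apply exp_pos|apply HPi]).
  assert (HlnPi : k * S1 - k ^ 2 * S3 <= ln Pi).
  { rewrite <- (ln_exp (k * S1 - k ^ 2 * S3)); apply ln_le; [apply exp_pos|easy]. }
  set (a := / 2 * Pi).
  assert (Hmean : a <= lsum (fun n => isq n * dual_mean k ps (ln (INR n))) (seq 1 N)).
  { assert (E := dual_mean_sum_ge k N ps ltac:(lra) HL (proj2 Hps) 1 ltac:(lia)).
    fold Pi in E; simpl (INR 1) in E; rewrite ln_1, Rplus_0_l in E.
    replace (isq 1) with 1 in E by (unfold isq; simpl; rewrite sqrt_1; field).
    rewrite (lsum_ext (fun n => isq n * dual_mean k ps (ln (INR n) - 0))
               (fun n => isq n * dual_mean k ps (ln (INR n)))) in E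
      by (intros; rewrite Rminus_0_r; easy).
    eapply Rle_trans; [|apply E].
    assert (E2 : lsum (fun p => k * (ln (INR p) / INR p)) ps / ln (INR N) <= / 2).
    { apply Rmult_le_reg_r with (ln (INR N)); [easy|].
      unfold Rdiv at 1; rewrite Rmult_assoc, Rinv_l; lra. }
    unfold a; nra. }
  set (D := fun t => lprod (trig2 c0 (fun p => 2 * k * isq p)
                 (fun p => / INR p * (k - k / (2 * k - 1)) / 2) t) ps).
  assert (HM : a / 4 * Rpower (a / (8 * b)) (2 * k - 1) <= pseudomoment k N).
  { apply (pseudomoment_dual_lower k N ps a b D); [easy|unfold a; lra|easy| | |easy].
    - now apply mean_prod_trig2.
    - intros t; rewrite Cmod_dual.
      assert (F : forall p, In p ps -> 0 < Cmod (dual_factor k t p) ^ 2).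
      { intros p Hp; apply dual_factor_bound; [easy|specialize (Hpp p Hp); lia|now apply Hsm]. }
      split; [now apply lprod_pos|].
      rewrite Rpower_lprod by easy.
      apply lprod_le; intros p Hp; split; [left; apply Rpower_pos|].
      apply dual_factor_bound; [easy|specialize (Hpp p Hp); lia|now apply Hsm]. }
  eapply Rle_trans; [|apply HM].
  assert (Ha : 0 < a) by (unfold a; lra).
  rewrite <- (exp_ln (a / 4)) by lra.
  unfold Rpower; rewrite <- exp_plus; apply exp_le.
  rewrite !ln_div, ln_mult by lra.
  assert (Ela : ln a = ln Pi - ln 2).
  { unfold a; rewrite ln_mult, ln_Rinv by lra; ring. }
  rewrite Ela.
  assert (L2 := ln_le_sub 2 ltac:(lra)).
  assert (E4 : ln 4 = 2 * ln 2) by (replace 4 with (2 * 2) by ring; rewrite ln_mult by lra; ring).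
  assert (E8 : ln 8 = 3 * ln 2) by (replace 8 with (2 * (2 * 2)) by ring; rewrite !ln_mult by lra; ring).
  rewrite E4, E8.
  assert (B1 : (2 * k - 1) * ln b <= k ^ 2 * S1 + 180 * k ^ 4 * S3).
  { assert (PS3 : 0 <= S3).
    { apply lsum_nonneg; intros p Hp; apply pow_le; left; apply isq_pos.
      specialize (Hpp p Hp); lia. }
    apply (Rmult_le_compat_l (2 * k - 1)) in Hlnb; [|lra].
    replace ((2 * k - 1) * (k ^ 2 / (2 * k - 1) * S1 + 90 * k ^ 3 * S3))
      with (k ^ 2 * S1 + (2 * k - 1) * 90 * k ^ 3 * S3) in Hlnb by (field; lra).
    assert (0 <= k ^ 3 * S3) by (apply Rmult_le_pos; [apply pow_le; lra|easy]).
    nra. }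
  assert (B2 : 2 * k * (k * S1 - k ^ 2 * S3) <= 2 * k * ln Pi) by (apply Rmult_le_compat_l; lra).
  assert (B3 : 2 * k ^ 3 * S3 <= 2 * k ^ 4 * S3).
  { assert (PS3 : 0 <= S3).
    { apply lsum_nonneg; intros p Hp; apply pow_le; left; apply isq_pos.
      specialize (Hpp p Hp); lia. }
    assert (0 <= k ^ 3 * S3) by (apply Rmult_le_pos; [apply pow_le; lra|easy]).
    replace (2 * k ^ 4 * S3) with (2 * k * (k ^ 3 * S3)) by ring; nra. }
  assert (B4 : (8 * k + 1) * ln 2 <= 8 * k + 1) by nra.
  nra.
Qed.

(** Here [ell] is [log log N]. Powers of [k] are bounded by powers of [ell], while [exp ell / (8k)]
    is at least [ell^3 / 2048]; this leaves room between [k^4] and [N^(1/(4k))]. *)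
Lemma prime_range_sizes k ell : 2 <= k -> 300 <= ell -> k <= sqrt ell ->
  257 * k ^ 4 + 1 <= exp (exp ell / (8 * k)) /\ 8 * k <= exp ell.
Proof.
  intros Hk Hl Hkl.
  assert (Hk2 : k ^ 2 <= ell).
  { rewrite <- (Rsqr_sqrt ell), Rsqr_pow2 by lra; apply pow_incr; lra. }
  assert (Hkl' : k <= ell) by nra.
  assert (E1 : (ell / 4) ^ 4 <= exp ell).
  { assert (E := exp_ge_nat_pow (ell / 4) ltac:(lra)).
    replace ell with (2 * (ell / 4) + 2 * (ell / 4)) at 2 by field.
    rewrite exp_plus; replace ((ell / 4) ^ 4) with ((ell / 4) ^ 2 * (ell / 4) ^ 2) by ring.
    apply Rmult_le_compat; try apply pow2_ge_0; easy. }
  assert (El2 : 90000 <= ell ^ 2) by nra.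
  assert (El3 : 300 * 90000 <= ell ^ 3) by (replace (ell ^ 3) with (ell * ell ^ 2) by ring; nra).
  assert (E4 : (ell / 4) ^ 4 = ell * ell ^ 3 / 256) by field.
  set (v := exp ell / (8 * k)).
  assert (Ev : ell ^ 3 / 2048 <= v).
  { unfold v; apply Rmult_le_reg_r with (8 * k); [lra|].
    replace (exp ell / (8 * k) * (8 * k)) with (exp ell) by (field; lra).
    apply Rle_trans with (ell ^ 3 / 2048 * (8 * ell)); [|lra].
    apply Rmult_le_compat_l; lra. }
  split.
  - assert (Ee := exp_ge_nat_pow (v / 2) ltac:(lra)).
    replace (2 * (v / 2)) with v in Ee by field.
    eapply Rle_trans; [|apply Ee].
    apply Rle_trans with ((ell ^ 3 / 4096) ^ 2).
    2:{ apply pow_incr; lra. }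
    replace ((ell ^ 3 / 4096) ^ 2) with (ell ^ 2 / 4096 * (ell ^ 2 / 4096) * ell ^ 2) by field.
    assert (Q : 258 <= ell ^ 2 / 4096 * (ell ^ 2 / 4096)) by nra.
    assert (Q2 : k ^ 4 <= ell ^ 2).
    { replace (k ^ 4) with ((k ^ 2) ^ 2) by ring; apply pow_incr; nra. }
    nra.
  - nra.
Qed.

Lemma lower_bound_main k N : 2 <= k -> 300 <= ln (ln (INR N)) -> 0 < ln (INR N) ->
  k <= sqrt (ln (ln (INR N))) ->
  exp (- k ^ 2 * ln k - k ^ 2 * ln (ln k) - 600 * k ^ 2) <= normmoment k N.
Proof.
  intros Hk Hl HL Hkl; set (L := ln (INR N)) in *.
  destruct (prime_range_sizes k (ln L) Hk Hl Hkl) as [HV H8]; rewrite exp_ln in HV, H8 by easy.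
  set (v := L / (8 * k)) in *.
  assert (Hv : 1 <= v).
  { unfold v; apply Rmult_le_reg_r with (8 * k); [lra|].
    unfold Rdiv; rewrite Rmult_assoc, Rinv_l; lra. }
  assert (Hk2 : 4 <= k ^ 2) by nra.
  assert (Hk4 : 16 <= k ^ 4) by (replace (k ^ 4) with (k ^ 2 * k ^ 2) by ring; nra).
  (* Makes [isq X <= 1 / (16 k^2)], which yields both [k isq p <= 1/16] and
     [k^4 sum p^(-3/2) = O(k^2)]. *)
  destruct (nfloor_ex (256 * k ^ 4) ltac:(lra)) as [X0 HX0].
  set (X := S X0).
  assert (HX : 256 * k ^ 4 <= INR X <= 257 * k ^ 4) by (unfold X; rewrite S_INR; lra).
  (* [exp (2 v) = N^(1/(4k))]: by [mertens_log] the cutoff loss [k sum log p / p] is at most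
     [2 k ln Y <= L / 2]. *)
  destruct (nfloor_ex (exp (2 * v)) ltac:(left; apply exp_pos)) as [Y HY].
  assert (Hev := exp_ineq1_le v).
  assert (HYv : exp v <= INR Y).
  { replace (2 * v) with (v + v) in HY by ring; rewrite exp_plus in HY; nra. }
  assert (HXY : (X <= Y)%nat) by (apply INR_le; lra).
  assert (HX2 : (2 <= X)%nat) by (apply INR_le; change (INR 2) with 2; lra).
  assert (HY2 : (2 <= Y)%nat) by lia.
  assert (PX : 0 < INR X) by lra; assert (PY : 0 < INR Y) by lra.
  assert (HiX : isq X <= / (16 * k ^ 2)) by (apply isq_le_of_large; [lra|lra]).
  assert (HlnY : v <= ln (INR Y) <= 2 * v).
  { split; [rewrite <- (ln_exp v); apply ln_le; [apply exp_pos|easy]|].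
    rewrite <- (ln_exp (2 * v)); apply ln_le; lra. }
  assert (Hl2 : / 2 <= ln k) by (apply Rle_trans with (ln 2); [left; exact ln_lt_2|apply ln_le; lra]).
  assert (HlnX : ln (INR X) <= 516 * ln k).
  { apply Rle_trans with (ln (257 * (k * k * (k * k)))); [apply ln_le; lra|].
    assert (0 < k * k) by nra.
    rewrite !ln_mult by nra; assert (E := ln_le_sub 257 ltac:(lra)); lra. }
  assert (HlX : 0 < ln (INR X)).
  { rewrite <- ln_1; apply ln_increasing; lra. }
  assert (Hcore := lower_bound_core k N (PR X Y) Hk HL (PR_primes X Y)).
  assert (C1 : forall p, In p (PR X Y) -> k * isq p <= / 16).
  { intros p Hp; apply in_PR in Hp.
    assert (E : isq p <= isq X) by (apply isq_decr; lia).
    apply Rle_trans with (k * / (16 * k ^ 2)); [apply Rmult_le_compat_l; lra|].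
    replace (k * / (16 * k ^ 2)) with (/ (16 * k)) by (field; lra).
    apply Rinv_le_contravar; lra. }
  assert (C2 : lsum (fun p => k * (ln (INR p) / INR p)) (PR X Y) <= / 2 * L).
  { rewrite lsum_scal.
    assert (E := mertens_log Y ltac:(lia)).
    rewrite (PR_split 0 X Y), lsum_app in E by lia.
    assert (E0 : 0 <= lsum (fun p => ln (INR p) / INR p) (PR 0 X)).
    { apply lsum_nonneg; intros p Hp; apply PR_primes, is_prime_gt1 in Hp.
      assert (1 <= INR p) by (change 1 with (INR 1); apply le_INR; lia).
      apply Rdiv_le_0_compat; [rewrite <- ln_1; apply ln_le; lra|lra]. }
    replace (/ 2 * L) with (k * (4 * v)) by (unfold v; field; lra).
    apply Rmult_le_compat_l; lra. }
  specialize (Hcore C1 C2).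
  assert (HS3 := sum_isq3 X (PR X Y) ltac:(lia) (proj1 (PR_primes X Y))
                  (fun p Hp => proj1 (proj1 (proj1 (in_PR X Y p) Hp)))).
  set (S3 := lsum (fun p => isq p ^ 3) (PR X Y)) in *.
  set (tau := ln L - ln k - ln (ln k)).
  (* The 532 is [4 + 6] from Mertens, 7 for [ln 8] and 515 for [ln 516]. *)
  assert (HS1 : tau - 532 <= lsum (fun p => / INR p) (PR X Y)).
  { assert (M1 := mertens_lower Y HY2); assert (M2 := mertens_upper X HX2).
    rewrite (PR_split 0 X Y), lsum_app in M1 by lia.
    assert (Q1 : ln v <= ln (ln (INR Y))) by (apply ln_le; lra).
    assert (Q2 : ln v = ln L - ln (8 * k)) by (unfold v; apply ln_div; lra).
    rewrite ln_mult in Q2 by lra.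
    assert (Q3 := ln_le_sub 8 ltac:(lra)).
    assert (Q4 : ln (ln (INR X)) <= ln (516 * ln k)) by (apply ln_le; lra).
    rewrite ln_mult in Q4 by lra; assert (Q5 := ln_le_sub 516 ltac:(lra)).
    unfold tau; lra. }
  assert (HT : 182 * k ^ 4 * S3 <= 23 * k ^ 2).
  { apply Rle_trans with (182 * k ^ 4 * (2 * / (16 * k ^ 2))); [apply Rmult_le_compat_l; lra|].
    replace (182 * k ^ 4 * (2 * / (16 * k ^ 2))) with (182 / 8 * k ^ 2) by (field; lra); lra. }
  assert (HM : exp (k ^ 2 * (tau - 570)) <= pseudomoment k N).
  { eapply Rle_trans; [|apply Hcore]; apply exp_le.
    assert (k ^ 2 * (tau - 532) <= k ^ 2 * lsum (fun p => / INR p) (PR X Y))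
      by (apply Rmult_le_compat_l; lra).
    assert (20 * k <= 10 * k ^ 2) by nra; lra. }
  unfold normmoment; fold L.
  apply Rmult_le_reg_r with (Rpower L (k ^ 2)); [apply Rpower_pos|].
  unfold Rdiv; rewrite Rmult_assoc, Rinv_l, Rmult_1_r by (assert (Z := Rpower_pos L (k ^ 2)); lra).
  eapply Rle_trans; [|apply HM].
  unfold Rpower; rewrite <- exp_plus; apply exp_le; unfold tau; nra.
Qed.

(** * Failure of the upper bound for larger [k] *)

Lemma upper_bound_fails A C2 N : exp (Rabs A + 2) <= C2 -> 100 + 2 * ln C2 <= ln (ln (INR N)) ->
  0 < ln (INR N) ->
  let k := C2 * ln (INR N) / ln (ln (INR N)) in
  exp (- k ^ 2 * ln k - k ^ 2 * ln (ln k) + A * k ^ 2) < normmoment k N.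
Proof.
  intros HC Hl HL k; set (L := ln (INR N)) in *; set (ell := ln L) in *.
  assert (EL : L = exp ell) by (unfold ell; rewrite exp_ln; easy).
  assert (HA := Rle_abs A); assert (HA0 := Rabs_pos A).
  assert (PC : 0 < C2) by (eapply Rlt_le_trans; [apply exp_pos|apply HC]).
  assert (HlC : Rabs A + 2 <= ln C2).
  { rewrite <- (ln_exp (Rabs A + 2)); apply ln_le; [apply exp_pos|easy]. }
  assert (HC1 : 1 <= C2).
  { eapply Rle_trans; [|apply HC]; rewrite <- exp_0; apply exp_le; lra. }
  assert (Pk : 0 < k) by (unfold k; apply Rdiv_lt_0_compat; nra).
  assert (HLl : (ell / 2) ^ 2 <= L).
  { rewrite EL; replace ell with (2 * (ell / 2)) at 2 by field; apply exp_ge_nat_pow; lra. }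
  assert (Hk : 25 <= k).
  { unfold k; apply Rmult_le_reg_r with ell; [lra|].
    unfold Rdiv; rewrite Rmult_assoc, Rinv_l by lra; nra. }
  assert (Elk : ln k = ln C2 + ell - ln ell).
  { unfold k; rewrite ln_div, ln_mult by nra; easy. }
  assert (Hll : ln ell <= ell / 2).
  { assert (E := ln_le_sub (ell / 4) ltac:(lra)).
    replace (ell / 4) with (ell * / 4) in E at 1 by field.
    rewrite ln_mult, ln_Rinv in E by lra; assert (E4 := ln_le_sub 4 ltac:(lra)); lra. }
  (* [ln (ln k)] makes up for the [- ln ell] in [ln k]; together they exceed [ell] by at least
     [ln C2 - 1]. *)
  assert (Hllk : ln ell - 1 <= ln (ln k)).
  { apply Rle_trans with (ln (ell * / 2)); [|apply ln_le; lra].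
    rewrite ln_mult, ln_Rinv by lra; assert (E := ln_le_sub 2 ltac:(lra)); lra. }
  assert (Hcore := lower_bound_core k N [] ltac:(lra) HL).
  simpl in Hcore; specialize (Hcore (conj (NoDup_nil _) (fun p (H : In p []) => False_ind _ H))
    (fun p (H : False) => False_ind _ H) ltac:(fold L; lra)).
  rewrite !Rmult_0_r, Rminus_0_r in Hcore.
  unfold normmoment; fold L.
  apply Rmult_lt_reg_r with (Rpower L (k ^ 2)); [apply Rpower_pos|].
  unfold Rdiv; rewrite (Rmult_assoc (pseudomoment k N)), Rinv_l, Rmult_1_r
    by (assert (Z := Rpower_pos L (k ^ 2)); lra).
  eapply Rlt_le_trans; [|apply Hcore].
  unfold Rpower; rewrite <- exp_plus; apply exp_increasing.
  fold ell.
  (* [k^2 ell] is the logarithm of the normalising factor. The excess [ln C2 - 1 >= |A| + 1] beats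
     [A], and [k >= 25] puts [-k^2] below [-20 k]. *)
  assert (Q : k ^ 2 * (A - (ln k + ln (ln k)) + ell) <= k ^ 2 * (- 1)).
  { apply Rmult_le_compat_l; [apply pow2_ge_0|lra]. }
  nra.
Qed.

Lemma eventually_INR_ge x : exists N0 : nat, forall N, (N0 <= N)%nat -> x <= INR N.
Proof.
  destruct (nfloor_ex (Rabs x) (Rabs_pos x)) as [m Hm]; exists (S m); intros N HN.
  assert (E : INR (S m) <= INR N) by now apply le_INR.
  rewrite S_INR in E; assert (Q := Rle_abs x); lra.
Qed.

Lemma eventually_loglog_ge x : exists N0 : nat, forall N, (N0 <= N)%nat ->
  0 < ln (INR N) /\ x <= ln (INR N) /\ x <= ln (ln (INR N)).
Proof.
  destruct (eventually_INR_ge (exp (exp x))) as [N0 H]; exists N0; intros N HN.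
  specialize (H N HN).
  assert (E : exp x <= ln (INR N)).
  { rewrite <- (ln_exp (exp x)); apply ln_le; [apply exp_pos|easy]. }
  assert (P0 := exp_pos x); assert (Q := exp_ineq1_le x).
  repeat split; [lra|lra|].
  rewrite <- (ln_exp x); apply ln_le; lra.
Qed.

Theorem theorem1 :
  (exists c : R, c > 0 /\
     exists A : R, exists N0 : nat, forall (N : nat) (k : R),
       (N0 <= N)%nat ->
       2 <= k -> k <= c * sqrt (ln (ln (INR N))) ->
       normmoment k N >=
         exp (- k ^ 2 * ln k - k ^ 2 * ln (ln k) - A * k ^ 2)) /\
  (exists C1 : R, C1 > 0 /\
     exists A : R, exists N0 : nat, forall (N : nat) (k : R),
       (N0 <= N)%nat ->
       2 <= k -> k <= C1 * ln (INR N) / ln (ln (INR N)) ->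
       normmoment k N <=
         exp (- k ^ 2 * ln k - k ^ 2 * ln (ln k) + A * k ^ 2)) /\
  (forall A : R, exists C0 : R, forall C2 : R, C2 >= C0 ->
     ~ (exists N0 : nat, forall N : nat, (N0 <= N)%nat ->
          let k := C2 * ln (INR N) / ln (ln (INR N)) in
          normmoment k N <=
            exp (- k ^ 2 * ln k - k ^ 2 * ln (ln k) + A * k ^ 2))).
Proof.
  split; [|split].
  - exists 1; split; [lra|]; exists 600.
    destruct (eventually_loglog_ge 300) as [N0 H]; exists N0; intros N k HN Hk Hc.
    destruct (H N HN) as (H1 & H2 & H3).
    apply Rle_ge, lower_bound_main; lra.
  - exists 1; split; [lra|]; exists 300.
    destruct (eventually_loglog_ge 100) as [N0 H]; exists N0; intros N k HN Hk Hc.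
    destruct (H N HN) as (H1 & H2 & H3).
    apply upper_bound_main; [easy|easy|].
    rewrite Rmult_1_l in Hc; exact Hc.
  (* [C0] depends on [A] alone. The bound fails at every large [N], in particular at one beyond the
     supposed threshold [N0]. *)
  - intros A; exists (exp (Rabs A + 2)); intros C2 HC2 [N0 H].
    destruct (eventually_loglog_ge (100 + 2 * ln C2)) as [N1 HN1].
    destruct (HN1 (N0 + N1)%nat ltac:(lia)) as (H1 & H2 & H3).
    specialize (H (N0 + N1)%nat ltac:(lia)); cbv zeta in H.
    assert (F := upper_bound_fails A C2 (N0 + N1) ltac:(lra) H3 H1); cbv zeta in F; lra.
Qed.
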